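(* There exists a constant $\alpha\in(0,1)$ such that for any $\eta\in(0,1)$, all integers $d\ge1$ and $s\ge1$, all $\sigma>0$, any $\boldsymbol\Sigma$ satisfying Assumptions $(\varepsilon^*0)$ and $(\varepsilon^*1)$ with $s\le\min\{\alpha d,\|\boldsymbol\Sigma\|_F\}$, and any $\boldsymbol\theta\in B_0(s,d)$, \[ \mathbf P_{\boldsymbol\theta,\boldsymbol\Sigma}\left((\hat N^*_\eta-\|\boldsymbol\theta\|_2)^2\le c_\eta\sigma^2\psi^*(s,\boldsymbol\Sigma)\right)\ge1-\eta, \] where $c_\eta>0$ is a constant depending only on $\eta$.
   Context: Model: one observes $\boldsymbol Y=\boldsymbol\theta+\sigma\boldsymbol\varepsilon\in\mathbb R^d$, $\boldsymbol\varepsilon\sim\mathcal N(\boldsymbol0,\boldsymbol\Sigma)$, $\boldsymbol\Sigma$ a covariance matrix with known diagonal entries $\sigma_i^2$ and known $\|\boldsymbol\Sigma\|_F$; $\sigma>0$ unknown. $B_0(s,d)=\{\boldsymbol\theta:\|\boldsymbol\theta\|_0\le s\}$. Assumption $(\varepsilon^*0)$: $\max_i\sigma_i^2\le1$; Assumption $(\varepsilon^*1)$: $\min_i\sigma_i^2\ge c_*$ for a constant $c_*>0$. $\tilde Y_i=Y_i/\sigma_i$; $\hat F_{Y^2}$ the empirical c.d.f. of $\tilde Y_1^2,\dots,\tilde Y_d^2$; $F$ the c.d.f. of $\chi^2_1$; $\hat\sigma_S^2(t)=t/F^{-1}(\hat F_{Y^2}(t))$ if $\hat F_{Y^2}(t)>0$,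 $+\infty$ otherwise; $\hat t=\min\{2^\ell:\ell\in\mathbb Z,\hat F_{Y^2}(2^\ell)\ge0.5\}$; $\hat\sigma_S^2=\hat\sigma_S^2(\hat t)$. For $a\in(0,1)$ let $q_a$ be the $a$-quantile of $\chi^2_1$. $\hat M=\min\{t:\hat F_{Y^2}(t)\ge0.5\}$, $\hat\sigma_\eta^2=\hat M/q_{1-\eta/20}$. $\tau_\eta=3\sqrt{\frac{q_{1-\eta/20}}{q_{\eta/20}}\log(1+\|\boldsymbol\Sigma\|_F^2/s^2)}$, $\alpha_{s,\eta}=\mathbf E[Z^2\mathbb 1\{|Z|\ge\tau_\eta\}]$ with $Z\sim\mathcal N(0,1)$, \[ \hat Q^*_\eta=\sum_{i=1}^dY_i^2\mathbb 1\{|Y_i|>\max\{\hat\sigma_S,\hat\sigma_\eta\}\sigma_i\tau_\eta\}-\hat\sigma_S^2\alpha_{s,\eta}\sum_{i=1}^d\sigma_i^2,\qquad\hat N^*_\eta=\sqrt{|\hat Q^*_\eta|}. \] $\psi^*(s,\boldsymbol\Sigma)=s\log(1+\|\boldsymbol\Sigma\|_F^2/s^2)$ if $s\le\|\boldsymbol\Sigma\|_F$, and $\frac{s}{1\vee\log(s/\|\boldsymbol\Sigma\|_F)}$ otherwise. *)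

(* Defs.v *)
From HB Require Import structures.
From mathcomp Require Import all_boot all_order all_algebra.
From mathcomp Require Import all_classical all_reals all_analysis.
Set Implicit Arguments. Unset Strict Implicit. Unset Printing Implicit Defensive.
Import Order.TTheory GRing.Theory Num.Theory.
Local Open Scope classical_set_scope.
Local Open Scope ring_scope.

Section Defs.
Context {R : realType}.

Definition gauss_law (v : R) (B : set R) : \bar R :=
  if v == 0 then (\1_B (0 : R))%:E else normal_prob 0 (Num.sqrt v) B.

Definition covariance_matrix (d : nat) (S : 'M[R]_d) : Prop :=
  S^T = S /\ forall u : 'I_d -> R, 0 <= \sum_i \sum_j u i * S i j * u j.

Definition gaussian_vector (d : nat) (dT : measure_display) (T : measurableType dT)
  (P : probability T R) (eps : 'I_d -> T -> R) (S : 'M[R]_d) : Prop :=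
  (forall i, measurable_fun [set: T] (eps i)) /\
  forall (u : 'I_d -> R) (B : set R), measurable B ->
    P [set w | B (\sum_i u i * eps i w)] =
    gauss_law (\sum_i \sum_j u i * S i j * u j) B.

Definition frob (d : nat) (S : 'M[R]_d) : R :=
  Num.sqrt (\sum_i \sum_j S i j ^+ 2).

Definition l2norm (d : nat) (x : 'I_d -> R) : R := Num.sqrt (\sum_i x i ^+ 2).

Definition sparse (d s : nat) (theta : 'I_d -> R) : Prop :=
  (#|[set i : 'I_d | theta i != 0%R]| <= s)%N.

Definition Fchi2 (t : R) : R := fine (normal_prob 0 1 [set x : R | x ^+ 2 <= t]).

Definition Fchi2_inv (p : R) : R := inf [set t : R | p <= Fchi2 t].

Definition qchi (a : R) : R := Fchi2_inv a.

Definition sig_i (d : nat) (S : 'M[R]_d) (i : 'I_d) : R := Num.sqrt (S i i).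

Definition Fhat (d : nat) (S : 'M[R]_d) (Y : 'I_d -> R) (t : R) : R :=
  (#|[set i : 'I_d | (Y i / sig_i S i) ^+ 2 <= t]|)%:R / d%:R.

Definition sigmaS2_at (d : nat) (S : 'M[R]_d) (Y : 'I_d -> R) (t : R) : R :=
  t / Fchi2_inv (Fhat S Y t).

Definition that (d : nat) (S : 'M[R]_d) (Y : 'I_d -> R) : R :=
  inf [set t : R | exists l : int, t = 2 ^ l /\ 1 / 2 <= Fhat S Y t].

Definition sigmaS2 (d : nat) (S : 'M[R]_d) (Y : 'I_d -> R) : R :=
  sigmaS2_at S Y (that S Y).

Definition Mhat (d : nat) (S : 'M[R]_d) (Y : 'I_d -> R) : R :=
  inf [set t : R | 1 / 2 <= Fhat S Y t].

Definition sigma_eta2 (eta : R) (d : nat) (S : 'M[R]_d) (Y : 'I_d -> R) : R :=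
  Mhat S Y / qchi (1 - eta / 20).

Definition tau (eta : R) (d : nat) (S : 'M[R]_d) (s : nat) : R :=
  3 * Num.sqrt (qchi (1 - eta / 20) / qchi (eta / 20) *
                ln (1 + frob S ^+ 2 / (s%:R) ^+ 2)).

Definition alpha_s_eta (eta : R) (d : nat) (S : 'M[R]_d) (s : nat) : R :=
  fine (\int[normal_prob 0 1]_(x in [set x : R | (tau eta S s <= `|x|)%R]) (x ^+ 2)%:E)%E.

Definition Qstar (eta : R) (d : nat) (S : 'M[R]_d) (s : nat) (Y : 'I_d -> R) : R :=
  \sum_i Y i ^+ 2 *
    (if Num.max (Num.sqrt (sigmaS2 S Y)) (Num.sqrt (sigma_eta2 eta S Y))
          * sig_i S i * tau eta S s < `|Y i| then 1 else 0)
  - sigmaS2 S Y * alpha_s_eta eta S s * \sum_i S i i.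

Definition Nstar (eta : R) (d : nat) (S : 'M[R]_d) (s : nat) (Y : 'I_d -> R) : R :=
  Num.sqrt `|Qstar eta S s Y|.

Definition psi_star (d : nat) (s : nat) (S : 'M[R]_d) : R :=
  if s%:R <= frob S then s%:R * ln (1 + frob S ^+ 2 / (s%:R) ^+ 2)
  else s%:R / Num.max 1 (ln (s%:R / frob S)).

End Defs.

(* Main.v *)
Require Import Defs.
From HB Require Import structures.
From mathcomp Require Import all_boot all_order all_algebra.
From mathcomp Require Import all_classical all_reals all_analysis.
From mathcomp Require Import measurable_realfun zify ring lra.
Import Order.TTheory GRing.Theory Num.Theory.
Import numFieldNormedType.Exports.
Local Open Scope classical_set_scope.
Local Open Scope ring_scope.
Set Implicit Arguments. Unset Strict Implicit. Unset Printing Implicit Defensive.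

(** Write F for the Frobenius norm of Sigma, L = ln (1 + F^2 / s^2) and z_i for the
    standardized noise.  Everything is reduced to second moments of sums
    sum_i w_i (f (z_i) - E f (Z)) with f an indicator or a truncated square.

    For f a combination of cosines, expanding E f (z_i) f (z_j) in powers of the correlation
    rho_ij gives nonnegative coefficients and no linear term, so the covariance is at most
    rho_ij^2 E f (Z)^2.  Both kinds of f are L2-limits of such combinations, so the variance is
    of order sum_ij w_i w_j rho_ij^2, that is, F^2 for weights bounded by Sigma_ii.

    With probability close to 1 the empirical quartiles of z_i^2 are within
    [q_(eta/20), q_(1-eta/20)], hence both scale estimates are comparable to sigma^2 and the
    threshold dominates 3 sigma sqrt L; coordinates in the support of theta then
    contribute an error of order sigma^2 s L.  On the remaining coordinates, if F >= c0 d, the mean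
    tail sum is already O(d exp (- 9 L / 8)) = O(s).  If F < c0 d, the estimate of sigma^2 has relative
    error O(F / d): hat t takes one of finitely many dyadic values, and Chebyshev applies at
    each.  Replacing the random threshold by its ideal value then costs the mass of an
    annulus of relative width F / d, and the centred tail sum has variance F^2 exp (- 9 L / 8) = O(s^2). *)

(** * Gaussian integrals *)

Section normal_integral.
Context {R : realType}.
Notation mu := (@lebesgue_measure R).
Implicit Types (m s : R).

(** No independence is available: [Sigma] is arbitrary, possibly singular, and the hypothesis only
    gives the laws of linear combinations of the noise. Cosines are adapted to this: the mean of a
    product of two cosines is read off from two linear combinations, so that neither a joint density
    nor a Hermite expansion enters. The other obstacle is that the threshold depends on all
    coordinates at once, so that no moment can be computed at it; it is compared with deterministic
    levels, where moments are available. The two scale estimates share the work. [sigma_eta2] is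
    crude but never far off, and the ratio of quantiles inside [tau] makes up for its
    underestimation; in the accurate regime it lies below [sigmaS2], so that the maximum is then the
    accurate estimate. The factor 3 in [tau] pays for the tail bounds, which have exponent t^2/8
    instead of t^2/2: since 3^2/8 >= 1 and exp (- L) <= (s/F)^2, the loss is harmless. *)

Lemma integral_normal_prob m s (f : R -> \bar R) (U : set R) :
  measurable U -> (normal_prob m s).-integrable U f ->
  (\int[normal_prob m s]_(x in U) f x =
   \int[mu]_(x in U) (f x * (normal_pdf m s x)%:E))%E.
Proof.
move=> mU intf.
rewrite -(Radon_Nikodym_change_of_variables (normal_prob_dominates m s))//=.
have mf := measurable_int _ intf.
apply: ae_eq_integral => //.
- apply: emeasurable_funM => //; apply: (measurable_int mu).
  apply: (integrableS _ _ (@subsetT _ _)) => //=.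
  by apply: Radon_Nikodym_integrable; exact: normal_prob_dominates.
- apply: emeasurable_funM => //=; apply/measurableT_comp => //=.
  by apply/measurable_funTS; exact: measurable_normal_pdf.
- apply: ae_eqe_mul2l => /=.
  rewrite Radon_NikodymE//=; first exact: normal_prob_dominates.
  move=> abmu.
  case: cid => /= h [h1 h2 h3].
  apply: integral_ae_eq => //=.
  + exact: integrableS h2.
  + by apply/measurable_funTS/measurableT_comp =>//; exact: measurable_normal_pdf.
  + by move=> E E01 mE; rewrite -h3.
Qed.

(** Form without integrability, for moments not yet known to be finite. The Radon-Nikodym derivative
    agrees almost everywhere with the density because both integrate to the same value on every
    measurable set. *)
Lemma ge0_integral_normal_prob m s (f : R -> \bar R) :
  measurable_fun setT f -> (forall x, 0 <= f x)%E ->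
  (\int[normal_prob m s]_x f x =
   \int[mu]_x (f x * (normal_pdf m s x)%:E))%E.
Proof.
move=> mf f0.
have nd := @normal_prob_dominates R m s.
rewrite -(@Radon_Nikodym_SigmaFinite.change_of_variables _ _ _ (normal_prob m s) mu nd)//.
have fi := Radon_Nikodym_SigmaFinite.f_integrable nd.
apply: ae_eq_integral => //.
- apply: emeasurable_funM => //; exact: (measurable_int _ fi).
- apply: emeasurable_funM => //=; apply/measurableT_comp => //=.
  exact: measurable_normal_pdf.
- apply: ae_eqe_mul2l => /=.
  apply: integral_ae_eq => //=.
  + by apply/measurableT_comp =>//; exact: measurable_normal_pdf.
  + by move=> E E01 mE; rewrite -Radon_Nikodym_SigmaFinite.f_integral.
Qed.

End normal_integral.

Section standard_normal.
Context {R : realType}.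
Implicit Types (m s : R).
Notation mu := (@lebesgue_measure R).
Notation N01 := (normal_prob (0 : R) 1).

Lemma normal_pdf01E (x : R) :
  normal_pdf 0 1 x = normal_peak 1 * expR (- (x ^+ 2 / 2)).
Proof.
rewrite normal_pdfE ?oner_neq0//; congr (_ * expR _).
by rewrite /normal_fun subr0 expr1n mulNr.
Qed.

Lemma normal_peak1_le : normal_peak 1 <= 2^-1 :> R.
Proof.
rewrite /normal_peak expr1n mul1r lef_pV2 ?posrE//; last first.
  by rewrite sqrtr_gt0 mulrn_wgt0 ?pi_gt0.
rewrite -[leLHS]ger0_norm// -sqrtr_sqr ler_sqrt; last first.
  by rewrite mulrn_wge0 ?pi_ge0.
by have := @pi_ge2 R; lra.
Qed.

Lemma ge0_integral_normal_prob_EFin m s (f : R -> R) :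
  measurable_fun [set: R] f -> (forall x, 0 <= f x) ->
  (\int[normal_prob m s]_x (f x)%:E =
   \int[mu]_x (f x * normal_pdf m s x)%:E)%E.
Proof.
move=> mf f0; rewrite (@ge0_integral_normal_prob R m s (EFin \o f))//.
exact/measurable_EFinP.
Qed.

Lemma measurable_expR_sqr (c : R) :
  measurable_fun [set: R] (fun x : R => expR (c * x ^+ 2)).
Proof. by apply: measurableT_comp => //; apply: measurable_funM. Qed.

(** The weight turns the standard density into sqrt 2 times the density of variance 2, so the exact
    value is sqrt 2. This exponential is the common envelope of all moment bounds and dominations
    below. *)
Lemma expect_expR_sqr_quarter :
  (\int[N01]_x (expR (x ^+ 2 / 4))%:E <= 2%:E)%E.
Proof.
have mE : measurable_fun [set: R] (fun x : R => expR (x ^+ 2 / 4)).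
  by under eq_fun do rewrite mulrC; exact: measurable_expR_sqr.
rewrite (ge0_integral_normal_prob_EFin _ _ mE)//.
have s2 : Num.sqrt 2 != 0 :> R by rewrite gt_eqF ?sqrtr_gt0.
rewrite -[leRHS]mule1 -(integral_normal_pdf (0 : R) (Num.sqrt 2)).
have mp k : measurable_fun [set: R] (fun x : R => normal_pdf 0 k x).
  exact: measurable_normal_pdf.
rewrite -ge0_integralZl//; last 2 first.
- by apply/measurable_EFinP; exact: measurable_normal_pdf.
- by move=> x _; rewrite lee_fin normal_pdf_ge0.
apply: ge0_le_integral => //=.
- by move=> x _; rewrite lee_fin mulr_ge0 ?expR_ge0 ?normal_pdf_ge0.
- by apply/measurable_EFinP; apply: measurable_funM => //; exact: mp.
- by under eq_fun do rewrite -EFinM; apply/measurable_EFinP; apply: measurable_funM => //; exact: mp.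
move=> x _; rewrite -!EFinM lee_fin normal_pdf01E normal_pdfE// /normal_fun subr0.
rewrite mulrCA -expRD sqr_sqrtr// mulrA.
have -> : x ^+ 2 / 4 - x ^+ 2 / 2 = - x ^+ 2 / (2 *+ 2).
  by rewrite (_ : 2 *+ 2 = 4 :> R); lra.
apply: ler_wpM2r; first exact: expR_ge0.
rewrite /normal_peak sqr_sqrtr// expr1n mul1r.
rewrite -{1}[2]invrK -invfM lef_pV2 ?posrE; last 2 first.
- by rewrite sqrtr_gt0 mulrn_wgt0// pi_gt0.
- by rewrite mulr_gt0// sqrtr_gt0 mulrn_wgt0// mulr_gt0 ?pi_gt0.
rewrite ler_pdivrMl//.
rewrite -[X in _ <= X * _]ger0_norm// -sqrtr_sqr -sqrtrM ?sqr_ge0// ler_sqrt; last first.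
  by rewrite mulr_ge0 ?sqr_ge0// mulrn_wge0// pi_ge0.
have := @pi_ge0 R; lra.
Qed.

Lemma expR_ge_half_sqr (y : R) : 0 <= y -> y ^+ 2 / 2 <= expR y.
Proof.
move=> y0; have := @expR_ge1Dxn R y 1 y0.
rewrite (_ : 2`!%:R = 2)//; lra.
Qed.

Lemma expect_le_expR_sqr (f : R -> R) (c : R) : measurable_fun [set: R] f ->
  0 <= c -> (forall x, 0 <= f x <= c * expR (x ^+ 2 / 4)) ->
  (\int[N01]_x (f x)%:E <= (2 * c)%:E)%E.
Proof.
move=> mf c0 fle.
have mE : measurable_fun [set: R] (fun x : R => expR (x ^+ 2 / 4)).
  by under eq_fun do rewrite mulrC; exact: measurable_expR_sqr.
apply: (@le_trans _ _ (\int[N01]_x (c%:E * (expR (x ^+ 2 / 4))%:E)))%E.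
  apply: ge0_le_integral => //=.
  - by move=> x _; rewrite lee_fin; case/andP: (fle x).
  - exact/measurable_EFinP.
  - by under eq_fun do rewrite -EFinM; apply/measurable_EFinP; apply: measurable_funM.
  - by move=> x _; rewrite lee_fin; case/andP: (fle x).
rewrite ge0_integralZl//; last exact/measurable_EFinP.
by rewrite mulrC EFinM lee_wpmul2l ?lee_fin//; exact: expect_expR_sqr_quarter.
Qed.

Lemma measurable_tail (f : R -> R) (t : R) : measurable_fun [set: R] f ->
  measurable_fun [set: R] (fun x : R => if t <= `|x| then f x else 0).
Proof.
move=> mf; apply: measurable_fun_ifT => //.
by apply: measurable_fun_ler => //; exact: measurableT_comp.
Qed.

(** Split exp (x^2/4) into two factors exp (x^2/8): one dominates x^2/8, the other is at least exp
    (t^2/8) on the tail. *)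
Lemma expect_sqr_tail (t : R) : 0 <= t ->
  (\int[N01]_x (if t <= `|x| then x ^+ 2 else 0)%:E <= (16 * expR (- (t ^+ 2 / 8)))%:E)%E.
Proof.
move=> t0.
rewrite (_ : 16 * _ = 2 * (8 * expR (- (t ^+ 2 / 8)))); last by lra.
apply: expect_le_expR_sqr.
- exact: measurable_tail.
- by rewrite mulr_ge0 ?expR_ge0.
move=> x; case: ifPn => [tx|_]; last by rewrite lexx !mulr_ge0 ?expR_ge0.
rewrite sqr_ge0/= -mulrA -expRD.
have x8 := expR_ge1Dx (x ^+ 2 / 8).
have : expR (x ^+ 2 / 8) <= expR (- (t ^+ 2 / 8) + x ^+ 2 / 4).
  rewrite ler_expR.
  have : t ^+ 2 <= x ^+ 2 by rewrite -[leRHS]real_normK ?num_real// lerXn2r ?nnegrE.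
  lra.
lra.
Qed.

(** Same splitting, with y^2/2 <= exp y at y = x^2/8, so that x^4 <= 128 exp (x^2/8). *)
Lemma expect_pow4_tail (t : R) : 0 <= t ->
  (\int[N01]_x ((if t <= `|x| then x ^+ 2 else 0) ^+ 2)%:E <= (256 * expR (- (t ^+ 2 / 8)))%:E)%E.
Proof.
move=> t0.
rewrite (_ : 256 * _ = 2 * (128 * expR (- (t ^+ 2 / 8)))); last by lra.
apply: expect_le_expR_sqr.
- by apply: measurable_funX; exact: measurable_tail.
- by rewrite mulr_ge0 ?expR_ge0.
move=> x; case: ifPn => [tx|_]; last by rewrite expr0n/= lexx !mulr_ge0 ?expR_ge0.
rewrite sqr_ge0/= -mulrA -expRD.
have x80 : 0 <= x ^+ 2 / 8 by rewrite divr_ge0 ?sqr_ge0.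
have x8 := expR_ge_half_sqr x80.
have : expR (x ^+ 2 / 8) <= expR (- (t ^+ 2 / 8) + x ^+ 2 / 4).
  rewrite ler_expR.
  have : t ^+ 2 <= x ^+ 2 by rewrite -[leRHS]real_normK ?num_real// lerXn2r ?nnegrE.
  lra.
rewrite expr_div_n in x8.
have -> : x ^+ 2 ^+ 2 = 128 * (x ^+ 2 ^+ 2 / 8 ^+ 2 / 2) by field.
nra.
Qed.

Lemma normal_prob_itv_le (a b : R) : a <= b -> (N01 `[a, b] <= (b - a)%:E)%E.
Proof.
move=> ab; rewrite /normal_prob.
apply: (@le_trans _ _ (\int[mu]_(x in `[a, b]) 1%:E))%E.
  apply: ge0_le_integral => //=.
  - by move=> x _; rewrite lee_fin normal_pdf_ge0.
  - by apply/measurable_EFinP; apply: measurable_funTS; exact: measurable_normal_pdf.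
  - move=> x _; rewrite lee_fin.
    have := @normal_pdf_ub R 0 1 x (oner_neq0 _); have := normal_peak1_le; lra.
by rewrite integral_cst//= mul1e lebesgue_measure_itv/=; case: ifPn; rewrite // lee_fin subr_ge0.
Qed.

Lemma normal_prob_itv_ge (a b M : R) : a <= b ->
  (forall x, a <= x <= b -> `|x| <= M) ->
  (((b - a) * normal_pdf 0 1 M)%:E <= N01 `[a, b])%E.
Proof.
move=> ab xM; rewrite /normal_prob.
apply: (@le_trans _ _ (\int[mu]_(x in `[a, b]) (normal_pdf 0 1 M)%:E))%E.
  rewrite integral_cst//= lebesgue_measure_itv/= lte_fin; case: ifPn => [ab'|].
    by rewrite mulrC EFinM -EFinB.
  rewrite -leNgt => ba; have -> : a = b by apply/eqP; rewrite eq_le ab.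
  by rewrite subrr mul0r mule0.
apply: ge0_le_integral => //=.
- by move=> x _; rewrite lee_fin normal_pdf_ge0.
- by apply/measurable_EFinP; apply: measurable_funTS; exact: measurable_normal_pdf.
- move=> x; rewrite in_itv/= => xab; rewrite lee_fin !normal_pdf01E.
  rewrite ler_pM2l ?normal_peak_gt0 ?oner_neq0// ler_expR lerN2 ler_pM2r//.
  rewrite -[leLHS]real_normK ?num_real// lerXn2r ?nnegrE//; last exact: xM.
  by rewrite (le_trans _ (xM _ xab)).
Qed.

Lemma measurable_annulus (l h : R) :
  measurable_fun [set: R] (fun x : R => if l <= `|x| <= h then x ^+ 2 else 0).
Proof.
apply: measurable_fun_ifT => //; apply: measurable_and.
  by apply: measurable_fun_ler => //; exact: measurableT_comp.
by apply: measurable_fun_ler => //; exact: measurableT_comp.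
Qed.

(** With d <= 1/4 the annulus lies in 3t/4 <= |x| <= 2t; the first bound gives the exponent
    (3/4)^2/2 = 9/32, the second the factor t^2. *)
Lemma annulus_pdf_le (x t d : R) : 0 <= t -> 0 <= d -> d <= 4^-1 ->
  (1 - d) * t <= `|x| -> `|x| <= (1 + d) * t ->
  x ^+ 2 * normal_pdf 0 1 x <= 2 * t ^+ 2 * expR (- (9 / 32 * t ^+ 2)).
Proof.
move=> t0 d0 d4 lx xh.
have xx : x ^+ 2 = `|x| ^+ 2 by rewrite real_normK ?num_real.
have y0 := normr_ge0 x.
have x2 : x ^+ 2 <= 4 * t ^+ 2.
  rewrite xx; have : `|x| <= 2 * t by nra.
  nra.
have pdfle : normal_pdf 0 1 x <= 2^-1 * expR (- (9 / 32 * t ^+ 2)).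
  rewrite normal_pdf01E; apply: ler_pM; rewrite ?normal_peak_ge0 ?expR_ge0 ?normal_peak1_le//.
  rewrite ler_expR lerN2 xx; have : 3 / 4 * t <= `|x| by nra.
  nra.
rewrite (_ : 2 * t ^+ 2 * _ = 4 * t ^+ 2 * (2^-1 * expR (- (9 / 32 * t ^+ 2)))); last by lra.
by apply: ler_pM => //; rewrite ?sqr_ge0 ?normal_pdf_ge0.
Qed.

(** The linear dependence on the relative width d is what is needed later. The integrand is bounded
    by its maximum on two intervals of length 2 d t each. *)
Lemma expect_annulus (t d : R) : 0 <= t -> 0 <= d <= 4^-1 ->
  (\int[N01]_x (if ((1 - d) * t <= `|x| <= (1 + d) * t)%R then x ^+ 2 else 0)%:E
   <= (1000 * d * expR (- (t ^+ 2 / 8)))%:E)%E.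
Proof.
move=> t0 /andP[d0 d4].
set l := (1 - d) * t; set h := (1 + d) * t.
have lh : l <= h by rewrite /l /h; nra.
have l0 : 0 <= l by rewrite /l mulr_ge0//; lra.
rewrite (ge0_integral_normal_prob_EFin _ _ (measurable_annulus l h)); last first.
  by move=> x; case: ifP => //; rewrite sqr_ge0.
set K := 2 * t ^+ 2 * expR (- (9 / 32 * t ^+ 2)).
have K0 : 0 <= K by rewrite /K !mulr_ge0 ?expR_ge0.
apply: (@le_trans _ _ (\int[mu]_x (K%:E * (\1_(`[l, h]) x + \1_(`[- h, - l]) x)%:E)))%E.
  apply: ge0_le_integral => //=.
  - by move=> x _; rewrite lee_fin mulr_ge0 ?normal_pdf_ge0//; case: ifP => //; rewrite sqr_ge0.
  - apply/measurable_EFinP; apply: measurable_funM; first exact: measurable_annulus.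
    exact: measurable_normal_pdf.
  - under eq_fun do rewrite -EFinM; apply/measurable_EFinP; apply: measurable_funM => //.
    by apply: measurable_funD; exact: measurable_indic.
  - move=> x _; rewrite -EFinM lee_fin; case: ifPn => [/andP[lx xh]|_]; last first.
      by rewrite mul0r mulr_ge0// addr_ge0// ?indicE.
    have H : x ^+ 2 * normal_pdf 0 1 x <= K by exact: (@annulus_pdf_le x t d).
    apply: (le_trans H); rewrite -[leLHS]mulr1 ler_wpM2l// !indicE.
    have [x0|x0] := leP 0 x.
      have -> : x \in `[l, h]%classic by rewrite inE/= in_itv/= -(ger0_norm x0) lx.
      by rewrite /= lerDl.
    have -> : x \in `[- h, - l]%classic.
      by rewrite inE/= in_itv/= lerNl lerNr -(ltr0_norm x0) lx xh.
    by rewrite /= lerDr.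
rewrite ge0_integralZl//; last first.
  by apply/measurable_EFinP; apply: measurable_funD; exact: measurable_indic.
under eq_integral do rewrite EFinD.
rewrite ge0_integralD//; [|by apply/measurable_EFinP; exact: measurable_indic..].
rewrite !integral_indic// !setIT.
have itvle (a b : R) : a <= b -> (mu `[a, b] <= (b - a)%:E)%E.
  by move=> ab; rewrite lebesgue_measure_itv/=; case: ifPn; rewrite // lee_fin subr_ge0.
apply: (@le_trans _ _ (K%:E * ((h - l)%:E + (h - l)%:E)))%E.
  apply: lee_wpmul2l; first by rewrite lee_fin.
  apply: leeD; first exact: itvle.
  by rewrite (le_trans (itvle _ _ _)) ?lerN2// lee_fin; lra.
rewrite -EFinD -EFinM lee_fin /K /h /l.
(* 9/32 = 1/8 + 5/32: the surplus exp (- y) absorbs t^3, of which t^2 comes from the integrand and t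
   from the length of the intervals. *)
set y := 5 / 32 * t ^+ 2.
have y0 : 0 <= y by rewrite /y mulr_ge0 ?sqr_ge0//; lra.
have -> : expR (- (9 / 32 * t ^+ 2)) = expR (- (t ^+ 2 / 8)) * expR (- y).
  by rewrite -expRD; congr expR; rewrite /y; lra.
rewrite (expRN y).
have ey := expR_ge_half_sqr y0; have ey1 := expR_ge1Dx y.
have ep := expR_gt0 y; have ep2 := expR_gt0 (- (t ^+ 2 / 8)).
set e1 := expR (- _) in ep2 *; set e2 := expR y in ey ey1 ep *.
have t3 : 8 * t ^+ 3 <= 1000 * e2.
  have : t ^+ 3 <= 1 + t ^+ 4 by have [?|?] := leP t 1; nra.
  have : t ^+ 4 <= 100 * e2.
    rewrite /y in ey; nra.
  lra.
have -> : 2 * t ^+ 2 * (e1 / e2) * ((1 + d) * t - (1 - d) * t + ((1 + d) * t - (1 - d) * t)) = (8 * t ^+ 3 / e2) * (d * e1).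
  by field; rewrite gt_eqF.
have -> : 1000 * d * e1 = 1000 * (d * e1) by lra.
apply: ler_wpM2r; first by rewrite mulr_ge0// ltW.
by rewrite ler_pdivrMr.
Qed.

Lemma integrable_le_expR_sqr (f : R -> R) (c : R) : measurable_fun [set: R] f ->
  0 <= c -> (forall x, `|f x| <= c * expR (x ^+ 2 / 4)) ->
  N01.-integrable [set: R] (EFin \o f).
Proof.
move=> mf c0 fle; apply/integrableP; split; first exact/measurable_EFinP.
apply: (@le_lt_trans _ _ (2 * c)%:E); last by rewrite ltry.
rewrite (_ : (fun x => `|(EFin \o f) x|)%E = (fun x => (`|f x|)%:E))//.
apply: expect_le_expR_sqr => //; first exact: measurableT_comp.
by move=> x; rewrite normr_ge0 fle.
Qed.

End standard_normal.

(** * Characteristic function of the standard normal law *)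

Section characteristic_function.
Context {R : realType}.
Notation mu := (@lebesgue_measure R).
Notation N01 := (normal_prob (0 : R) 1).

Lemma abs_le_expR_sqr (x : R) : `|x| <= 2 * expR (x ^+ 2 / 4).
Proof.
have := expR_ge1Dx (x ^+ 2 / 4).
have : x ^+ 2 = `|x| ^+ 2 by rewrite real_normK ?num_real.
have := normr_ge0 x; set y := `|x|; nra.
Qed.

Lemma expR_sqr_ge1 (x : R) : 1 <= expR (x ^+ 2 / 4).
Proof.
by rewrite -[leLHS]expR0 ler_expR divr_ge0 ?sqr_ge0.
Qed.

Lemma measurable_cosM (t : R) : measurable_fun [set: R] (fun x : R => cos (t * x)).
Proof.
by apply: measurableT_comp; [exact: continuous_measurable_fun (@continuous_cos R)|exact: measurable_funM].
Qed.

Lemma measurable_sinM (t : R) : measurable_fun [set: R] (fun x : R => sin (t * x)).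
Proof.
by apply: measurableT_comp; [exact: continuous_measurable_fun (@continuous_sin R)|exact: measurable_funM].
Qed.

Lemma integrable_cosM (t : R) : N01.-integrable [set: R] (EFin \o (fun x : R => cos (t * x))).
Proof.
apply: (@integrable_le_expR_sqr _ _ 1) => //; first exact: measurable_cosM.
by move=> x; rewrite mul1r (le_trans (cos_max _))// expR_sqr_ge1.
Qed.

Lemma integrable_xsinM (t : R) : N01.-integrable [set: R] (EFin \o (fun x : R => x * sin (t * x))).
Proof.
apply: (@integrable_le_expR_sqr _ _ 2) => //.
  by apply: measurable_funM => //; exact: measurable_sinM.
move=> x; rewrite normrM (le_trans _ (abs_le_expR_sqr x))//.
by rewrite ler_piMr ?sin_max.
Qed.

Lemma integral_itv_cvg (k : R -> R) : N01.-integrable [set: R] (EFin \o k) ->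
  (\int[N01]_(x in (`[(- n.+1%:R)%R, n.+1%:R%R])) (k x)%:E)%E @[n --> \oo] --> (\int[N01]_x (k x)%:E)%E.
Proof.
move=> ik; under eq_fun do rewrite integral_mkcond.
have mk := measurable_int _ ik.
apply: (@dominated_cvg _ _ _ N01 [set: R] measurableT
  (fun n => (EFin \o k) \_ `[(- n.+1%:R)%R, n.+1%:R%R]) (EFin \o k) (fun x => `|(k x)%:E|%E)) => //=.
- move=> n; apply/(measurable_restrictT _ _).1 => //; exact: measurable_funTS.
- move=> x _; apply: cvg_near_cst; near=> n.
  rewrite patchE ifT// inE/= in_itv/= -ler_norml.
  rewrite (le_trans (ltW (truncnS_gt _)))// ler_nat ltnS; near: n.
  exact: nbhs_infty_ge.
- exact: (integrable_abse ik).
- by move=> n x _; rewrite patchE; case: ifPn => _ //=; rewrite ?abse0 ?normr0 lee_fin.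
Unshelve. all: by end_near. Qed.

Lemma is_derive_cosM (c x : R) : is_derive x (1 : R) (fun y : R => cos (c * y)) (- (c * sin (c * x))).
Proof.
have H : is_derive x (1 : R) (fun y : R => c * y) c.
  by apply: is_derive_eq; rewrite /GRing.scale/=; ring.
have := @is_derive1_comp _ (@cos R) (fun y : R => c * y) x _ _ (is_derive_cos (c * x)) H.
by rewrite /comp mulNr mulrC.
Qed.

Lemma is_derive_sinM (c x : R) : is_derive x (1 : R) (fun y : R => sin (c * y)) (c * cos (c * x)).
Proof.
have H : is_derive x (1 : R) (fun y : R => c * y) c.
  by apply: is_derive_eq; rewrite /GRing.scale/=; ring.
have := @is_derive1_comp _ (@sin R) (fun y : R => c * y) x _ _ (is_derive_sin (c * x)) H.
by rewrite /comp mulrC.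
Qed.

Lemma is_derive_expR_sqr (c x : R) : is_derive x (1 : R) (fun y : R => expR (c * y ^+ 2)) (2 * c * x * expR (c * x ^+ 2)).
Proof.
have H : is_derive x (1 : R) (fun y : R => c * y ^+ 2) (2 * c * x).
  by apply: is_derive_eq; rewrite /GRing.scale/=; ring.
have := @is_derive1_comp _ (@expR R) (fun y : R => c * y ^+ 2) x _ _ (is_derive_expR (c * x ^+ 2)) H.
by rewrite /comp mulrC.
Qed.

Lemma is_derive_stein (t x : R) : is_derive x (1 : R)
  (fun y : R => normal_pdf 0 1 y * sin (t * y))
  (normal_pdf 0 1 x * (t * cos (t * x) - x * sin (t * x))).
Proof.
have H : is_derive x (1 : R) (fun y : R => normal_pdf 0 1 y) (- x * normal_pdf 0 1 x).
  rewrite (_ : (fun y => _) = (fun y => normal_peak 1 * expR (- 2^-1 * y ^+ 2))); last first.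
    by apply/funext => y; rewrite normal_pdf01E mulNr [2^-1 * _]mulrC.
  have H0 := is_derive_expR_sqr (- 2^-1) x.
  apply: is_derive_eq.
  by rewrite normal_pdf01E /GRing.scale/= [- 2^-1 * _]mulNr [2^-1 * _]mulrC; field.
have H1 := is_derive_sinM t x.
by apply: is_derive_eq; rewrite /GRing.scale/=; ring.
Qed.

(** Stein's identity for sin (t x): against the density the integrand is the derivative of
    [normal_pdf 0 1 y * sin (t * y)], which vanishes at infinity. *)
Lemma stein_cos (t : R) : \int[N01]_x (t * cos (t * x) - x * sin (t * x)) = 0.
Proof.
set k := fun x : R => t * cos (t * x) - x * sin (t * x).
have ik : N01.-integrable [set: R] (EFin \o k).
  rewrite (_ : EFin \o k = (fun x => (t%:E * (cos (t * x))%:E) - (x * sin (t * x))%:E)%E)//.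
  apply: integrableB => //; last exact: integrable_xsinM.
  by apply: integrableZl => //; exact: integrable_cosM.
set G := fun y : R => normal_pdf 0 1 y * sin (t * y).
have FTC n : (\int[N01]_(x in (`[(- n.+1%:R)%R, n.+1%:R%R])) (k x)%:E)%E = (G n.+1%:R - G (- n.+1%:R))%:E.
  rewrite integral_normal_prob//; last exact: integrableS ik.
  rewrite EFinB -(@continuous_FTC2 _ (fun x => normal_pdf 0 1 x * k x) G)//.
  - by apply: eq_integral => x _; rewrite mulrC.
  - by rewrite -subr_gt0 opprK addr_gt0.
  - apply: continuous_subspaceT => x; apply: cvgM; first exact: continuous_normal_pdf.
    apply: cvgB; apply: cvgM; try exact: cvg_cst; try exact: cvg_id.
      by apply: differentiable_continuous; apply/derivable1_diffP; exact: (ex_derive (is_derive := is_derive_cosM t x)).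
    by apply: differentiable_continuous; apply/derivable1_diffP; exact: (ex_derive (is_derive := is_derive_sinM t x)).
  - have cG x : {for x, continuous G}.
      by apply: differentiable_continuous; apply/derivable1_diffP; exact: (ex_derive (is_derive := is_derive_stein t x)).
    split.
    + by move=> x _; exact: (ex_derive (is_derive := is_derive_stein t x)).
    + exact/cvg_at_right_filter/cG.
    + exact/cvg_at_left_filter/cG.
  - by move=> x _; rewrite derive1E; exact: (derive_val (is_derive := is_derive_stein t x)).
have := integral_itv_cvg ik; under eq_fun do rewrite FTC.
have G1 : (G n.+1%:R - G (- n.+1%:R) : R) @[n --> \oo] --> (0 : R).
  have h0 : 2 * expR (- n%:R) @[n --> \oo] --> (0 : R).
    rewrite -[X in _ --> X](mulr0 2); apply: cvgM; first exact: cvg_cst.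
    exact: cvgn_expR.
  apply: (squeeze_cvgr (f := fun n => - (2 * expR (- n%:R))) (h := fun n : nat => 2 * expR (- n%:R))) => //; last first.
    by rewrite -[X in _ --> X]oppr0; exact: cvgN.
  near=> n; rewrite -ler_norml.
  have Gle y : n%:R <= y ^+ 2 / 2 -> `|G y| <= expR (- n%:R).
    move=> ny; rewrite /G normrM normal_pdf01E ger0_norm ?mulr_ge0 ?normal_peak_ge0 ?expR_ge0//.
    rewrite -[leRHS]mulr1; apply: ler_pM; rewrite ?mulr_ge0 ?normal_peak_ge0 ?expR_ge0 ?sin_max//.
    rewrite -[leRHS]mul1r; apply: ler_pM; rewrite ?normal_peak_ge0 ?expR_ge0//.
      by have := @normal_peak1_le R; lra.
    by rewrite ler_expR lerN2.
  have n2 : n%:R <= n.+1%:R ^+ 2 / 2 :> R.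
    by rewrite ler_pdivlMr// -natrX -natrM ler_nat; nia.
  apply: (le_trans (ler_normB _ _)).
  by have := Gle _ n2; have := Gle (- n.+1%:R); rewrite sqrrN => /(_ n2); lra.
have G0 : (G n.+1%:R - G (- n.+1%:R))%:E @[n --> \oo] --> 0%:E.
  by apply: cvg_EFin; [exact: nearW|exact: G1].
move=> /(cvg_unique _ G0) H; rewrite /Rintegral -H//.
Unshelve. all: by end_near. Qed.

(** Differentiating under the integral, with domination by [|x|], gives the mean of - x sin (t x);
    Stein's identity rewrites it as - t times the function itself. *)
Lemma derive_cf (t : R) : is_derive t 1 (fun t : R => \int[N01]_x cos (t * x)) (- t * \int[N01]_x cos (t * x)).
Proof.
set g := fun t : R => \int[N01]_x cos (t * x).
have dcos (u x : R) : is_derive u 1 ((fun t x : R => cos (t * x))^~ x) (- (x * sin (u * x))).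
  have E : (fun y : R => cos (y * x)) = (fun y => cos (x * y)) by apply/funext => y; rewrite mulrC.
  change (is_derive u 1 (fun y : R => cos (y * x)) (- (x * sin (u * x)))); rewrite E.
  by rewrite [u * x]mulrC; exact: is_derive_cosM.
have dp (u x : R) : partial1of2 (fun t x : R => cos (t * x)) u x = - (x * sin (u * x)).
  by rewrite partial1of2E; exact: (derive_val (is_derive := dcos u x)).
have It : `]t - 1, t + 1[%classic t by rewrite /= in_itv/=; apply/andP; split; lra.
have iG : N01.-integrable setT (EFin \o (fun x : R => `|x|)).
  apply: (@integrable_le_expR_sqr _ _ 2) => //.
  by move=> x; rewrite normr_id abs_le_expR_sqr.
have I1 (x : R) : `]t - 1, t + 1[%classic x -> N01.-integrable setT (EFin \o (fun y : R => cos (x * y))).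
  by move=> _; exact: integrable_cosM.
have I2 (x y : R) : `]t - 1, t + 1[%classic x -> [set: R] y -> derivable ((fun t x : R => cos (t * x))^~ y) x 1.
  by move=> _ _; exact: (ex_derive (is_derive := dcos x y)).
have I3 (x y : R) : `]t - 1, t + 1[%classic x -> [set: R] y -> `|partial1of2 (fun t x : R => cos (t * x)) x y| <= `|y|.
  by move=> _ _; rewrite dp normrN normrM ler_piMr// sin_max.
have gt := @differentiation_under_integral _ _ _ N01 _ _ measurableT _ _ _ It I1 I2 _ (fun y => normr_ge0 _) iG I3.
have dg := @derivable_under_integral _ _ _ N01 _ _ measurableT _ _ _ It I1 I2 _ (fun y => normr_ge0 _) iG I3.
apply: DeriveDef; first exact: dg.
rewrite -derive1E gt; under eq_Rintegral do rewrite dp.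
have := stein_cos t; rewrite RintegralB//; last 2 first.
- apply: (@integrable_le_expR_sqr _ (fun x : R => t * cos (t * x)) `|t|) => //.
    by apply: measurable_funM => //; exact: measurable_cosM.
  by move=> x; rewrite normrM ler_wpM2l// (le_trans (cos_max _))// expR_sqr_ge1.
- exact: integrable_xsinM.
rewrite RintegralZl//; last exact: integrable_cosM.
move=> H.
under eq_Rintegral do rewrite -mulN1r.
rewrite RintegralZl//; last exact: integrable_xsinM.
lra.
Qed.

(** The differential equation makes the product with exp (t^2/2) constant, and its value at 0 is
    1. *)
Lemma cf_normal (t : R) : \int[N01]_x cos (t * x) = expR (- (t ^+ 2 / 2)).
Proof.
set g := fun t : R => \int[N01]_x cos (t * x).
have : g t * expR (2^-1 * t ^+ 2) = g 0 * expR (2^-1 * 0 ^+ 2).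
  apply: (is_derive_0_is_cst (f := fun t => g t * expR (2^-1 * t ^+ 2))) => x.
  have H1 := derive_cf x; have H2 := is_derive_expR_sqr 2^-1 x.
  by apply: is_derive_eq; rewrite /GRing.scale/= /g; field.
rewrite expr0n/= mulr0 expR0 mulr1.
have -> : g 0 = 1.
  rewrite /g; under eq_Rintegral do rewrite mul0r cos0.
  by rewrite /Rintegral integral_cst//= mul1e; have := @probability_setT _ _ _ N01; rewrite /= => ->.
move=> /(congr1 (fun z => z * expR (- (t ^+ 2 / 2)))).
by rewrite mul1r -mulrA -expRD mulrC [2^-1 * _]mulrC subrr expR0 mul1r.
Qed.

End characteristic_function.

(** * Variance of sums of functions of correlated Gaussian variables *)

Section cosine_kernel.
Context {R : realType}.
Implicit Types (s : seq (R * R)).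

(** For damped amplitudes this is the mean of f (U) f (V), where f is a cosine polynomial and U, V
    are standard normal with correlation z. *)
Definition cosh_kernel s (z : R) : R :=
  \sum_(p <- s) \sum_(q <- s)
    p.1 * q.1 * ((expR (z * (p.2 * q.2)) + expR (- z * (p.2 * q.2))) / 2).

Lemma cvg_sum_seq I (r : seq I) (f : I -> nat -> R) (l : I -> R) :
  (forall i, f i n @[n --> \oo] --> l i) ->
  \sum_(i <- r) f i n @[n --> \oo] --> \sum_(i <- r) l i.
Proof.
move=> fl; elim: r => [|i r IH].
  by under eq_fun do rewrite big_nil; rewrite big_nil; exact: cvg_cst.
by under eq_fun do rewrite big_cons; rewrite big_cons; exact: cvgD.
Qed.

(** The coefficient of z^n factors over the double sum into a square divided by n!, which is the
    source of its nonnegativity. *)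
Lemma cvg_exp_kernel s (z : R) :
  series (fun n => z ^+ n * ((\sum_(p <- s) p.1 * p.2 ^+ n) ^+ 2 / n`!%:R)) @ \oo -->
  \sum_(p <- s) \sum_(q <- s) p.1 * q.1 * expR (z * (p.2 * q.2)).
Proof.
rewrite (_ : series _ = (fun n => \sum_(p <- s) \sum_(q <- s) p.1 * q.1 * series (exp_coeff (z * (p.2 * q.2))) n)).
  apply: cvg_sum_seq => p; apply: cvg_sum_seq => q; apply: cvgM; first exact: cvg_cst.
  exact: is_cvg_series_exp_coeff.
apply/funext => n; rewrite /series/=.
under [RHS]eq_bigr do under eq_bigr do rewrite mulr_sumr.
under [RHS]eq_bigr do rewrite exchange_big/=.
rewrite [RHS]exchange_big/=; apply: eq_bigr => k _.
rewrite expr2 big_distrlr/= mulr_suml mulr_sumr; apply: eq_bigr => p _.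
rewrite mulr_suml mulr_sumr; apply: eq_bigr => q _.
by rewrite /exp_coeff/= !exprMn; ring.
Qed.

(* The power series of [cosh_kernel s] in [rho] has even powers and nonnegative coefficients only. *)
Lemma cosh_kernel_le s (rho : R) : `|rho| <= 1 ->
  cosh_kernel s rho - (\sum_(p <- s) p.1) ^+ 2 <= rho ^+ 2 * cosh_kernel s 1.
Proof.
move=> rho1.
pose b n := (\sum_(p <- s) p.1 * p.2 ^+ n) ^+ 2 / n`!%:R.
have b0 n : 0 <= b n by rewrite /b divr_ge0 ?sqr_ge0.
have kE z : cosh_kernel s z = (\sum_(p <- s) \sum_(q <- s) p.1 * q.1 * expR (z * (p.2 * q.2))
   + \sum_(p <- s) \sum_(q <- s) p.1 * q.1 * expR (- z * (p.2 * q.2))) / 2.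
  rewrite -big_split/= mulr_suml; apply: eq_bigr => p _.
  rewrite -big_split/= mulr_suml; apply: eq_bigr => q _; ring.
pose h z n := (series (fun n => z ^+ n * b n) n + series (fun n => (- z) ^+ n * b n) n) / 2.
have hcvg z : h z @ \oo --> cosh_kernel s z.
  rewrite kE; apply: cvgM; last exact: cvg_cst.
  by apply: cvgD; exact: cvg_exp_kernel.
have b00 : b 0%N = (\sum_(p <- s) p.1) ^+ 2.
  rewrite /b fact0 divr1; congr (_ ^+ 2); apply: eq_bigr => p _; by rewrite expr0 mulr1.
rewrite -b00.
rewrite -subr_le0.
have C : h rho n - b 0%N - rho ^+ 2 * h 1 n @[n --> \oo] -->
    cosh_kernel s rho - b 0%N - rho ^+ 2 * cosh_kernel s 1.
  apply: cvgB; first by apply: cvgB; [exact: hcvg|exact: cvg_cst].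
  by apply: cvgM; [exact: cvg_cst|exact: hcvg].
apply: (cvgr_to_le C).
near=> n.
have n0 : (0 < n)%N by near: n; exact: nbhs_infty_gt.
have hE z : h z n = \sum_(0 <= k < n) ((z ^+ k + (- z) ^+ k) / 2 * b k).
  rewrite /h /series/= -big_split/= mulr_suml; apply: eq_bigr => k _; ring.
rewrite subr_le0 !hE -(prednK n0); move: n.-1 => {n0 hE} m.
(* The term of order 0 is the squared mean: it cancels on the left and is nonnegative on the right.
   Each remaining order is odd, hence contributes 0, or is at least 2, where |rho|^k <= rho^2. *)
rewrite mulr_sumr big_nat_recl// [leRHS]big_nat_recl// !expr0.
rewrite (_ : (1 + 1) / 2 = 1 :> R); last by lra.
rewrite !mul1r addrAC subrr add0r; apply: ler_wpDl.
  by apply: mulr_ge0; [exact: sqr_ge0|exact: b0].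
apply: ler_sum => k _; rewrite mulrA; apply: ler_wpM2r => //.
rewrite expr1n (exprNn rho) -signr_odd.
have [ok|ok] := boolP (odd k.+1); first by rewrite expr1; lra.
rewrite expr0 mul1r (_ : (1 + 1) / 2 = 1 :> R); last by lra.
rewrite mulr1 (_ : (_ + _) / 2 = rho ^+ k.+1); last by lra.
rewrite (le_trans (ler_norm _))// normrX -[rho ^+ 2]real_normK ?num_real//.
by apply: ler_wiXn2l => //; case: k ok.
Unshelve. all: by end_near. Qed.

End cosine_kernel.

Section bounded_measurable.
Context d (T : measurableType d) (R : realType) (P : probability T R).
Implicit Types (f g : T -> R).

Definition bmeas f := measurable_fun [set: T] f /\ exists M : R, forall x, `|f x| <= M.

Lemma bmeas_integrable f : bmeas f -> P.-integrable [set: T] (EFin \o f).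
Proof.
move=> [mf [M fM]]; apply: measurable_bounded_integrable => //.
  exact: le_lt_trans (probability_le1 P measurableT) (ltry 1).
exists M; split; first exact: num_real.
by move=> x Mx y _ /=; rewrite (le_trans (fM y))// ltW.
Qed.

Lemma bmeas_cst (c : R) : bmeas (fun=> c).
Proof. by split => //; exists `|c|. Qed.

Lemma bmeasD f g : bmeas f -> bmeas g -> bmeas (fun x => f x + g x).
Proof.
move=> [mf [M fM]] [mg [N gN]]; split; first exact: measurable_funD.
by exists (M + N) => x; rewrite (le_trans (ler_normD _ _))// lerD.
Qed.

Lemma bmeasM f g : bmeas f -> bmeas g -> bmeas (fun x => f x * g x).
Proof.
move=> [mf [M fM]] [mg [N gN]]; split; first exact: measurable_funM.
by exists (M * N) => x; rewrite normrM ler_pM.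
Qed.

Lemma bmeas_sum I (r : seq I) (F : I -> T -> R) :
  (forall i, bmeas (F i)) -> bmeas (fun x => \sum_(i <- r) F i x).
Proof.
move=> bF; elim: r => [|i r IH].
  by under eq_fun do rewrite big_nil; exact: bmeas_cst.
by under eq_fun do rewrite big_cons; exact: bmeasD.
Qed.

Lemma Rintegral_sum I (r : seq I) (F : I -> T -> R) :
  (forall i, bmeas (F i)) ->
  \int[P]_x (\sum_(i <- r) F i x) = \sum_(i <- r) \int[P]_x F i x.
Proof.
move=> bF; elim: r => [|i r IH].
  under eq_Rintegral do rewrite big_nil; rewrite big_nil.
  by rewrite Rintegral_cst// mul0r.
under eq_Rintegral do rewrite big_cons.
rewrite big_cons -IH RintegralD//; apply: bmeas_integrable => //.
exact: bmeas_sum.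
Qed.

Lemma bmeas_RintegralE f : bmeas f ->
  (\int[P]_x (f x)%:E)%E = (\int[P]_x f x)%:E.
Proof.
move=> bf; rewrite /Rintegral fineK//; apply: integrable_fin_num => //.
exact: bmeas_integrable.
Qed.

End bounded_measurable.

Section cosine_polynomials.
Context d (T : measurableType d) (R : realType) (P : probability T R).
Implicit Types (s : seq (R * R)) (U V : T -> R).

Definition cospoly (R' : realType) (s : seq (R' * R')) (x : R') : R' :=
  \sum_(p <- s) p.1 * cos (p.2 * x).

(** Each amplitude is multiplied by the mean of its cosine under the standard normal law, so that
    the damped amplitudes add up to the mean of the cosine polynomial. *)
Definition damp s : seq (R * R) :=
  [seq (p.1 * expR (- (p.2 ^+ 2 / 2)), p.2) | p <- s].

(* This much of joint normality is all that products of cosines see. *)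
Definition gaussian_pair U V (rho : R) :=
  forall a b, \int[P]_w cos (a * U w + b * V w) =
     expR (- ((a ^+ 2 + b ^+ 2 + 2 * (a * b * rho)) / 2)).

Lemma bmeas_cos U (a : R) : measurable_fun [set: T] U ->
  bmeas (fun w => cos (a * U w)).
Proof.
move=> mU; split; last by exists 1 => x; exact: cos_max.
by apply: (measurableT_comp (measurable_cosM a)).
Qed.

Lemma bmeas_cospoly s U : measurable_fun [set: T] U ->
  bmeas (fun w => cospoly s (U w)).
Proof.
move=> mU; apply: bmeas_sum => p.
by apply: bmeasM; [exact: bmeas_cst|exact: bmeas_cos].
Qed.

Lemma cosM (x y : R) : cos x * cos y = (cos (x + y) + cos (x - y)) / 2.
Proof. rewrite cosD cosB; lra. Qed.

Lemma expect_cosM U V rho (a b : R) : measurable_fun [set: T] U ->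
  measurable_fun [set: T] V -> gaussian_pair U V rho ->
  \int[P]_w (cos (a * U w) * cos (b * V w)) =
  expR (- (a ^+ 2 / 2)) * expR (- (b ^+ 2 / 2)) *
    ((expR (rho * (a * b)) + expR (- rho * (a * b))) / 2).
Proof.
move=> mU mV H.
have bm c e : bmeas (fun w => cos (c * U w + e * V w)).
  split; last by exists 1 => x; exact: cos_max.
  apply: measurableT_comp; first exact: continuous_measurable_fun (@continuous_cos R).
  by apply: measurable_funD; exact: measurable_funM.
under eq_Rintegral do rewrite cosM -mulNr.
rewrite RintegralZr//; last by apply: bmeas_integrable; apply: bmeasD; exact: bm.
rewrite RintegralD//; [|exact: bmeas_integrable..].
have E (A B C D : R) : A * B * ((C + D) / 2) = (A * B * D + A * B * C) / 2 by field.
rewrite !H E -!expRD; congr ((expR _ + expR _) / 2); first by field.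
by rewrite sqrrN; field.
Qed.

Lemma expect_cospoly s U V rho : measurable_fun [set: T] U ->
  measurable_fun [set: T] V -> gaussian_pair U V rho ->
  \int[P]_w cospoly s (U w) = \sum_(p <- damp s) p.1.
Proof.
move=> mU mV H; rewrite Rintegral_sum; last first.
  by move=> p; apply: bmeasM; [exact: bmeas_cst|exact: bmeas_cos].
rewrite big_map; apply: eq_bigr => p _ /=.
rewrite RintegralZl//; last by apply: bmeas_integrable; exact: bmeas_cos.
congr (_ * _); have := H p.2 0.
under eq_Rintegral do rewrite mul0r addr0.
by move=> ->; congr expR; rewrite expr0n/=; field.
Qed.

Lemma expect_cospolyM s U V rho : measurable_fun [set: T] U ->
  measurable_fun [set: T] V -> gaussian_pair U V rho ->
  \int[P]_w (cospoly s (U w) * cospoly s (V w)) = cosh_kernel (damp s) rho.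
Proof.
move=> mU mV H.
have bc (p : R * R) (W : T -> R) : measurable_fun [set: T] W -> bmeas (fun w => p.1 * cos (p.2 * W w)).
  by move=> mW; apply: bmeasM; [exact: bmeas_cst|exact: bmeas_cos].
under eq_Rintegral do rewrite /cospoly big_distrlr/=.
rewrite Rintegral_sum; last by move=> p; apply: bmeas_sum => q; apply: bmeasM; exact: bc.
rewrite /cosh_kernel big_map; apply: eq_bigr => p _.
rewrite Rintegral_sum; last by move=> q; apply: bmeasM; exact: bc.
rewrite big_map; apply: eq_bigr => q _ /=.
under eq_Rintegral do rewrite mulrACA.
rewrite RintegralZl//; last first.
  by apply: bmeas_integrable; apply: bmeasM; exact: bmeas_cos.
by rewrite (expect_cosM _ _ mU mV H); ring.
Qed.

(** After expansion of the square each covariance is the kernel at [rho i j] minus the squared mean.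
    Covariances are bounded from above only, so the weights must be nonnegative for the bounds to be
    summed. *)
Lemma variance_cospoly s n (X : 'I_n -> T -> R) (rho : 'I_n -> 'I_n -> R) (w : 'I_n -> R) :
  (forall i, measurable_fun [set: T] (X i)) ->
  (forall i, 0 <= w i) -> (forall i j, `|rho i j| <= 1) ->
  (forall i j, gaussian_pair (X i) (X j) (rho i j)) ->
  (\int[P]_t ((\sum_i w i * (cospoly s (X i t) - \sum_(p <- damp s) p.1)) ^+ 2)%:E <=
  ((\sum_i \sum_j w i * w j * rho i j ^+ 2) * cosh_kernel (damp s) 1)%:E)%E.
Proof.
move=> mX w0 rho1 H; set m := \sum_(p <- damp s) p.1.
have bX i : bmeas (fun t => cospoly s (X i t)) by exact: bmeas_cospoly.
have bXm i : bmeas (fun t => cospoly s (X i t) - m) by apply: bmeasD => //; exact: bmeas_cst.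
have bXw i : bmeas (fun t => w i * (cospoly s (X i t) - m)) by apply: bmeasM => //; exact: bmeas_cst.
have bXX i j : bmeas (fun t => w i * (cospoly s (X i t) - m) * (w j * (cospoly s (X j t) - m))).
  by apply: bmeasM; exact: bXw.
rewrite bmeas_RintegralE; last first.
  under eq_fun do rewrite expr2.
  by apply: bmeasM; apply: bmeas_sum => i; exact: bXw.
rewrite lee_fin.
under eq_Rintegral do rewrite expr2 big_distrlr/=.
rewrite Rintegral_sum; last by move=> i; apply: bmeas_sum => j; exact: bXX.
rewrite mulr_suml; apply: ler_sum => i _.
rewrite Rintegral_sum; last by move=> j; exact: bXX.
rewrite mulr_suml; apply: ler_sum => j _.
under eq_Rintegral do rewrite mulrACA.
rewrite RintegralZl//; last by apply: bmeas_integrable; apply: bmeasM; exact: bXm.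
rewrite -mulrA; apply: ler_wpM2l; first by rewrite mulr_ge0.
have -> : \int[P]_t ((cospoly s (X i t) - m) * (cospoly s (X j t) - m)) =
   \int[P]_t (cospoly s (X i t) * cospoly s (X j t) + (- m * cospoly s (X i t) + (- m * cospoly s (X j t) + m ^+ 2))).
  by apply: eq_Rintegral => t _; ring.
have bm i' : bmeas (fun t => - m * cospoly s (X i' t)) by apply: bmeasM => //; exact: bmeas_cst.
have bc : bmeas (fun t : T => m ^+ 2) by exact: bmeas_cst.
rewrite RintegralD//; last 2 first.
- by apply: bmeas_integrable; exact: bmeasM.
- by apply: bmeas_integrable; do 2 apply: bmeasD => //.
rewrite RintegralD//; last 2 first.
- exact: bmeas_integrable.
- by apply: bmeas_integrable; apply: bmeasD.
rewrite RintegralD//; [|exact: bmeas_integrable..].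
have E i' : \int[P]_t (- m * cospoly s (X i' t)) = - m * m.
  rewrite RintegralZl//; last exact: bmeas_integrable.
  by rewrite (expect_cospoly _ (mX i') (mX i') (H i' i')).
rewrite !E (expect_cospolyM _ (mX i) (mX j) (H i j)).
have -> : \int[P]_t m ^+ 2 = m ^+ 2.
  by rewrite /Rintegral integral_cst//; have := @probability_setT _ _ _ P => /= ->; rewrite mule1.
have := cosh_kernel_le (damp s) (rho1 i j); rewrite -/m; lra.
Qed.

End cosine_polynomials.

Section cosine_polynomials_normal.
Context (R : realType).
Notation N01 := (normal_prob (0 : R) 1).

Lemma gaussian_pair_normal : gaussian_pair N01 id id 1.
Proof.
move=> a b /=; under eq_Rintegral do rewrite -mulrDl.
by rewrite cf_normal; congr expR; field.
Qed.

(** A standard normal variable paired with itself has correlation 1, which identifies the kernel at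
    1 as a second moment. *)
Lemma expect_cospoly_sqr (s : seq (R * R)) :
  (\int[N01]_x ((cospoly s x) ^+ 2)%:E)%E = (cosh_kernel (damp s) 1)%:E.
Proof.
have bs : @bmeas _ _ R (fun x : measurableTypeR R => cospoly s x) by exact: (@bmeas_cospoly _ (measurableTypeR R)).
rewrite -(@expect_cospolyM _ _ R N01 s id id 1 (@measurable_id _ _ _) (@measurable_id _ _ _) gaussian_pair_normal).
rewrite -bmeas_RintegralE; last exact: (bmeasM bs bs).
by apply: eq_integral => x _; rewrite expr2.
Qed.

End cosine_polynomials_normal.

(** * L2 approximation by cosine polynomials *)

Section span.
Context {R : realType} (phi : R -> R -> R).

(** Instantiated with cosines and with Gaussians exp (- |a| x^2). In both families the product of
    two members is again in the span, so powers and products stay there. *)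
Definition spanned (f : R -> R) :=
  exists s : seq (R * R), forall x, f x = \sum_(p <- s) p.1 * phi p.2 x.

Lemma spanned_gen a : spanned (phi a).
Proof. by exists [:: (1, a)] => x; rewrite big_seq1 mul1r. Qed.

Lemma spannedD f g : spanned f -> spanned g -> spanned (fun x => f x + g x).
Proof. by move=> [s fs] [t gt]; exists (s ++ t) => x; rewrite big_cat fs gt. Qed.

Lemma spannedZ c f : spanned f -> spanned (fun x => c * f x).
Proof.
move=> [s fs]; exists [seq (c * p.1, p.2) | p <- s] => x.
by rewrite big_map fs mulr_sumr; apply: eq_bigr => p _; rewrite mulrA.
Qed.

Lemma eq_spanned f g : f =1 g -> spanned f -> spanned g.
Proof. by move=> fg [s fs]; exists s => x; rewrite -fg. Qed.

Lemma spanned_sum I (r : seq I) (F : I -> R -> R) :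
  (forall i, spanned (F i)) -> spanned (fun x => \sum_(i <- r) F i x).
Proof.
move=> sF; elim: r => [|i r IH]; first by exists [::] => x; rewrite !big_nil.
by apply: eq_spanned (spannedD (sF i) IH) => x; rewrite big_cons.
Qed.

Hypothesis phiM : forall a b, spanned (fun x => phi a x * phi b x).
Hypothesis phi1 : spanned (fun=> 1).

Lemma spannedM f g : spanned f -> spanned g -> spanned (fun x => f x * g x).
Proof.
move=> [s fs] [t gt].
have H : spanned (fun x => \sum_(p <- s) \sum_(q <- t) (p.1 * q.1) * (phi p.2 x * phi q.2 x)).
  by do 2!apply: spanned_sum => ?; exact: spannedZ.
apply: eq_spanned H => x; rewrite fs gt big_distrlr/=.
by apply: eq_bigr => p _; apply: eq_bigr => q _; rewrite mulrACA.
Qed.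

Lemma spannedX n f : spanned f -> spanned (fun x => f x ^+ n).
Proof.
move=> sf; elim: n => [|n IH]; first by apply: eq_spanned phi1.
by apply: eq_spanned (spannedM sf IH) => x; rewrite exprS.
Qed.

End span.

Section L2_closure.
Context {R : realType}.
Notation N01 := (normal_prob (0 : R) 1).
Implicit Types (f g h : R -> R).

(** The closure of the cosine polynomials in L2 of the standard normal law; the variance bound
    extends to it by approximation. *)
Definition cosL2 f := measurable_fun [set: R] f /\
  forall e : R, 0 < e -> exists s,
    (\int[N01]_x ((f x - cospoly s x) ^+ 2)%:E <= e%:E)%E.

Lemma measurable_cospoly (s : seq (R * R)) : measurable_fun [set: R] (cospoly s).
Proof.
by apply: measurable_sum => p; apply: measurable_funM => //; exact: measurable_cosM.
Qed.

Lemma sqr_addr_le (a b : R) : (a + b) ^+ 2 <= 2 * a ^+ 2 + 2 * b ^+ 2.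
Proof. by have := sqr_ge0 (a - b); nra. Qed.

Lemma le_expect_sqrD f g : measurable_fun [set: R] f -> measurable_fun [set: R] g ->
  (\int[N01]_x ((f x + g x) ^+ 2)%:E <=
   2%:E * \int[N01]_x (f x ^+ 2)%:E + 2%:E * \int[N01]_x (g x ^+ 2)%:E)%E.
Proof.
move=> mf mg.
have mf2 : measurable_fun [set: R] (fun x => f x ^+ 2) by exact: measurable_funX.
have mg2 : measurable_fun [set: R] (fun x => g x ^+ 2) by exact: measurable_funX.
rewrite -!ge0_integralZl//; last 4 first.
- exact/measurable_EFinP.
- by move=> x _; rewrite lee_fin sqr_ge0.
- exact/measurable_EFinP.
- by move=> x _; rewrite lee_fin sqr_ge0.
rewrite -ge0_integralD//; last 4 first.
- by move=> x _; rewrite -EFinM lee_fin mulr_ge0 ?sqr_ge0.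
- by under eq_fun do rewrite -EFinM; apply/measurable_EFinP; exact: measurable_funM.
- by move=> x _; rewrite -EFinM lee_fin mulr_ge0 ?sqr_ge0.
- by under eq_fun do rewrite -EFinM; apply/measurable_EFinP; exact: measurable_funM.
apply: ge0_le_integral => //=.
- by move=> x _; rewrite lee_fin sqr_ge0.
- by apply/measurable_EFinP; apply: measurable_funX; exact: measurable_funD.
- under eq_fun do rewrite -!EFinM -EFinD; apply/measurable_EFinP.
  by apply: measurable_funD; exact: measurable_funM.
- by move=> x _; rewrite -!EFinM -EFinD lee_fin sqr_addr_le.
Qed.

Lemma le_expect_sqrD_fin f g (a b : R) : measurable_fun [set: R] f -> measurable_fun [set: R] g ->
  (\int[N01]_x (f x ^+ 2)%:E <= a%:E)%E -> (\int[N01]_x (g x ^+ 2)%:E <= b%:E)%E ->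
  (\int[N01]_x ((f x + g x) ^+ 2)%:E <= (2 * a + 2 * b)%:E)%E.
Proof.
move=> mf mg fa gb; apply: (le_trans (le_expect_sqrD mf mg)).
apply: (@le_trans _ _ (2%:E * a%:E + 2%:E * b%:E)%E); last by rewrite -!EFinM -EFinD.
by apply: leeD; apply: lee_wpmul2l; rewrite ?lee_fin.
Qed.

Lemma cosL2_lim f : measurable_fun [set: R] f ->
  (forall e : R, 0 < e -> exists2 g, cosL2 g &
    (\int[N01]_x ((f x - g x) ^+ 2)%:E <= e%:E)%E) -> cosL2 f.
Proof.
move=> mf H; split => // e e0.
have e4 : 0 < e / 4 by rewrite divr_gt0.
have [g [mg Hg] fg] := H _ e4; have [s gs] := Hg _ e4; exists s.
have := le_expect_sqrD_fin (measurable_funB mf mg)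
  (measurable_funB mg (measurable_cospoly s)) fg gs.
rewrite (_ : 2 * _ + _ = e); last by field.
by under eq_integral do rewrite addrA subrK.
Qed.

Lemma cosL2D f g : cosL2 f -> cosL2 g -> cosL2 (fun x => f x + g x).
Proof.
move=> [mf Hf] [mg Hg]; split; first exact: measurable_funD.
move=> e e0; have e4 : 0 < e / 4 by rewrite divr_gt0.
have [s fs] := Hf _ e4; have [t gt] := Hg _ e4; exists (s ++ t).
have := le_expect_sqrD_fin (measurable_funB mf (measurable_cospoly s))
  (measurable_funB mg (measurable_cospoly t)) fs gt.
rewrite (_ : 2 * _ + _ = e); last by field.
by under [X in _ -> (X <= _)%E]eq_integral do rewrite /cospoly big_cat/= opprD addrACA.
Qed.

Lemma cosL2Z (c : R) f : cosL2 f -> cosL2 (fun x => c * f x).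
Proof.
move=> [mf Hf]; split; first exact: measurable_funM.
move=> e e0; have e4 : 0 < e / (c ^+ 2 + 1) by rewrite divr_gt0// ltr_wpDl ?sqr_ge0.
have [s fs] := Hf _ e4; exists [seq (c * p.1, p.2) | p <- s].
have -> : (\int[N01]_x ((c * f x - cospoly [seq (c * p.1, p.2) | p <- s] x) ^+ 2)%:E =
    (c ^+ 2)%:E * \int[N01]_x ((f x - cospoly s x) ^+ 2)%:E)%E.
  rewrite -ge0_integralZl//; last 3 first.
  - apply/measurable_EFinP; apply: measurable_funX; apply: measurable_funB => //.
    exact: measurable_cospoly.
  - by move=> x _; rewrite lee_fin sqr_ge0.
  - by rewrite lee_fin sqr_ge0.
  apply: eq_integral => x _; rewrite -EFinM -exprMn mulrBr /cospoly big_map mulr_sumr.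
  by congr (((_ - _) ^+ 2)%:E); apply: eq_bigr => p _; rewrite mulrA.
apply: (@le_trans _ _ ((c ^+ 2)%:E * (e / (c ^+ 2 + 1))%:E))%E.
  by apply: lee_wpmul2l => //; rewrite lee_fin sqr_ge0.
rewrite -EFinM lee_fin mulrA ler_pdivrMr ?ltr_wpDl ?sqr_ge0//.
by rewrite [leLHS]mulrC ler_wpM2l ?(ltW e0)// lerDl.
Qed.

Lemma eq_cosL2 f g : f =1 g -> cosL2 f -> cosL2 g.
Proof. by move=> /funext ->. Qed.

Lemma cosL2_cospoly s : cosL2 (cospoly s).
Proof.
split; first exact: measurable_cospoly.
move=> e e0; exists s; under eq_integral do rewrite subrr expr0n/=.
by rewrite integral0 lee_fin ltW.
Qed.

Lemma cosL2_sum I (r : seq I) (F : I -> R -> R) :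
  (forall i, cosL2 (F i)) -> cosL2 (fun x => \sum_(i <- r) F i x).
Proof.
move=> sF; elim: r => [|i r IH].
  by apply: eq_cosL2 (cosL2_cospoly [::]) => x; rewrite /cospoly !big_nil.
by apply: eq_cosL2 (cosL2D (sF i) IH) => x; rewrite big_cons.
Qed.

(** Dominated convergence of the squared errors. Convergence almost everywhere is enough, which
    matters for indicators, where the approximation fails on the boundary. *)
Lemma cosL2_dominated f (f_ : nat -> R -> R) (c : R) : measurable_fun [set: R] f ->
  (forall n, cosL2 (f_ n)) -> 0 <= c ->
  (forall n x, (f x - f_ n x) ^+ 2 <= c * expR (x ^+ 2 / 4)) ->
  {ae N01, forall x, f_ n x @[n --> \oo] --> f x} -> cosL2 f.
Proof.
move=> mf Hf c0 fc ff; apply: cosL2_lim => // e e0.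
have mD n : measurable_fun [set: R] (fun x => (f x - f_ n x) ^+ 2).
  by apply: measurable_funX; apply: measurable_funB => //; case: (Hf n).
have mE : measurable_fun [set: R] (fun x : R => c * expR (x ^+ 2 / 4)).
  apply: measurable_funM => //.
  by under eq_fun do rewrite mulrC; exact: measurable_expR_sqr.
have [|||||_ _] := @dominated_convergence _ _ _ N01 [set: R] measurableT
  (fun n x => ((f x - f_ n x) ^+ 2)%:E) (cst 0%E) (EFin \o (fun x : R => c * expR (x ^+ 2 / 4))).
- by move=> n; apply/measurable_EFinP; exact: mD.
- exact: measurable_cst.
- have [A [mA A0 sA]] := ff; exists A; split => //.
  apply: subset_trans sA; apply: subsetC => x /= fx _.
  apply: cvg_EFin; first exact: nearW.
  rewrite [X in _ --> X](_ : _ = (f x - f x) ^+ 2); last by rewrite subrr expr0n.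
  by apply: cvgM; (apply: cvgB; [exact: cvg_cst|exact: fx]).
- apply: (@integrable_le_expR_sqr _ _ c) => // x.
  by rewrite ger0_norm// mulr_ge0 ?expR_ge0.
- by apply/aeW => x n _; rewrite /= lee_fin ger0_norm ?sqr_ge0.
rewrite integral0 => /fine_cvgP[_ /cvgr0Pnorm_le/(_ _ e0)[n _ /(_ n (leqnn _))]] /= Hn.
exists (f_ n) => //.
rewrite -[leLHS]fineK; last first.
  rewrite ge0_fin_numE; last by apply: integral_ge0 => x _; rewrite lee_fin sqr_ge0.
  apply: (@le_lt_trans _ _ (2 * c)%:E); last exact: ltry.
  by apply: expect_le_expR_sqr => // x; rewrite sqr_ge0/=.
by rewrite lee_fin (le_trans (ler_norm _)).
Qed.

End L2_closure.

Section gaussian_limits.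
Context {R : realType}.

Lemma bernoulli_expn (y : R) n : 0 <= y <= 1 -> 1 - n%:R * y <= (1 - y) ^+ n.
Proof.
move=> /andP[y0 y1]; elim: n => [|n IH]; first by rewrite mul0r subr0 expr0.
rewrite exprS; apply: (@le_trans _ _ ((1 - y) * (1 - n%:R * y))).
  rewrite -natr1; have : 0 <= n%:R * y ^+ 2 by rewrite mulr_ge0 ?sqr_ge0.
  lra.
by apply: ler_wpM2l => //; rewrite subr_ge0.
Qed.

Lemma expRN_le_inv (y : R) : 0 < y -> expR (- y) <= y^-1.
Proof.
move=> y0; rewrite expRN lef_pV2 ?posrE ?expR_gt0//.
have := expR_ge1Dx y; lra.
Qed.

(** Bernoulli's inequality bounds the term from below by 1 - (2u)^n. *)
Lemma cvg_step_hi (u : R) : 0 <= u < 2^-1 ->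
  (1 - u ^+ n) ^+ (2 ^ n) @[n --> \oo] --> (1 : R).
Proof.
move=> /andP[u0 u2].
apply: (squeeze_cvgr (f := fun n => 1 - (2 * u) ^+ n) (h := cst 1)); last exact: cvg_cst.
  near=> n.
  have un : 0 <= u ^+ n <= 1.
    by rewrite exprn_ge0//= exprn_ile1//; lra.
  have /andP[un0 un1] := un.
  rewrite exprn_ile1 ?andbT; last 2 first.
    by rewrite subr_ge0.
    by rewrite lerBlDr lerDl.
  by rewrite exprMn -natrX; exact: bernoulli_expn.
rewrite -[X in _ --> X]subr0; apply: cvgB; first exact: cvg_cst.
by apply: cvg_expr; rewrite ger0_norm ?mulr_ge0//; lra.
Unshelve. all: by end_near. Qed.

(** From 1 - y <= exp (- y) the term is at most exp (- (2u)^n), hence at most the inverse of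
    (2u)^n. *)
Lemma cvg_step_lo (u : R) : 2^-1 < u <= 1 ->
  (1 - u ^+ n) ^+ (2 ^ n) @[n --> \oo] --> (0 : R).
Proof.
move=> /andP[u2 u1]; have u0 : 0 < u by lra.
apply: (squeeze_cvgr (f := cst 0) (h := fun n => ((2 * u)^-1) ^+ n)); first last.
- by apply: cvg_expr; rewrite ger0_norm ?invr_ge0 ?mulr_ge0 ?(ltW u0)// invf_lt1 ?mulr_gt0//; lra.
- exact: cvg_cst.
near=> n.
have un0 : 0 < u ^+ n by rewrite exprn_gt0.
have un1 : u ^+ n <= 1 by rewrite exprn_ile1// ltW.
rewrite exprn_ge0 ?subr_ge0//=.
apply: (@le_trans _ _ (expR (- u ^+ n) ^+ (2 ^ n))).
  by rewrite lerXn2r ?nnegrE ?subr_ge0 ?expR_ge0//; have := expR_ge1Dx (- u ^+ n); lra.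
rewrite -expRM_natl natrX mulrN -exprMn exprVn; apply: expRN_le_inv.
by rewrite exprn_gt0// mulr_gt0.
Unshelve. all: by end_near. Qed.

(** With z = x^2 this approximates the unbounded square by a constant plus a multiple of a Gaussian,
    from below. The squeeze is z/(1 + z/(n+1)) <= . <= z. *)
Lemma cvg_sqr_expR (z : R) : 0 <= z ->
  n.+1%:R * (1 - expR (- (z / n.+1%:R))) @[n --> \oo] --> z.
Proof.
move=> z0.
apply: (squeeze_cvgr (f := fun n => z / (1 + z * n.+1%:R^-1)) (h := cst z)); last exact: cvg_cst.
  near=> n.
  have n0 : 0 < n.+1%:R :> R by [].
  have y0 : 0 <= z / n.+1%:R by rewrite divr_ge0.
  set y := z / n.+1%:R in y0 *.
  have zE : z = n.+1%:R * y by rewrite /y mulrCA divff ?mulr1// gt_eqF.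
  apply/andP; split.
    rewrite -/y {1}zE -mulrA ler_pM2l// expRN.
    have := expR_ge1Dx y; move: (expR y) (expR_gt0 y) => E E0 yE.
    have y1 : 0 < 1 + y by lra.
    rewrite ler_pdivrMr// mulrBl mul1r.
    have : E^-1 * (1 + y) <= 1 by rewrite mulrC ler_pdivrMr// mul1r.
    lra.
  rewrite /cst zE ler_pM2l//; have := expR_ge1Dx (- y); lra.
rewrite -[X in _ --> X](_ : z / (1 + z * 0) = z); last by rewrite mulr0 addr0 divr1.
apply: cvgM; first exact: cvg_cst.
apply: cvgV; first by rewrite mulr0 addr0 oner_neq0.
apply: cvgD; first exact: cvg_cst.
apply: cvgM; first exact: cvg_cst.
exact: cvg_harmonic.
Unshelve. all: by end_near. Qed.

Lemma cvg_sin_ratio (y : nat -> R) : (forall n, y n != 0) -> y @ \oo --> (0 : R) ->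
  sin (y n) / y n @[n --> \oo] --> (1 : R).
Proof.
move=> yn0 y0.
have := @ex_derive _ _ _ _ _ _ _ (is_derive_sin (0 : R)).
have dv := @derive_val _ _ _ _ _ _ _ (is_derive_sin (0 : R)).
rewrite /derivable => /cvg_ex[/= l Hl].
have lE : l = 1.
  by rewrite -(cos0 R) -dv /derive; apply/esym/cvg_lim.
have /cvgr_dnbhsP/(_ y (conj yn0 y0)) := Hl; rewrite lE.
under eq_fun do rewrite scaler1 addr0 sin0 subr0.
by under [X in _ -> X @ _ --> _]eq_fun do rewrite mulrC.
Qed.

(** Write the squared cosine as 1 - v with (n+1) v tending to z^2, and use exp (- v/(1 - v)) <= 1 -
    v <= exp (- v). It realises Gaussians as limits of cosine polynomials. *)
Lemma cvg_cos_pow (z : R) :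
  (cos (z / Num.sqrt n.+1%:R) ^+ 2) ^+ n.+1 @[n --> \oo] --> expR (- z ^+ 2).
Proof.
have [->|z0] := eqVneq z 0.
  under eq_fun do rewrite mul0r cos0 !expr1n.
  by rewrite expr0n/= oppr0 expR0; exact: cvg_cst.
pose y n : R := z / Num.sqrt n.+1%:R.
have sn n : 0 < Num.sqrt n.+1%:R :> R by rewrite sqrtr_gt0.
have yn0 n : y n != 0 by rewrite mulf_neq0// invr_neq0// gt_eqF.
have y0 : y @ \oo --> (0 : R).
  have -> : y = (fun n => z * Num.sqrt n.+1%:R^-1) by apply/funext => n; rewrite /y sqrtrV.
  rewrite -[X in _ --> X](mulr0 z) -[X in _ * X](@sqrtr0 R).
  apply: cvgM; first exact: cvg_cst.
  by apply: continuous_cvg; [exact: sqrt_continuous|exact: cvg_harmonic].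
have sr := cvg_sin_ratio yn0 y0.
pose v n := sin (y n) ^+ 2.
have mv : n.+1%:R * v n @[n --> \oo] --> z ^+ 2.
  have -> : (fun n => n.+1%:R * v n) = (fun n => z ^+ 2 * (sin (y n) / y n) ^+ 2).
    apply/funext => n.
    have -> : n.+1%:R = z ^+ 2 / y n ^+ 2.
      rewrite /y expr_div_n sqr_sqrtr// invf_div mulrCA divff ?mulr1//.
      by rewrite expf_neq0.
    by rewrite /v (expr_div_n (sin _)); ring.
  rewrite -[X in _ --> X]mulr1; apply: cvgM; first exact: cvg_cst.
  by rewrite -[X in _ --> X](expr1n _ 2); apply: cvgM.
have v0 : v n @[n --> \oo] --> (0 : R).
  rewrite -(sin0 R) -[X in _ --> X](_ : sin 0 ^+ 2 = sin 0 :> R); last by rewrite sin0 expr0n.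
  by apply: cvgM; apply: continuous_cvg => //; exact: continuous_sin.
have -> : (fun n => (cos (z / Num.sqrt n.+1%:R) ^+ 2) ^+ n.+1) = (fun n => (1 - v n) ^+ n.+1).
  by apply/funext => n; rewrite -/(y n) cos2sin2.
apply: (squeeze_cvgr (f := fun n => expR (- (n.+1%:R * v n / (1 - v n)))) (h := fun n => expR (- (n.+1%:R * v n)))).
- near=> n.
  have vn0 : 0 <= v n by exact: sqr_ge0.
  have vn1 : v n < 1.
    near: n; apply: (cvgr_lt _ v0); exact: ltr01.
  have v1 : 0 < 1 - v n by rewrite subr_gt0.
  apply/andP; split.
    rewrite -mulrA -mulrN expRM_natl lerXn2r ?nnegrE ?expR_ge0 ?(ltW v1)//.
    rewrite expRN -[leRHS]invrK lef_pV2 ?posrE ?expR_gt0 ?invr_gt0//.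
    apply: le_trans (expR_ge1Dx _).
    by rewrite le_eqVlt; apply/orP; left; apply/eqP; field; rewrite gt_eqF.
  rewrite -[X in expR X]mulrN expRM_natl lerXn2r ?nnegrE ?expR_ge0 ?(ltW v1)//.
  by have := expR_ge1Dx (- v n); lra.
- apply: continuous_cvg; first exact: continuous_expR.
  apply: cvgN; rewrite -[X in _ --> X](_ : z ^+ 2 / (1 - 0) = z ^+ 2); last by rewrite subr0 divr1.
  apply: cvgM => //; apply: cvgV; first by rewrite subr0 oner_neq0.
  by apply: cvgB => //; exact: cvg_cst.
- by apply: continuous_cvg; [exact: continuous_expR|exact: cvgN].
Unshelve. all: by end_near. Qed.


End gaussian_limits.

Section cosL2_members.
Context {R : realType}.
Notation N01 := (normal_prob (0 : R) 1).

Let phic (a x : R) := cos (a * x).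
(** The absolute value makes every real index give a bounded Gaussian, as [spanned] ranges over all
    reals. *)
Let phie (a x : R) := expR (- (`|a| * x ^+ 2)).

Lemma phic_mul a b : spanned phic (fun x => phic a x * phic b x).
Proof.
apply: (eq_spanned (f := fun x => 2^-1 * phic (a + b) x + 2^-1 * phic (a - b) x)).
  by move=> x; rewrite /phic cosM mulrDl mulrBl; lra.
by apply: spannedD; apply: spannedZ; exact: spanned_gen.
Qed.

Lemma phic_one : spanned phic (fun=> 1).
Proof. by apply: eq_spanned (spanned_gen phic 0) => x; rewrite /phic mul0r cos0. Qed.

Lemma phie_mul a b : spanned phie (fun x => phie a x * phie b x).
Proof.
apply: eq_spanned (spanned_gen phie (`|a| + `|b|)) => x.
by rewrite /phie ger0_norm ?addr_ge0// -expRD -opprD mulrDl.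
Qed.

Lemma phie_one : spanned phie (fun=> 1).
Proof.
by apply: eq_spanned (spanned_gen phie 0) => x; rewrite /phie normr0 mul0r oppr0 expR0.
Qed.

Lemma spanned_cos_cosL2 f : spanned phic f -> cosL2 f.
Proof.
by move=> [s fs]; apply: eq_cosL2 (cosL2_cospoly s) => x; rewrite fs.
Qed.

Lemma cosL2_bounded (f : R -> R) (f_ : nat -> R -> R) : measurable_fun [set: R] f ->
  (forall n, cosL2 (f_ n)) -> (forall x, 0 <= f x <= 1) ->
  (forall n x, 0 <= f_ n x <= 1) ->
  {ae N01, forall x, f_ n x @[n --> \oo] --> f x} -> cosL2 f.
Proof.
move=> mf Hf f01 fn01 ff; apply: (@cosL2_dominated _ f f_ 1) => // n x.
rewrite mul1r (le_trans _ (expR_sqr_ge1 x))//.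
by have := f01 x; have := fn01 n x; nra.
Qed.

(** Powers of a squared cosine are cosine polynomials with values in [0, 1], so their pointwise
    convergence to the Gaussian is bounded convergence. *)
Lemma cosL2_expR (a : R) : cosL2 (phie a).
Proof.
pose f_ (n : nat) (x : R) := (cos (Num.sqrt `|a| / Num.sqrt n.+1%:R * x) ^+ 2) ^+ n.+1.
apply: (@cosL2_bounded _ f_).
- rewrite /phie; under eq_fun do rewrite -mulNr.
  exact: measurable_expR_sqr.
- move=> n; apply: spanned_cos_cosL2.
  apply: (spannedX phic_mul phic_one n.+1 (f := fun x => cos (Num.sqrt `|a| / Num.sqrt n.+1%:R * x) ^+ 2)).
  by apply: (spannedX phic_mul phic_one 2); exact: (spanned_gen phic).
- by move=> x; rewrite expR_ge0/= expR_le1 oppr_le0 mulr_ge0 ?sqr_ge0.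
- by move=> n x; rewrite /f_ exprn_ge0 ?sqr_ge0//= exprn_ile1 ?sqr_ge0//.
- apply/aeW => x; rewrite /phie.
  have -> : `|a| * x ^+ 2 = (Num.sqrt `|a| * x) ^+ 2 by rewrite exprMn sqr_sqrtr.
  have -> : (fun n => f_ n x) = (fun n => (cos (Num.sqrt `|a| * x / Num.sqrt n.+1%:R) ^+ 2) ^+ n.+1).
    by apply/funext => n; rewrite /f_ mulrAC.
  exact: cvg_cos_pow.
Qed.

Lemma spanned_exp_cosL2 f : spanned phie f -> cosL2 f.
Proof.
move=> [s fs]; apply: (eq_cosL2 (f := fun x => \sum_(p <- s) p.1 * phie p.2 x)) => [x|].
  by rewrite fs.
by apply: cosL2_sum => p; apply: cosL2Z; exact: cosL2_expR.
Qed.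

(* With [u = 2^(- x^2/t)], [(1 - u^n)^(2^n)] tends to [0] for [u > 1/2], i.e. for [x^2 < t], and to
   [1] for [x^2 > t]. *)
Let step (t : R) (n : nat) (x : R) := (1 - expR (- (ln 2 / t * x ^+ 2)) ^+ n) ^+ (2 ^ n).

Lemma spanned_step (t : R) n : 0 < t -> spanned phie (step t n).
Proof.
move=> t0; apply: (spannedX phie_mul phie_one (2 ^ n) (f := fun x => 1 - expR (- (ln 2 / t * x ^+ 2)) ^+ n)).
apply: (eq_spanned (f := fun x => 1 + (-1) * expR (- (ln 2 / t * x ^+ 2)) ^+ n)).
  by move=> x; rewrite mulN1r.
apply: spannedD; first exact: phie_one.
apply: spannedZ; apply: (spannedX phie_mul phie_one n (f := fun x => expR (- (ln 2 / t * x ^+ 2)))).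
apply: eq_spanned (spanned_gen phie (ln 2 / t)) => x; rewrite /phie ger0_norm//.
by rewrite divr_ge0 ?ltW// ln_gt0// ltr1n.
Qed.

Lemma step01 (t : R) n (x : R) : 0 < t -> 0 <= step t n x <= 1.
Proof.
move=> t0; have l2 : 0 <= ln 2 / t by rewrite divr_ge0 ?ltW// ln_gt0// ltr1n.
have e1 : 0 <= expR (- (ln 2 / t * x ^+ 2)) ^+ n <= 1.
  rewrite exprn_ge0 ?expR_ge0//= exprn_ile1 ?expR_ge0// expR_le1 oppr_le0.
  by rewrite mulr_ge0 ?sqr_ge0.
by rewrite /step exprn_ge0 ?exprn_ile1//; lra.
Qed.

Lemma cvg_step (t x : R) : 0 < t -> x ^+ 2 != t ->
  step t n x @[n --> \oo] --> (if t < x ^+ 2 then 1 else 0 : R).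
Proof.
move=> t0 xt.
have l2 : 0 < ln (2 : R) by rewrite ln_gt0// ltr1n.
have e2 : expR (- ln 2) = 2^-1 :> R by rewrite expRN lnK// posrE.
case: ifPn => [tx|].
  apply: cvg_step_hi; rewrite expR_ge0/= -e2 ltr_expR ltrN2 mulrAC ltr_pdivlMr//.
  by rewrite ltr_pM2l.
rewrite -leNgt le_eqVlt (negbTE xt)/= => {}xt.
apply: cvg_step_lo; rewrite -e2 ltr_expR ltrN2 mulrAC ltr_pdivrMr// ltr_pM2l// xt/=.
by rewrite expR_le1 oppr_le0; apply: divr_ge0; [apply: mulr_ge0; [exact: ltW|exact: sqr_ge0]|exact: ltW].
Qed.

(** At x^2 = t the approximating steps do not tend to 0 or 1; this boundary consists of at most two
    points, hence is a null set. *)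
Lemma ae_sqr_neq (t : R) : {ae N01, forall x : R, x ^+ 2 != t}.
Proof.
exists ([set Num.sqrt t] `|` [set - Num.sqrt t]); split.
- by apply: measurableU; exact: measurable_set1.
- apply/eqP; rewrite eq_le measure_ge0 andbT.
  have z (a : R) : N01 [set a] = 0%E.
    apply/eqP; rewrite eq_le measure_ge0 andbT -set_itv1.
    by rewrite (le_trans (normal_prob_itv_le (lexx a)))// subrr.
  rewrite (le_trans (measureU2 _ _ _))//=; try exact: measurable_set1.
  by rewrite !z adde0.
- move=> x /= /negP; rewrite negbK => /eqP <-; rewrite sqrtr_sqr.
  by have [x0|x0] := leP 0 x; [left; rewrite ger0_norm|right; rewrite ltr0_norm// opprK].
Qed.

Lemma cosL2_indicator (t : R) : 0 < t -> cosL2 (fun x => if x ^+ 2 <= t then 1 else 0).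
Proof.
move=> t0.
have H : cosL2 (fun x => if t < x ^+ 2 then 1 else 0).
  apply: (@cosL2_bounded _ (step t)).
  - by apply: measurable_fun_ifT => //; apply: measurable_fun_ltr => //; exact: measurable_funX.
  - by move=> n; apply: spanned_exp_cosL2; exact: spanned_step.
  - by move=> x; case: ifP; rewrite ?lexx ?ler01.
  - by move=> n x; exact: step01.
  - have [A [mA A0 sA]] := ae_sqr_neq t; exists A; split => //.
    by apply: subset_trans sA; apply: subsetC => x /= xt; exact: cvg_step.
have H1 := cosL2D (cosL2_cospoly [:: (1, 0)]) (cosL2Z (-1) H).
apply: eq_cosL2 H1 => x; rewrite /cospoly big_seq1/= mul0r cos0.
by rewrite ltNge; case: (x ^+ 2 <= t) => /=; lra.
Qed.

(** The approximant is the product of the Gaussian approximation of x^2 and of the smooth step. Both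
    factors are in the span of Gaussians and the product lies between 0 and x^2, so the squared
    error is at most x^4, which the exponential envelope dominates. *)
Lemma cosL2_tail (t : R) : 0 < t -> cosL2 (fun x => if t <= `|x| then x ^+ 2 else 0).
Proof.
move=> t0; have t20 : 0 < t ^+ 2 by rewrite exprn_gt0.
pose f_ n x := n.+1%:R * (1 - expR (- (x ^+ 2 / n.+1%:R))) * step (t ^+ 2) n x.
have fn n x : 0 <= f_ n x <= x ^+ 2.
  have /andP[s0 s1] := step01 n x t20.
  have n0 : 0 < n.+1%:R :> R by [].
  have y0 : 0 <= x ^+ 2 / n.+1%:R by rewrite divr_ge0 ?sqr_ge0.
  have A0 : 0 <= n.+1%:R * (1 - expR (- (x ^+ 2 / n.+1%:R))).
    by rewrite mulr_ge0// subr_ge0 expR_le1 oppr_le0.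
  rewrite mulr_ge0//= -[leRHS]mulr1 ler_pM//.
  rewrite mulrC -ler_pdivlMr//; move: (x ^+ 2 / _) => y; have := expR_ge1Dx (- y); lra.
apply: (@cosL2_dominated _ _ f_ 128) => //.
- exact: measurable_tail.
- move=> n; apply: spanned_exp_cosL2; apply: (spannedM phie_mul); last exact: spanned_step.
  apply: spannedZ; apply: (eq_spanned (f := fun x => 1 + (-1) * phie n.+1%:R^-1 x)).
    by move=> x; rewrite mulN1r /phie ger0_norm// [_^-1 * _]mulrC.
  apply: spannedD; first exact: phie_one.
  by apply: spannedZ; exact: spanned_gen.
- move=> n x; have /andP[a b] := fn n x.
  have x4 : (x ^+ 2) ^+ 2 <= 128 * expR (x ^+ 2 / 4).
    have x80 : 0 <= x ^+ 2 / 8 by rewrite divr_ge0 ?sqr_ge0.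
    have := expR_ge_half_sqr x80; rewrite expr_div_n.
    have : expR (x ^+ 2 / 8) <= expR (x ^+ 2 / 4) by rewrite ler_expR; have := sqr_ge0 x; lra.
    move: (expR _) (expR _) => e f; lra.
  apply: le_trans x4; have := sqr_ge0 x; case: ifP => _; nra.
- have [A [mA A0 sA]] := ae_sqr_neq (t ^+ 2); exists A; split => //.
  apply: subset_trans sA; apply: subsetC => x /= xt.
  have -> : (if t <= `|x| then x ^+ 2 else 0) = x ^+ 2 * (if t ^+ 2 < x ^+ 2 then 1 else 0).
    have -> : (t ^+ 2 < x ^+ 2) = (t <= `|x|).
      rewrite lt_neqAle eq_sym xt/= -[x ^+ 2]real_normK ?num_real//.
      by rewrite ler_sqr// nnegrE; exact: ltW.
    by case: ifP; rewrite ?mulr1 ?mulr0.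
  by apply: cvgM; [apply: cvg_sqr_expR; exact: sqr_ge0|exact: cvg_step].
Qed.

End cosL2_members.

(** * Laws of the standardized noise *)

Section transfer.
Context d (T : measurableType d) (R : realType) (P : probability T R).
Notation N01 := (normal_prob (0 : R) 1).
Implicit Types (W : T -> R) (f : R -> R).

Definition has_law W (Q : set R -> \bar R) :=
  measurable_fun [set: T] W /\
  forall B, measurable B -> P [set w | B (W w)] = Q B.

Lemma ge0_integral_law W (Q : {measure set (measurableTypeR R) -> \bar R}) f :
  has_law W Q -> measurable_fun [set: R] f -> (forall x, 0 <= f x) ->
  (\int[P]_w (f (W w))%:E = \int[Q]_x (f x)%:E)%E.
Proof.
move=> [mW lW] mf f0.
have mW' : measurable_fun [set: T] (W : T -> measurableTypeR R) by exact: mW.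
pose X : {RV P >-> measurableTypeR R} := HB.pack W (isMeasurableFun.Build _ _ _ _ _ mW').
transitivity (\int[distribution P X]_x (f x)%:E)%E.
  rewrite (@ge0_integral_distribution _ _ _ _ _ P X (EFin \o f))//.
  exact/measurable_EFinP.
by apply: eq_measure_integral => A mA _; exact: lW.
Qed.

Lemma integral_law W (Q : {measure set (measurableTypeR R) -> \bar R}) f (M : R) :
  has_law W Q -> measurable_fun [set: R] f -> (forall x, `|f x| <= M) ->
  \int[P]_w f (W w) = \int[Q]_x f x.
Proof.
move=> [mW lW] mf fM.
have mW' : measurable_fun [set: T] (W : T -> measurableTypeR R) by exact: mW.
pose X : {RV P >-> measurableTypeR R} := HB.pack W (isMeasurableFun.Build _ _ _ _ _ mW').
congr fine; transitivity (\int[distribution P X]_x (f x)%:E)%E.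
  rewrite (@integral_distribution _ _ _ _ _ P X (EFin \o f))//.
    exact/measurable_EFinP.
  apply: bmeas_integrable; split; first exact: measurableT_comp.
  by exists M => x; exact: fM.
by apply: eq_measure_integral => A mA _; exact: lW.
Qed.

End transfer.

Section gaussian_vector_laws.
Context (d : nat) (dT : measure_display) (T : measurableType dT) (R : realType)
  (P : probability T R) (eps : 'I_d -> T -> R) (S : 'M[R]_d).
Hypothesis geps : gaussian_vector P eps S.
Hypothesis covS : covariance_matrix S.
Notation N01 := (normal_prob (0 : R) 1).

Definition qform (u : 'I_d -> R) : R := \sum_i \sum_j u i * S i j * u j.

Lemma measurable_linear (u : 'I_d -> R) :
  measurable_fun [set: T] (fun w => \sum_i u i * eps i w).
Proof.
by apply: measurable_sum => i; apply: measurable_funM => //; case: geps.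
Qed.

Lemma law_linear1 u : qform u = 1 -> has_law P (fun w => \sum_i u i * eps i w) N01.
Proof.
move=> q1; split; first exact: measurable_linear.
move=> B mB; have [_ ->//] := geps; rewrite /gauss_law -/(qform u) q1 oner_eq0.
by rewrite sqrtr1.
Qed.

(** A combination of variance 0 is treated apart: [gauss_law] is then a point mass at 0 and both
    sides equal 1. Such combinations occur for perfectly correlated coordinates. Otherwise the
    combination is normalised. *)
Lemma expect_cos_linear u :
  \int[P]_w cos (\sum_i u i * eps i w) = expR (- (qform u / 2)).
Proof.
have mcos : measurable_fun [set: R] (@cos R).
  exact: continuous_measurable_fun (@continuous_cos R).
have [q0|q0] := eqVneq (qform u) 0.
  rewrite q0 mul0r oppr0 expR0.
  have H : has_law P (fun w => \sum_i u i * eps i w) (\d_(0 : measurableTypeR R)).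
    split; first exact: measurable_linear.
    by move=> B mB; have [_ ->//] := geps; rewrite /gauss_law -/(qform u) q0 eqxx.
  rewrite (integral_law H mcos (@cos_max R)) /Rintegral integral_dirac//; last first.
    exact/measurable_EFinP.
  by rewrite diracT mul1e/= cos0.
have qge0 : 0 <= qform u by case: covS => _; exact.
have qgt0 : 0 < qform u by rewrite lt_def q0.
set r := Num.sqrt (qform u).
have r0 : r != 0 by rewrite gt_eqF// sqrtr_gt0.
have qr : qform u = r ^+ 2 by rewrite sqr_sqrtr.
have q1 : qform (fun i => u i / r) = 1.
  have -> : qform (fun i => u i / r) = qform u / r ^+ 2.
    rewrite /qform mulr_suml; apply: eq_bigr => i _; rewrite mulr_suml; apply: eq_bigr => j _.
    by field.
  by rewrite qr divff// expf_neq0.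
have -> : (fun w => cos (\sum_i u i * eps i w)) = (fun w => cos (r * \sum_i u i / r * eps i w)).
  apply/funext => w; congr cos; rewrite mulr_sumr; apply: eq_bigr => i _.
  by field.
rewrite (@integral_law _ _ _ _ _ _ (fun x => cos (r * x)) 1 (law_linear1 q1))//.
- by rewrite cf_normal qr.
- exact: measurable_cosM.
- by move=> x; exact: cos_max.
Qed.

Hypothesis S0 : forall i, 0 < S i i.

Definition stdeps i w := eps i w / sig_i S i.
Definition corr i j := S i j / (sig_i S i * sig_i S j).

Lemma sig_i_gt0 i : 0 < sig_i S i.
Proof. by rewrite sqrtr_gt0. Qed.

Lemma qform2 i j (a b : R) :
  qform (fun k => a * (k == i)%:R + b * (k == j)%:R) =
  a ^+ 2 * S i i + b ^+ 2 * S j j + 2 * (a * b * S i j).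
Proof.
have Sji : S j i = S i j by case: covS => /matrixP/(_ i j); rewrite mxE.
have E (F : 'I_d -> R) k : \sum_l (l == k)%:R * F l = F k.
  rewrite (bigD1 k)//= eqxx mul1r big1 ?addr0// => l /negbTE ->; exact: mul0r.
have E2 (G : 'I_d -> R) : \sum_l (a * (l == i)%:R + b * (l == j)%:R) * G l = a * G i + b * G j.
  under eq_bigr do rewrite mulrDl -!mulrA.
  by rewrite big_split/= -!mulr_sumr !E.
rewrite /qform; under eq_bigr do under eq_bigr do rewrite mulrC.
rewrite (eq_bigr (fun k => (a * (k == i)%:R + b * (k == j)%:R) * (a * S k i + b * S k j))); last first.
  move=> k _; rewrite E2; ring.
by rewrite E2 Sji; ring.
Qed.

Lemma linear2E i j (a b : R) w :
  \sum_k (a * (k == i)%:R + b * (k == j)%:R) * eps k w = a * eps i w + b * eps j w.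
Proof.
have E (F : 'I_d -> R) k : \sum_l (l == k)%:R * F l = F k.
  rewrite (bigD1 k)//= eqxx mul1r big1 ?addr0// => l /negbTE ->; exact: mul0r.
under eq_bigr do rewrite mulrDl -!mulrA.
by rewrite big_split/= -!mulr_sumr !E.
Qed.

Lemma sig_i_sqr i : sig_i S i ^+ 2 = S i i.
Proof. by rewrite sqr_sqrtr// ltW. Qed.

Lemma stdeps_pair i j : gaussian_pair P (stdeps i) (stdeps j) (corr i j).
Proof.
move=> a b.
have [si sj] := (sig_i_gt0 i, sig_i_gt0 j).
have -> : (fun w => cos (a * stdeps i w + b * stdeps j w)) =
  (fun w => cos (\sum_k (a / sig_i S i * (k == i)%:R + b / sig_i S j * (k == j)%:R) * eps k w)).
  by apply/funext => w; rewrite linear2E /stdeps; congr cos; ring.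
rewrite expect_cos_linear qform2; congr expR; rewrite -!sig_i_sqr /corr.
by field; rewrite !gt_eqF.
Qed.

Lemma measurable_stdeps i : measurable_fun [set: T] (stdeps i).
Proof. by apply: measurable_funM => //; case: geps. Qed.

Lemma stdeps_law i : has_law P (stdeps i) N01.
Proof.
have si := sig_i_gt0 i.
have -> : stdeps i = (fun w => \sum_k ((sig_i S i)^-1 * (k == i)%:R + 0 * (k == i)%:R) * eps k w).
  by apply/funext => w; rewrite linear2E /stdeps; ring.
apply: law_linear1; rewrite qform2 -sig_i_sqr.
by field; rewrite gt_eqF.
Qed.

(** The sum and the difference of two standardized coordinates have nonnegative variance. *)
Lemma corr_le1 i j : `|corr i j| <= 1.
Proof.
have [si sj] := (sig_i_gt0 i, sig_i_gt0 j).
have H b : 0 <= 1 + b ^+ 2 + 2 * (b * corr i j).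
  have : 0 <= qform (fun k => (sig_i S i)^-1 * (k == i)%:R + b / sig_i S j * (k == j)%:R).
    by case: covS => _; exact.
  rewrite qform2 -!sig_i_sqr => /le_trans; apply.
  rewrite le_eqVlt; apply/orP; left; apply/eqP; rewrite /corr; field.
  by rewrite !gt_eqF.
by have := H 1; have := H (-1); rewrite ler_norml; lra.
Qed.

End gaussian_vector_laws.

(** * Cauchy-Schwarz and elementary moment inequalities *)

Section cauchy_schwarz.
Context {R : realType} {I : finType}.

(** Lagrange's identity: twice the defect is the double sum of (a_i b_j - a_j b_i)^2. *)
Lemma sum_cauchy_schwarz (A : pred I) (a b : I -> R) :
  (\sum_(i | A i) a i * b i) ^+ 2 <= (\sum_(i | A i) a i ^+ 2) * (\sum_(i | A i) b i ^+ 2).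
Proof.
rewrite -subr_ge0.
have E : 2 * ((\sum_(i | A i) a i ^+ 2) * (\sum_(i | A i) b i ^+ 2) - (\sum_(i | A i) a i * b i) ^+ 2)
   = \sum_(i | A i) \sum_(j | A j) (a i * b j - a j * b i) ^+ 2.
  have -> : \sum_(i | A i) \sum_(j | A j) (a i * b j - a j * b i) ^+ 2 =
     \sum_(i | A i) \sum_(j | A j) (a i ^+ 2 * b j ^+ 2) + \sum_(i | A i) \sum_(j | A j) (b i ^+ 2 * a j ^+ 2)
      - 2 * \sum_(i | A i) \sum_(j | A j) (a i * b i) * (a j * b j).
    rewrite mulr_sumr -sumrN -!big_split/=; apply: eq_bigr => i _.
    rewrite mulr_sumr -sumrN -!big_split/=; apply: eq_bigr => j _; ring.
  by rewrite -!big_distrlr/= expr2; ring.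
rewrite -(pmulr_rge0 _ (_ : 0 < 2))// E.
by apply: sumr_ge0 => i _; apply: sumr_ge0 => j _; exact: sqr_ge0.
Qed.

Lemma sqr_sum_le (a : I -> R) : (\sum_i a i) ^+ 2 <= #|I|%:R * \sum_i a i ^+ 2.
Proof.
have := sum_cauchy_schwarz predT (fun=> 1) a.
rewrite (_ : \sum_i 1 * a i = \sum_i a i); last by apply: eq_bigr => i _; rewrite mul1r.
by rewrite (_ : \sum_(i : I) 1 ^+ 2 = #|I|%:R)// expr1n sumr_const.
Qed.

End cauchy_schwarz.

Section moments.
Context d (T : measurableType d) (R : realType) (P : probability T R).
Implicit Types (X h : T -> R).

Lemma markov_le X (a p : R) : measurable_fun [set: T] X -> (forall w, 0 <= X w) ->
  0 < a -> (\int[P]_w (X w)%:E <= (a * p)%:E)%E ->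
  (P [set w | (a <= X w)%R] <= p%:E)%E.
Proof.
move=> mX X0 a0 H; set A := [set w | _].
have mA : measurable A.
  rewrite /A -[X in measurable X]setTI.
  by apply: measurable_fun_le => //; exact: measurable_cst.
have : (a%:E * P A <= (a * p)%:E)%E.
  apply: le_trans H; rewrite -integral_cst//.
  apply: (@le_trans _ _ (\int[P]_(w in A) (X w)%:E))%E.
    apply: ge0_le_integral => //.
    - by move=> w _; rewrite lee_fin ltW.
    - by apply/measurable_EFinP; exact: measurable_funTS.
  apply: ge0_subset_integral => //.
  - exact/measurable_EFinP.
  - by move=> w _; rewrite lee_fin.
by rewrite EFinM lee_pmul2l.
Qed.

Lemma integrable_of_sqr h (e : R) : measurable_fun [set: T] h ->
  (\int[P]_w (h w ^+ 2)%:E <= e%:E)%E ->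
  P.-integrable [set: T] (EFin \o (fun w => h w ^+ 2)) /\ P.-integrable [set: T] (EFin \o h).
Proof.
move=> mh he.
have i2 : P.-integrable [set: T] (EFin \o (fun w => h w ^+ 2)).
  apply/integrableP; split; first by apply/measurable_EFinP; exact: measurable_funX.
  rewrite (_ : (fun x => _) = (fun x => (h x ^+ 2)%:E)).
    exact: le_lt_trans he (ltry _).
  by apply/funext => x /=; rewrite ger0_norm ?sqr_ge0.
split => //.
have i1 : P.-integrable [set: T] (EFin \o (fun w => 1 + h w ^+ 2)).
  rewrite (_ : EFin \o _ = (fun w => (cst 1 w)%:E + (h w ^+ 2)%:E)%E)//.
  apply: integrableD => //; apply: (bmeas_integrable P (bmeas_cst _ _)).
apply: le_integrable i1 => //; first exact/measurable_EFinP.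
move=> w _ /=; rewrite lee_fin [leRHS]ger0_norm ?addr_ge0 ?sqr_ge0//.
have : h w ^+ 2 = `|h w| ^+ 2 by rewrite real_normK ?num_real.
have := normr_ge0 (h w); set y := `|h w|; nra.
Qed.

(** Integrate 2 m h - m^2 <= h^2, where m is the mean; the left side integrates to m^2. *)
Lemma sqr_mean_le h (e : R) : measurable_fun [set: T] h ->
  (\int[P]_w (h w ^+ 2)%:E <= e%:E)%E -> (\int[P]_w h w) ^+ 2 <= e.
Proof.
move=> mh he; have [i2 i1] := integrable_of_sqr mh he.
set m := \int[P]_w h w.
have H : \int[P]_w (2 * m * h w - m ^+ 2) <= \int[P]_w (h w ^+ 2).
  apply: le_Rintegral => //.
    rewrite (_ : EFin \o _ = (fun w => (2 * m)%:E * (h w)%:E - (cst (m ^+ 2) w)%:E)%E)//.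
    by apply: integrableB => //; [exact: integrableZl|apply: (bmeas_integrable P (bmeas_cst _ _))].
  by move=> w _; have := sqr_ge0 (m - h w); nra.
have E : \int[P]_w (2 * m * h w - m ^+ 2) = m ^+ 2.
  rewrite RintegralB//; last 2 first.
  - rewrite (_ : EFin \o _ = (fun w => (2 * m)%:E * (h w)%:E)%E)//.
    exact: integrableZl.
  - exact: (bmeas_integrable P (bmeas_cst _ _)).
  rewrite RintegralZl// -/m.
  have -> : \int[P]_w m ^+ 2 = m ^+ 2.
    by rewrite /Rintegral integral_cst//; have := @probability_setT _ _ _ P => /= ->; rewrite mule1.
  ring.
rewrite E in H; apply: (le_trans H); rewrite -lee_fin.
by rewrite /Rintegral fineK//; exact: integrable_fin_num.
Qed.

End moments.

(** * Variance bound on the L2 closure *)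

Section variance.
Context d (T : measurableType d) (R : realType) (P : probability T R).
Notation N01 := (normal_prob (0 : R) 1).

(** Write f = g + h with g a cosine polynomial and h small in L2. The part in g has the correlation
    bound; the part in h is bounded by Cauchy-Schwarz without regard to correlations, at a cost that
    vanishes with the approximation error. The 4 is a 2 from squaring the sum times a 2 from the
    second moment of g being at most 2 V + 2 e. *)
Lemma variance_cosL2 n (X : 'I_n -> T -> R) (rho : 'I_n -> 'I_n -> R) (w : 'I_n -> R)
    (f : R -> R) (V : R) :
  (forall i, has_law P (X i) N01) ->
  (forall i, 0 <= w i) -> (forall i j, `|rho i j| <= 1) ->
  (forall i j, gaussian_pair P (X i) (X j) (rho i j)) ->
  cosL2 f -> (\int[N01]_x (f x ^+ 2)%:E <= V%:E)%E ->
  (\int[P]_t ((\sum_i w i * (f (X i t) - \int[N01]_x f x)) ^+ 2)%:E <=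
  (4 * (\sum_i \sum_j w i * w j * rho i j ^+ 2) * V)%:E)%E.
Proof.
move=> lX w0 rho1 gX [mf Hf] fV.
set m := \int[N01]_x f x; set W := \sum_i _.
have W0 : 0 <= W.
  apply: sumr_ge0 => i _; apply: sumr_ge0 => j _.
  by apply: mulr_ge0; [exact: mulr_ge0|exact: sqr_ge0].
have mX i : measurable_fun [set: T] (X i) by case: (lX i).
(* The total coefficient of the approximation error e: 4 W comes from the second moment of g, the
   rest from the part in h. *)
pose C := 4 * W + 8 * (n%:R * \sum_i w i ^+ 2).
have C0 : 0 <= C by rewrite addr_ge0 ?mulr_ge0// sumr_ge0// => i _; exact: sqr_ge0.
apply/lee_addgt0Pr => e' e'0.
have C1 : 0 < C + 1 by rewrite ltr_wpDl.
pose e := e' / (C + 1).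
have e0 : 0 < e by rewrite divr_gt0.
have [s fs] := Hf _ e0.
pose g := cospoly s; pose mg := \sum_(p <- damp s) p.1.
pose h x := f x - g x; pose mh := m - mg.
have mgE : \int[N01]_x g x = mg.
  by rewrite (@expect_cospoly _ _ _ N01 s id id 1)//; exact: gaussian_pair_normal.
have mcg : measurable_fun [set: R] g by exact: measurable_cospoly.
have mch : measurable_fun [set: R] h by exact: measurable_funB.
have mhE : \int[N01]_x h x = mh.
  rewrite RintegralB ?mgE//.
  - by case: (@integrable_of_sqr _ _ _ N01 f V mf fV).
  - exact: (bmeas_integrable N01 (@bmeas_cospoly _ (measurableTypeR R) R s id (@measurable_id _ _ _))).
have mh2 : mh ^+ 2 <= e by rewrite -mhE; exact: (@sqr_mean_le _ _ _ N01 h e mch fs).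
have gK : cosh_kernel (damp s) 1 <= 2 * V + 2 * e.
  rewrite -lee_fin -expect_cospoly_sqr.
  have := @le_expect_sqrD_fin _ f (fun x => - h x) V e mf (measurable_funN mch) fV.
  under [X in (X <= _)%E -> _]eq_integral do rewrite sqrrN.
  move=> /(_ fs).
  by under eq_integral do rewrite /h opprB addrCA subrr addr0.
have vg := variance_cospoly s mX w0 rho1 gX.
pose A t := \sum_i w i * (g (X i t) - mg).
pose B t := \sum_i w i ^+ 2 * (2 * h (X i t) ^+ 2 + 2 * mh ^+ 2).
have mA : measurable_fun [set: T] A.
  apply: measurable_sum => i; apply: measurable_funM => //; apply: measurable_funB => //.
  exact: measurableT_comp.
have mhX i : measurable_fun [set: T] (fun t => h (X i t)) by exact: measurableT_comp.
have mhX2 i : measurable_fun [set: T] (fun t => 2 * h (X i t) ^+ 2 + 2 * mh ^+ 2).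
  by apply: measurable_funD => //; apply: measurable_funM => //; exact: measurable_funX.
have mB : measurable_fun [set: T] B.
  by apply: measurable_sum => i; apply: measurable_funM.
have B0 t : 0 <= B t.
  by apply: sumr_ge0 => i _; rewrite mulr_ge0 ?sqr_ge0// addr_ge0// mulr_ge0 ?sqr_ge0.
have pw t : (\sum_i w i * (f (X i t) - m)) ^+ 2 <= 2 * A t ^+ 2 + 2 * n%:R * B t.
  have -> : \sum_i w i * (f (X i t) - m) = A t + \sum_i w i * (h (X i t) - mh).
    by rewrite /A -big_split/=; apply: eq_bigr => i _; rewrite /h /mh; ring.
  apply: (le_trans (sqr_addr_le _ _)); rewrite lerD2l -mulrA ler_pM2l//.
  apply: (le_trans (sqr_sum_le _)); rewrite card_ord ler_wpM2l//.
  apply: ler_sum => i _; rewrite exprMn ler_wpM2l ?sqr_ge0//.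
  by apply: (le_trans (sqr_addr_le _ _)); rewrite sqrrN.
have EB : (\int[P]_t (B t)%:E <= ((\sum_i w i ^+ 2) * (4 * e))%:E)%E.
  rewrite /B; under eq_integral do rewrite -sumEFin.
  rewrite ge0_integral_sum//; last 2 first.
  - by move=> i; apply/measurable_EFinP; exact: measurable_funM.
  - by move=> i t _; rewrite lee_fin mulr_ge0 ?sqr_ge0// addr_ge0// mulr_ge0 ?sqr_ge0.
  rewrite mulr_suml -sumEFin; apply: lee_sum => i _.
  under eq_integral do rewrite EFinM.
  rewrite ge0_integralZl//; last 3 first.
  - exact/measurable_EFinP.
  - by move=> t _; rewrite lee_fin addr_ge0// mulr_ge0 ?sqr_ge0.
  - by rewrite lee_fin sqr_ge0.
  rewrite [leRHS]EFinM; apply: lee_wpmul2l; first by rewrite lee_fin sqr_ge0.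
  rewrite (@ge0_integral_law _ _ _ P (X i) N01 (fun x => 2 * h x ^+ 2 + 2 * mh ^+ 2) (lX i)); last 2 first.
  - by apply: measurable_funD => //; apply: measurable_funM => //; exact: measurable_funX.
  - by move=> x; rewrite addr_ge0// mulr_ge0 ?sqr_ge0.
  under eq_integral do rewrite EFinD EFinM.
  rewrite ge0_integralD//; last 3 first.
  - by move=> x _; rewrite -EFinM lee_fin mulr_ge0 ?sqr_ge0.
  - by under eq_fun do rewrite -EFinM; apply/measurable_EFinP; apply: measurable_funM => //; exact: measurable_funX.
  - by move=> x _; rewrite lee_fin mulr_ge0 ?sqr_ge0.
  rewrite ge0_integralZl//; last 2 first.
  - by apply/measurable_EFinP; exact: measurable_funX.
  - by move=> x _; rewrite lee_fin sqr_ge0.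
  rewrite integral_cst//.
  have := @probability_setT _ _ _ N01 => /= ->; rewrite mule1.
  rewrite (_ : 4 * e = 2 * e + 2 * e); last by ring.
  rewrite [leRHS]EFinD; apply: leeD; last by rewrite lee_fin ler_pM2l.
  by rewrite [leRHS]EFinM; apply: lee_wpmul2l.
apply: (@le_trans _ _ (\int[P]_t ((2 * A t ^+ 2)%:E + (2 * n%:R * B t)%:E)))%E.
  apply: ge0_le_integral => //.
  - by move=> t _; rewrite lee_fin sqr_ge0.
  - apply/measurable_EFinP; apply: measurable_funX; apply: measurable_sum => i.
    by apply: measurable_funM => //; apply: measurable_funB => //; exact: measurableT_comp.
  - under eq_fun do rewrite -EFinD; apply/measurable_EFinP; apply: measurable_funD.
      by apply: measurable_funM => //; exact: measurable_funX.
    exact: measurable_funM.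
  - by move=> t _; rewrite -EFinD lee_fin.
rewrite ge0_integralD//; last 4 first.
- by move=> t _; rewrite lee_fin mulr_ge0 ?sqr_ge0.
- by apply/measurable_EFinP; apply: measurable_funM => //; exact: measurable_funX.
- by move=> t _; rewrite lee_fin mulr_ge0.
- by apply/measurable_EFinP; exact: measurable_funM.
under eq_integral do rewrite EFinM.
under [X in (_ + X <= _)%E]eq_integral do rewrite EFinM.
rewrite !ge0_integralZl//; last 4 first.
- exact/measurable_EFinP.
- by move=> t _; rewrite lee_fin.
- by apply/measurable_EFinP; exact: measurable_funX.
- by move=> t _; rewrite lee_fin sqr_ge0.
apply: (@le_trans _ _ (2%:E * (W * (2 * V + 2 * e))%:E + (2 * n%:R)%:E * ((\sum_i w i ^+ 2) * (4 * e))%:E))%E.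
  apply: leeD; apply: lee_wpmul2l => //.
  by apply: (le_trans vg); rewrite lee_fin ler_wpM2l.
rewrite -!EFinM -!EFinD lee_fin.
have : C * e <= e'.
  by rewrite /e mulrA ler_pdivrMr// mulrC ler_pM2l// lerDl.
rewrite /C; lra.
Qed.

End variance.

(** * The chi-square distribution function *)

Section chi2.
Context {R : realType}.
Notation N01 := (normal_prob (0 : R) 1).
Implicit Types (t h p b : R).

Let A t : set R := [set x : R | x ^+ 2 <= t].

Lemma measurable_sqr_le t : measurable (A t).
Proof.
rewrite /A -[X in measurable X]setTI.
by apply: measurable_fun_le => //; exact: measurable_funX.
Qed.

Lemma Fchi2E t : (Fchi2 t)%:E = N01 (A t).
Proof.
rewrite /Fchi2 fineK// ge0_fin_numE//.
exact: le_lt_trans (probability_le1 N01 (measurable_sqr_le t)) (ltry 1).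
Qed.

Lemma Fchi2_mono t t' : t <= t' -> Fchi2 t <= Fchi2 t'.
Proof.
move=> tt; rewrite -lee_fin !Fchi2E; apply: le_measure; rewrite ?inE.
- exact: measurable_sqr_le.
- exact: measurable_sqr_le.
- by move=> x /= /le_trans; exact.
Qed.

Lemma Fchi2_le t : 0 <= t -> Fchi2 t <= 2 * Num.sqrt t.
Proof.
move=> t0; rewrite -lee_fin Fchi2E.
apply: (@le_trans _ _ (N01 `[- Num.sqrt t, Num.sqrt t])).
  apply: le_measure; rewrite ?inE//; first exact: measurable_sqr_le.
  by move=> x /= xt; rewrite in_itv/= -ler_norml -sqrtr_sqr ler_sqrt.
apply: (le_trans (normal_prob_itv_le _)); first by rewrite (@le_trans _ _ 0)// oppr_le0.
by rewrite lee_fin; lra.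
Qed.

Lemma Fchi2_lt0 t : t < 0 -> Fchi2 t = 0.
Proof.
move=> t0; apply/EFin_inj; rewrite Fchi2E (_ : A t = set0) ?measure0//.
apply/seteqP; split => // x /= xt.
by have := le_lt_trans xt t0; rewrite ltNge sqr_ge0.
Qed.

Lemma Fchi2_ge_arg p t : 0 < p -> p <= Fchi2 t -> p ^+ 2 / 4 <= t.
Proof.
move=> p0 pF; have [t0|t0] := leP 0 t; last first.
  by rewrite Fchi2_lt0// in pF; lra.
have := Fchi2_le t0; have := sqr_sqrtr t0; have := sqrtr_ge0 t; move: (Num.sqrt t) => r; nra.
Qed.

Lemma expect_sqr_le : (\int[N01]_x (x ^+ 2)%:E <= 16%:E)%E.
Proof.
have := @expect_sqr_tail R 0 (lexx 0).
rewrite expr0n/= mul0r oppr0 expR0 mulr1.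
by under eq_integral do rewrite normr_ge0.
Qed.

(** Markov's inequality with a crude second moment; it serves to show that the sets defining
    quantiles below level 1 are nonempty. *)
Lemma Fchi2_ge t : 0 < t -> 1 - 16 / t <= Fchi2 t.
Proof.
move=> t0.
have H : (N01 [set x : R | (t <= x ^+ 2)%R] <= (16 / t)%:E)%E.
  apply: (@markov_le _ _ _ N01 (fun x : R => x ^+ 2)) => //.
  - by move=> x; exact: sqr_ge0.
  - by rewrite mulrCA divff ?gt_eqF// mulr1; exact: expect_sqr_le.
have mB : measurable [set x : R | (t <= x ^+ 2)%R].
  rewrite -[X in measurable X]setTI.
  by apply: measurable_fun_le => //; exact: measurable_funX.
have : (1 <= (Fchi2 t)%:E + (16 / t)%:E)%E.
  rewrite Fchi2E; have <- : N01 setT = 1%E by exact: probability_setT.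
  apply: (@le_trans _ _ (N01 (A t `|` [set x : R | (t <= x ^+ 2)%R]))).
    apply: le_measure; rewrite ?inE//.
      by apply: measurableU => //; exact: measurable_sqr_le.
    by move=> x _ /=; have [|/ltW] := leP (x ^+ 2) t; [left|right].
  apply: (le_trans (measureU2 _ _ _)) => //; first exact: measurable_sqr_le.
  by apply: leeD.
by rewrite -EFinD lee_fin; lra.
Qed.

(** The added set is two intervals of length sqrt (t + h) - sqrt t <= h/(2 sqrt t), on which the
    density is below 1. *)
Lemma Fchi2_upper t h : 0 < t -> 0 <= h -> Fchi2 (t + h) <= Fchi2 t + h / Num.sqrt t.
Proof.
move=> t0 h0; set a := Num.sqrt t; set c := Num.sqrt (t + h).
have a0 : 0 < a by rewrite sqrtr_gt0.
have ac : a <= c by rewrite ler_sqrt ?lerDl// addr_ge0// ltW.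
have a2 : a ^+ 2 = t by rewrite sqr_sqrtr// ltW.
have c2 : c ^+ 2 = t + h by rewrite sqr_sqrtr// addr_ge0// ltW.
have c0 := le_trans (ltW a0) ac.
have Hx (x : R) : x ^+ 2 <= t + h -> t < x ^+ 2 -> 0 <= x -> a <= x <= c.
  by move=> ? ? ?; apply/andP; split; nra.
have Hx' (x : R) : x ^+ 2 <= t + h -> t < x ^+ 2 -> x < 0 -> - c <= x <= - a.
  by move=> ? ? ?; apply/andP; split; nra.
have H : (N01 (A (t + h)) <= N01 (A t) + ((c - a)%:E + (c - a)%:E))%E.
  apply: (@le_trans _ _ (N01 (A t `|` (`[a, c] `|` `[- c, - a])))).
    apply: le_measure; rewrite ?inE//; first exact: measurable_sqr_le.
      by apply: measurableU; [exact: measurable_sqr_le|exact: measurableU].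
    move=> x /= xth; have [xt|xt] := leP (x ^+ 2) t; first by left.
    right; have [x0|x0] := leP 0 x; [left|right]; rewrite /= in_itv/=.
      exact: (Hx x).
    exact: (Hx' x).
  apply: (le_trans (measureU2 _ _ _)) => //; first exact: measurable_sqr_le.
    exact: measurableU.
  apply: leeD => //; apply: (le_trans (measureU2 _ _ _)) => //.
  apply: leeD; first exact: normal_prob_itv_le.
  by apply: (le_trans (normal_prob_itv_le _)); rewrite ?lerN2// lee_fin; lra.
rewrite -!Fchi2E -!EFinD lee_fin in H; apply: (le_trans H); rewrite lerD2l.
rewrite ler_pdivlMr//; nra.
Qed.

(** A slope bounded below on [0, b], which turns an error on the level into an error on the
    quantile. Only the positive side is kept, where the density is at least its value at sqrt b. *)
Lemma Fchi2_lower b : 0 < b -> exists2 m : R, 0 < m &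
  forall t h, 0 <= t -> 0 <= h -> t + h <= b -> Fchi2 t + m * h <= Fchi2 (t + h).
Proof.
move=> b0; set B := Num.sqrt b.
have B0 : 0 < B by rewrite sqrtr_gt0.
have B2 : B ^+ 2 = b by rewrite sqr_sqrtr// ltW.
have p0 : 0 < normal_pdf 0 1 B.
  by rewrite normal_pdf01E mulr_gt0 ?expR_gt0// normal_peak_gt0 ?oner_neq0.
exists (normal_pdf 0 1 B / (4 * B)); first by rewrite divr_gt0// mulr_gt0.
move=> t h t0 h0 thb.
have [->|hn0] := eqVneq h 0; first by rewrite mulr0 !addr0.
have hp : 0 < h by rewrite lt_def hn0.
set a := Num.sqrt t; set c := Num.sqrt (t + h).
have a0 : 0 <= a by exact: sqrtr_ge0.
have ac : a < c by rewrite ltr_sqrt ?ltrDl// ltr_wpDl.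
have a2 : a ^+ 2 = t by rewrite sqr_sqrtr.
have c2 : c ^+ 2 = t + h by rewrite sqr_sqrtr// addr_ge0// ltW.
have cB : c <= B by rewrite ler_sqrt// ltW.
(* Starting at the midpoint instead of a keeps the closed interval disjoint from x^2 <= t; it only
   halves the length. *)
set l := (a + c) / 2.
have H1 (x : R) : x ^+ 2 <= t -> l <= x -> False by rewrite /l => ? ?; nra.
have H2 (x : R) : l <= x -> x <= c -> x ^+ 2 <= t + h by rewrite /l => ? ?; nra.
have H : (N01 (A t) + ((c - l) * normal_pdf 0 1 B)%:E <= N01 (A (t + h)))%E.
  have lc : l <= c by rewrite /l; lra.
  apply: (@le_trans _ _ (N01 (A t) + N01 `[l, c])%E).
    apply: leeD => //; apply: normal_prob_itv_ge => // x /andP[lx xc].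
    by rewrite ger0_norm; [exact: le_trans cB|rewrite (le_trans _ lx)// /l; lra].
  rewrite -measureU//; last 2 first.
  - exact: measurable_sqr_le.
  - apply/seteqP; split => // x /= [xt]; rewrite in_itv/= => /andP[lx xc].
    exact: (H1 x).
  apply: le_measure; rewrite ?inE//.
  - by apply: measurableU => //; exact: measurable_sqr_le.
  - exact: measurable_sqr_le.
  - move=> x /= [xt|]; first by rewrite /A/= (le_trans xt)// lerDl.
    by rewrite in_itv/= => /andP[lx xc]; exact: (H2 x).
rewrite -!Fchi2E -!EFinD lee_fin in H; apply: le_trans H; rewrite lerD2l.
rewrite mulrAC ler_pdivrMr ?mulr_gt0// mulrAC [leRHS]mulrC ler_pM2l//.
rewrite /l; nra.
Qed.

Lemma Finv_nonempty p : p < 1 -> [set t : R | p <= Fchi2 t] !=set0.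
Proof.
move=> p1; exists (16 / (1 - p)) => /=.
have p10 : 0 < 1 - p by lra.
have := @Fchi2_ge (16 / (1 - p)); rewrite divr_gt0// => /(_ isT).
by rewrite invf_div mulrCA divff// mulr1; lra.
Qed.

Lemma Finv_has_lbound p : 0 < p -> has_lbound [set t : R | p <= Fchi2 t].
Proof. by move=> p0; exists (p ^+ 2 / 4) => t /=; exact: Fchi2_ge_arg. Qed.

Lemma Finv_ge p : 0 < p < 1 -> p ^+ 2 / 4 <= Fchi2_inv p.
Proof.
move=> /andP[p0 p1]; apply: lb_le_inf; first exact: Finv_nonempty.
by move=> t /=; exact: Fchi2_ge_arg.
Qed.

(** At level 1, reached when all coordinates are counted, the quantile set can be empty, and the
    infimum of the empty set is 0 by default. The variance estimate is then t/0 = 0. *)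
Lemma Finv_ge1 p : 1 <= p -> Fchi2_inv p = 0 \/ p ^+ 2 / 4 <= Fchi2_inv p.
Proof.
move=> p1; rewrite /Fchi2_inv; have [->|/set0P ne] := eqVneq [set t : R | p <= Fchi2 t] set0.
  by left; rewrite inf0.
right; apply: lb_le_inf => // t /=; apply: Fchi2_ge_arg; lra.
Qed.

Lemma qchi_gt0 p : 0 < p < 1 -> 0 < qchi p.
Proof.
move=> p01; apply: lt_le_trans (Finv_ge p01).
by case/andP: p01 => p0 _; rewrite divr_gt0// exprn_gt0.
Qed.

(** Continuity of the distribution function: points just below the quantile have level less than p,
    and points of the defining set come arbitrarily close from above. *)
Lemma Fchi2_qchi p : 0 < p < 1 -> Fchi2 (qchi p) = p.
Proof.
move=> p01; have q0 := qchi_gt0 p01; case/andP: p01 => p0 p1.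
set q := qchi p in q0 *.
have hi : has_inf [set t : R | p <= Fchi2 t] by split; [exact: Finv_nonempty|exact: Finv_has_lbound].
apply/eqP; rewrite eq_le; apply/andP; split.
  apply/ler_addgt0Pr => e e0.
  set r := Num.sqrt (q / 2).
  have r0 : 0 < r by rewrite sqrtr_gt0 divr_gt0.
  pose h := Num.min (q / 2) (e * r).
  have h0 : 0 < h by rewrite lt_min divr_gt0// mulr_gt0.
  have hq : h <= q / 2 by rewrite ge_min lexx.
  have her : h <= e * r by rewrite ge_min lexx orbT.
  have qh : q / 2 <= q - h by lra.
  have qh0 : 0 < q - h by lra.
  have := Fchi2_upper qh0 (ltW h0); rewrite subrK => /le_trans; apply.
  apply: lerD.
    rewrite leNgt; apply/negP => pF.
    have : q <= q - h by apply: inf_lbound; [exact: Finv_has_lbound|exact: ltW].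
    lra.
  have sr : r <= Num.sqrt (q - h) by rewrite ler_sqrt// ltW.
  rewrite ler_pdivrMr; last exact: lt_le_trans sr.
  by apply: (le_trans her); rewrite ler_pM2l.
apply/ler_addgt0Pr => e e0.
have sq : 0 < Num.sqrt q by rewrite sqrtr_gt0.
have [t /= pt tq] := inf_adherent (mulr_gt0 e0 sq) hi; rewrite -/(qchi p) -/q in tq.
have qt : q <= t by apply: inf_lbound => //; exact: Finv_has_lbound.
have tq0 : 0 <= t - q by lra.
have := Fchi2_upper q0 tq0; rewrite subrKC => H.
apply: (le_trans pt); apply: (le_trans H); rewrite lerD2l ler_pdivrMr//.
by rewrite lerBlDl ltW.
Qed.

(** A shift by 2k/m changes the level by at least 2k, more than the error k. The factor 2 makes the
    contradiction on the lower side strict. *)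
Lemma Finv_close (b m x p k : R) : 0 < m ->
  (forall t h, 0 <= t -> 0 <= h -> t + h <= b -> Fchi2 t + m * h <= Fchi2 (t + h)) ->
  0 < p -> 0 < k -> `|p - Fchi2 x| <= k -> 0 <= x - 2 * k / m -> x + 2 * k / m <= b ->
  `|Fchi2_inv p - x| <= 2 * k / m.
Proof.
move=> m0 lip p0 k0; rewrite ler_distl => /andP[kF Fk] lo hi.
have km : 0 < 2 * k / m by rewrite divr_gt0// mulr_gt0.
have mk : m * (2 * k / m) = 2 * k by rewrite mulrCA divff ?mulr1// gt_eqF.
have xin : [set t : R | p <= Fchi2 t] (x + 2 * k / m).
  have := lip x (2 * k / m); rewrite mk /= => H; apply: (le_trans Fk).
  by apply: le_trans (H _ _ _); lra.
rewrite ler_distl; apply/andP; split; last first.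
  by apply: inf_lbound => //; exact: Finv_has_lbound.
apply: lb_le_inf; first by exists (x + 2 * k / m).
move=> t /= pt; rewrite leNgt; apply/negP => tx.
have := Fchi2_mono (ltW tx).
have := lip (x - 2 * k / m) (2 * k / m); rewrite mk subrK => H.
have := H lo (ltW km); lra.
Qed.

End chi2.

(** * Measurability of the estimator *)

Section Fhat.
Context {R : realType} (d : nat) (S : 'M[R]_d).
Implicit Types (Y : 'I_d -> R) (t : R).

Lemma FhatE Y t : Fhat S Y t = (\sum_i (if (Y i / sig_i S i) ^+ 2 <= t then 1 else 0)) / d%:R.
Proof.
rewrite /Fhat -sum1_card natr_sum big_mkcond/=; congr (_ / _).
apply: eq_bigr => i _; congr (if _ then _ else _).
by apply/idP/idP => [/asboolP|H]; [|apply/asboolP].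
Qed.

Lemma Fhat_mono Y t t' : t <= t' -> Fhat S Y t <= Fhat S Y t'.
Proof.
move=> tt; rewrite !FhatE ler_wpM2r ?invr_ge0//; apply: ler_sum => i _.
by case: ifP => [/le_trans/(_ tt) ->//|_]; case: ifP.
Qed.

Lemma Fhat_lt0 Y t : t < 0 -> Fhat S Y t = 0.
Proof.
move=> t0; rewrite FhatE big1 ?mul0r// => i _.
by rewrite ifN// -ltNge (lt_le_trans t0)// sqr_ge0.
Qed.

Lemma Fhat_half_ge0 Y t : 1 / 2 <= Fhat S Y t -> 0 <= t.
Proof. by move=> H; rewrite leNgt; apply/negP => t0; rewrite Fhat_lt0// in H; lra. Qed.

Lemma exp2z_gt0 (l : int) : 0 < 2 ^ l :> R.
Proof. by rewrite exprz_gt0. Qed.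

Lemma Fhat_large Y : (0 < d)%N -> exists n : nat, Fhat S Y (2 ^ n%:Z) = 1.
Proof.
move=> d0; pose b := \sum_i (Y i / sig_i S i) ^+ 2.
exists (Num.trunc b).+1.
have bn : b <= 2 ^ ((Num.trunc b).+1%:Z).
  rewrite -exprnP; apply: (@le_trans _ _ (Num.trunc b).+1%:R).
    by rewrite ltW// truncnS_gt.
  by rewrite -natrX ler_nat ltnW// ltn_expl.
rewrite FhatE (eq_bigr (fun=> 1)); last first.
  move=> i _; rewrite ifT// (le_trans _ bn)// /b (bigD1 i)//= lerDl.
  by apply: sumr_ge0 => j _; exact: sqr_ge0.
by rewrite sumr_const card_ord divff// pnatr_eq0 -lt0n.
Qed.

Lemma that_nonempty Y : (0 < d)%N ->
  [set t : R | exists l : int, t = 2 ^ l /\ 1 / 2 <= Fhat S Y t] !=set0.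
Proof.
move=> d0; have [n Fn] := Fhat_large Y d0.
by exists (2 ^ n%:Z); exists n%:Z; split => //; rewrite Fn; lra.
Qed.

Lemma that_lbound Y : lbound [set t : R | exists l : int, t = 2 ^ l /\ 1 / 2 <= Fhat S Y t] 0.
Proof. by move=> t /= [l [-> _]]; exact/ltW/exp2z_gt0. Qed.

Lemma Mhat_nonempty Y : (0 < d)%N -> [set t : R | 1 / 2 <= Fhat S Y t] !=set0.
Proof. by move=> /(that_nonempty Y)[t [l [_ H]]]; exists t. Qed.

Lemma Mhat_lbound Y : lbound [set t : R | 1 / 2 <= Fhat S Y t] 0.
Proof. by move=> t /=; exact: Fhat_half_ge0. Qed.

End Fhat.

Section measurability.
Context {R : realType} (d : nat) (S : 'M[R]_d) (dT : measure_display) (T : measurableType dT).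
Variable (Y : 'I_d -> T -> R).
Hypothesis mY : forall i, measurable_fun [set: T] (Y i).
Hypothesis d0 : (0 < d)%N.
Let y w i := Y i w.

Lemma measurable_fun_lt_sets (f : T -> R) :
  (forall a, measurable [set w | f w < a]) -> measurable_fun [set: T] f.
Proof.
move=> H mD; apply: (measurability _ (RGenInftyO.measurableE R)) => //.
move=> _ [_ [a ->] <-]; rewrite setTI.
by rewrite (_ : f @^-1` _ = [set w | f w < a]).
Qed.

Lemma measurable_ystd i : measurable_fun [set: T] (fun w => (Y i w / sig_i S i) ^+ 2).
Proof. by apply: measurable_funX; apply: measurable_funM. Qed.

Lemma measurable_Fhat (t : T -> R) : measurable_fun [set: T] t ->
  measurable_fun [set: T] (fun w => Fhat S (y w) (t w)).
Proof.
move=> mt; under eq_fun do rewrite FhatE.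
apply: measurable_funM => //; apply: measurable_sum => i.
apply: measurable_fun_ifT => //; apply: measurable_fun_ler => //.
exact: measurable_ystd.
Qed.

Lemma measurable_Fhat_half (t : R) : measurable [set w | 1 / 2 <= Fhat S (y w) t].
Proof.
rewrite -[X in measurable X]setTI.
apply: measurable_fun_le => //; exact: (measurable_Fhat (measurable_cst t)).
Qed.

Lemma measurable_that : measurable_fun [set: T] (fun w => that S (y w)).
Proof.
apply: measurable_fun_lt_sets => a.
have -> : [set w | that S (y w) < a] =
    (\bigcup_n [set w | 2 ^ n%:Z < a /\ 1 / 2 <= Fhat S (y w) (2 ^ n%:Z)]) `|`
    (\bigcup_n [set w | 2 ^ Negz n < a /\ 1 / 2 <= Fhat S (y w) (2 ^ Negz n)]).
  apply/seteqP; split => w /=.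
    move=> /(inf_lt (that_nonempty S (y w) d0))[t /= [[n|n] [-> H]] ta]; [left|right]; by exists n.
  move=> H; have [l [la Hl]] : exists l : int, 2 ^ l < a /\ 1 / 2 <= Fhat S (y w) (2 ^ l).
    by case: H => -[n _ /= [? ?]]; eexists; split; eassumption.
  apply: le_lt_trans la; apply: inf_lbound; first by exists 0; exact: that_lbound.
  by exists l.
have M (l : int) : measurable [set w | 2 ^ l < a /\ 1 / 2 <= Fhat S (y w) (2 ^ l)].
  case: (boolP (2 ^ l < a)) => [la|/negP la].
    rewrite (_ : [set w | _] = [set w | 1 / 2 <= Fhat S (y w) (2 ^ l)]); last first.
      by apply/seteqP; split => w /= [].
    exact: measurable_Fhat_half.
  rewrite (_ : [set w | _] = set0)//; by apply/seteqP; split => w //= [].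
by apply: measurableU; apply: bigcupT_measurable => n; exact: M.
Qed.

(** By monotonicity of [Fhat] in the threshold, rational thresholds decide whether the infimum is
    below a, so a countable union suffices. *)
Lemma measurable_Mhat : measurable_fun [set: T] (fun w => Mhat S (y w)).
Proof.
apply: measurable_fun_lt_sets => a.
have -> : [set w | Mhat S (y w) < a] =
    (\bigcup_(q : rat) [set w | ratr q < a /\ 1 / 2 <= Fhat S (y w) (ratr q)]).
  apply/seteqP; split => w /=.
    move=> /(inf_lt (Mhat_nonempty S (y w) d0))[t /= H ta].
    have [q] := rat_in_itvoo ta; rewrite in_itv/= => /andP[tq qa]; exists q => //=.
    by split => //; apply: (le_trans H); apply: Fhat_mono; exact: ltW.
  move=> [q _ /= [qa H]]; apply: le_lt_trans qa.
  by apply: inf_lbound => //; exists 0; exact: Mhat_lbound.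
apply: bigcupT_measurable_rat => q.
case: (boolP (ratr q < a)) => [la|/negP la].
  rewrite (_ : [set w | _] = [set w | 1 / 2 <= Fhat S (y w) (ratr q)]); last first.
    by apply/seteqP; split => w /= [].
  exact: measurable_Fhat_half.
rewrite (_ : [set w | _] = set0)//; by apply/seteqP; split => w //= [].
Qed.

(** [Fhat] takes only the values k/d, so any g is admissible; this covers the quantile function,
    whose measurability is not established. *)
Lemma measurable_comp_Fhat (g : R -> R) (t : T -> R) : measurable_fun [set: T] t ->
  measurable_fun [set: T] (fun w => g (Fhat S (y w) (t w))).
Proof.
move=> mt.
have E w : g (Fhat S (y w) (t w)) =
    \sum_(k < d.+1) (if Fhat S (y w) (t w) == k%:R / d%:R then g (k%:R / d%:R) else 0).
  pose A : {pred 'I_d} := mem [set i : 'I_d | (y w i / sig_i S i) ^+ 2 <= t w]%classic.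
  have Ad : (#|A| < d.+1)%N by rewrite ltnS -[X in (_ <= X)%N]card_ord max_card.
  have FA : Fhat S (y w) (t w) = #|A|%:R / d%:R by [].
  rewrite (bigD1 (Ordinal Ad))//= FA eqxx big1 ?addr0// => k kA.
  rewrite ifN//; apply: contra kA; rewrite (inj_eq (mulIf _)) ?invr_eq0 ?pnatr_eq0 -?lt0n//.
  by rewrite eqr_nat => /eqP e; apply/eqP/val_inj.
under eq_fun do rewrite E.
apply: measurable_sum => k; apply: measurable_fun_ifT => //.
by apply: measurable_fun_eqr => //; exact: measurable_Fhat.
Qed.

Lemma measurable_sigmaS2 : measurable_fun [set: T] (fun w => sigmaS2 S (y w)).
Proof.
apply: measurable_funM; first exact: measurable_that.
exact: (@measurable_comp_Fhat (fun x => (Fchi2_inv x)^-1) _ measurable_that).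
Qed.

Lemma measurable_Nstar (eta : R) (s : nat) :
  measurable_fun [set: T] (fun w => Nstar eta S s (y w)).
Proof.
have msq : measurable_fun [set: R] (@Num.sqrt R).
  by apply: continuous_measurable_fun; exact: sqrt_continuous.
apply: (measurableT_comp msq); apply: measurableT_comp => //.
apply: measurable_funB; last first.
  by apply: measurable_funM => //; apply: measurable_funM => //; exact: measurable_sigmaS2.
apply: measurable_sum => i; apply: measurable_funM; first by apply: measurable_funX; exact: mY.
apply: measurable_fun_ifT => //; apply: measurable_fun_ltr; last by apply: measurableT_comp => //; exact: mY.
apply: measurable_funM => //; apply: measurable_funM => //.
apply: measurable_maxr; apply: (measurableT_comp msq); first exact: measurable_sigmaS2.
by apply: measurable_funM => //; exact: measurable_Mhat.
Qed.

End measurability.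

(** * Deterministic bounds *)

Section elementary.
Context {R : realType}.

Lemma dyadic_between (x : R) : 0 < x -> exists l : int, x <= 2 ^ l < 2 * x.
Proof.
move=> x0.
have l2 : 0 < ln (2 : R) by rewrite ln_gt0// ltr1n.
have E (l : int) : 2 ^ l = expR (l%:~R * ln 2) :> R.
  by rewrite -powR_intmul// /powR pnatr_eq0.
exists (Num.ceil (ln x / ln 2)); rewrite E; apply/andP; split.
  rewrite -{1}[x]lnK ?posrE// ler_expR -ler_pdivrMr//.
  exact: ceil_ge.
rewrite -[ltRHS]lnK ?posrE ?mulr_gt0// ltr_expR lnM ?posrE//.
rewrite -ltr_pdivlMr// mulrDl divff ?gt_eqF// addrC.
by have := gt_pred_ceil (ln x / ln 2); rewrite intrD; lra.
Qed.

Lemma dyadic_succ (k l : int) : 2 ^ k < 2 ^ l :> R -> 2 * 2 ^ k <= 2 ^ l :> R.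
Proof.
move=> kl.
have kl' : (k < l)%R by move: kl; rewrite ltr_eXz2l// ltr1n.
have -> : 2 * 2 ^ k = 2 ^ (1 + k) :> R by rewrite expfzDr// expr1z.
by rewrite ler_eXz2l ?ltr1n// lez1D.
Qed.

(** Transfers an error on the squared norm to the norm. The cross term proportional to b is harmless
    because, with a the square root of |q|, |a^2 - b^2| = |a - b| (a + b); the cases b <= sqrt E and
    b > sqrt E both give |a - b| <= 3 sqrt E. *)
Lemma dist_sqrt_le (q b E : R) : 0 <= b -> 0 <= E ->
  `|q - b ^+ 2| <= E + 2 * b * Num.sqrt E ->
  (Num.sqrt `|q| - b) ^+ 2 <= 9 * E.
Proof.
move=> b0 E0 H; set a := Num.sqrt `|q|; set r := Num.sqrt E in H *.
have r0 : 0 <= r by exact: sqrtr_ge0.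
have a0 : 0 <= a by exact: sqrtr_ge0.
have r2 : r ^+ 2 = E by rewrite sqr_sqrtr.
have a2 : a ^+ 2 = `|q| by rewrite sqr_sqrtr.
have {}H : `|a ^+ 2 - b ^+ 2| <= r ^+ 2 + 2 * b * r.
  rewrite r2; apply: le_trans H; rewrite a2.
  have := ler_dist_dist q (b ^+ 2); rewrite [`|b ^+ 2|]ger0_norm ?sqr_ge0//.
rewrite -r2.
have : `|a ^+ 2 - b ^+ 2| = `|a - b| * (a + b).
  by rewrite subr_sqr normrM [`|a + b|]ger0_norm// addr_ge0.
move=> E1; rewrite {}E1 in H.
have := real_normK (num_real (a - b)) => <-.
have n0 := normr_ge0 (a - b); have nab : `|a - b| <= a + b.
  by rewrite (le_trans (ler_normB _ _))// !ger0_norm.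
have : `|a - b| <= 3 * r.
  rewrite leNgt; apply/negP => lt.
  move: (`|a - b|) n0 nab H lt => n n0 nab H lt.
  have [br|br] := leP b r; nra.
move: (`|a - b|) n0 => n n0 nr; nra.
Qed.

Lemma ln2_ge_half : 2^-1 <= ln 2 :> R.
Proof.
have H : expR 2^-1 <= 2 :> R.
  have := @expR_ge1Dx R (- 2^-1); rewrite expRN => h.
  have e0 := expR_gt0 (2^-1 : R).
  have := mulfV (lt0r_neq0 e0); move: (expR _) h e0 => E h e0 h1; nra.
by rewrite -ler_expR lnK// posrE.
Qed.

End elementary.

Section deterministic.
Context {R : realType} (d s : nat) (S : 'M[R]_d) (theta e : 'I_d -> R) (sigma : R).
Hypothesis d0 : (0 < d)%N.
Hypothesis s0 : (0 < s)%N.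
Hypothesis sg0 : 0 < sigma.
Hypothesis Sgt0 : forall i, 0 < S i i.
Hypothesis S1 : forall i, S i i <= 1.
Hypothesis sp : sparse s theta.

Let Y i := theta i + sigma * e i.
Let z i := e i / sig_i S i.

(** Not divided by d, so that the sparse mean perturbs it by at most s. *)
Definition cnt (u : 'I_d -> R) (x : R) : R := \sum_i (if u i ^+ 2 <= x then 1 else 0).

Lemma sum_supp_le (F : 'I_d -> R) (M : R) : 0 <= M ->
  (forall i, theta i != 0 -> F i <= M) -> \sum_(i | theta i != 0) F i <= s%:R * M.
Proof.
move=> M0 FM; apply: (@le_trans _ _ (\sum_(i | theta i != 0) M)); first exact: ler_sum.
rewrite sumr_const -[leLHS]mulr_natl ler_wpM2r// ler_nat.
move: sp; rewrite /sparse; apply: leq_trans; rewrite subset_leq_card//.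
by apply/fintype.subsetP => i; rewrite unfold_in/= => H; apply/asboolP.
Qed.

Lemma YE i : theta i = 0 -> (Y i / sig_i S i) ^+ 2 = sigma ^+ 2 * z i ^+ 2.
Proof. by move=> t0; rewrite /Y t0 add0r -mulrA exprMn. Qed.

(** Only coordinates in the support of theta can be classified differently, each changing the count
    by at most 1. *)
Lemma Fhat_cnt (t : R) : `|d%:R * Fhat S Y t - cnt z (t / sigma ^+ 2)| <= s%:R.
Proof.
have sg2 : 0 < sigma ^+ 2 by rewrite exprn_gt0.
rewrite FhatE mulrCA divff ?mulr1; last by rewrite pnatr_eq0 -lt0n.
rewrite /cnt -sumrB (bigID (fun i => theta i != 0))/= [X in _ + X]big1 ?addr0; last first.
  move=> i /negbNE/eqP t0; rewrite YE// ler_pdivlMr// mulrC subrr//.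
rewrite (le_trans (ler_norm_sum _ _ _))// -[leRHS]mulr1; apply: sum_supp_le => // i _.
by do 2!case: ifP => _; rewrite ?subrr ?subr0 ?sub0r ?normrN ?normr0 ?normr1.
Qed.

Hypothesis sd : @GRing.natmul R 1 s <= d%:R / 4.
Variables (qlo qhi : R).
Hypothesis qlo0 : 0 < qlo.
Hypothesis E1 : cnt z qlo < d%:R / 4.
Hypothesis E2 : 3 / 4 * d%:R <= cnt z qhi.

Let dR : 0 < @GRing.natmul R 1 d. Proof. by rewrite ltr0n. Qed.
Let sg2 : 0 < sigma ^+ 2. Proof. by rewrite exprn_gt0. Qed.

Lemma cnt_mono (u : 'I_d -> R) x y : x <= y -> cnt u x <= cnt u y.
Proof.
move=> xy; apply: ler_sum => i _.
by case: ifP => [/le_trans/(_ xy) ->//|_]; case: ifP.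
Qed.

(** Below sigma^2 qlo fewer than d/4 noise coordinates are counted, and the support adds at most s
    <= d/4, which leaves the count strictly below d/2. *)
Lemma Fhat_half_ge t : 1 / 2 <= Fhat S Y t -> sigma ^+ 2 * qlo <= t.
Proof.
move=> H; rewrite leNgt; apply/negP => tq.
have : cnt z (t / sigma ^+ 2) <= cnt z qlo.
  by apply: cnt_mono; rewrite ler_pdivrMr// mulrC ltW.
have := Fhat_cnt t; rewrite ler_norml => /andP[_].
have : d%:R * (1 / 2) <= d%:R * Fhat S Y t by rewrite ler_pM2l.
move: E1 sd; move: (Fhat S Y t) (cnt z (t / sigma ^+ 2)) (cnt z qlo) => f c1 c2.
move: (d%:R : R) (s%:R : R) => D s'; nra.
Qed.

Lemma Fhat_qhi : 1 / 2 <= Fhat S Y (sigma ^+ 2 * qhi).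
Proof.
have := Fhat_cnt (sigma ^+ 2 * qhi); rewrite ler_norml => /andP[+ _].
have -> : sigma ^+ 2 * qhi / sigma ^+ 2 = qhi by field; rewrite gt_eqF.
rewrite -(ler_pM2l dR); move: E2 sd; move: (Fhat S Y _) (cnt z qhi) => f c1.
move: (d%:R : R) (s%:R : R) => D s'; nra.
Qed.

Lemma Mhat_bounds : sigma ^+ 2 * qlo <= Mhat S Y <= sigma ^+ 2 * qhi.
Proof.
apply/andP; split.
  by apply: lb_le_inf; [exact: Mhat_nonempty|move=> t /=; exact: Fhat_half_ge].
apply: inf_lbound; first by exists 0; exact: Mhat_lbound.
exact: Fhat_qhi.
Qed.

Lemma that_bounds : [/\ exists l : int, that S Y = 2 ^ l, 1 / 2 <= Fhat S Y (that S Y),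
  sigma ^+ 2 * qlo <= that S Y & that S Y <= 2 * (sigma ^+ 2 * qhi)].
Proof.
set A := [set t : R | exists l : int, t = 2 ^ l /\ 1 / 2 <= Fhat S Y t].
have An : A !=set0 by exact: that_nonempty.
have Al : lbound A (sigma ^+ 2 * qlo) by move=> t /= [l [_]]; exact: Fhat_half_ge.
have Ab : has_lbound A by exists (sigma ^+ 2 * qlo).
have lo : sigma ^+ 2 * qlo <= that S Y by exact: lb_le_inf.
have that0 : 0 < that S Y by apply: lt_le_trans lo; rewrite mulr_gt0.
(* An element below twice the infimum is the minimum, since a smaller power of 2 would be at most
   half of it. So the infimum is attained and [that] is itself a power of 2. *)
have [x Ax xlt] : exists2 x, A x & x < 2 * inf A.
  by apply: inf_lt => //; rewrite -/(that S Y); lra.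
have xE : x = that S Y.
  apply/eqP; rewrite eq_le; apply/andP; split; last exact: inf_lbound.
  apply: lb_le_inf => // y Ay; rewrite leNgt; apply/negP => yx.
  have [l [xl _]] := Ax; have [k [yk _]] := Ay; rewrite xl yk in yx.
  have := dyadic_succ yx; rewrite -xl -yk => H.
  have : inf A <= y by exact: inf_lbound.
  lra.
have [l [xl Fx]] := Ax; rewrite xE in xl Fx; split => //; first by exists l.
have qhi0 : 0 < sigma ^+ 2 * qhi.
  by apply: lt_le_trans (Fhat_half_ge Fhat_qhi); rewrite mulr_gt0.
have [k /andP[k1 k2]] := dyadic_between qhi0.
apply: le_trans (ltW k2); apply: inf_lbound => //=.
by exists k; split => //; apply: (le_trans Fhat_qhi); exact: Fhat_mono.
Qed.

(** The level is at least 1/2, so the quantile is at least 1/16 unless it has the default value 0,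
    in which case the estimate is 0. The 32 is 16 times the 2 lost by the dyadic rounding of
    [that]. *)
Lemma sigmaS2_bounds : 0 <= sigmaS2 S Y <= 32 * qhi * sigma ^+ 2.
Proof.
have [_ Fh lo hi] := that_bounds.
have that0 : 0 < that S Y by apply: lt_le_trans lo; rewrite mulr_gt0.
rewrite /sigmaS2 /sigmaS2_at; set p := Fhat _ _ _ in Fh *.
have [->|H] : Fchi2_inv p = 0 \/ p ^+ 2 / 4 <= Fchi2_inv p.
    have [p1|p1] := ltP p 1; last exact: Finv_ge1.
    by right; apply: Finv_ge; rewrite p1 andbT; lra.
  rewrite invr0 mulr0 lexx/=; have := mulr_gt0 sg2 qlo0; nra.
have f0 : 16^-1 <= Fchi2_inv p by apply: le_trans H; nra.
have f1 : 0 < Fchi2_inv p by lra.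
rewrite divr_ge0 ?(ltW that0) ?(ltW f1)//= ler_pdivrMr//.
have := mulr_gt0 sg2 qlo0; nra.
Qed.

End deterministic.

(** * Reduction of the risk to the coordinates off the support *)

Section risk.
Context {R : realType} (d s : nat) (S : 'M[R]_d) (theta e : 'I_d -> R) (sigma eta : R).
Hypothesis d0 : (0 < d)%N.
Hypothesis s0 : (0 < s)%N.
Hypothesis sg0 : 0 < sigma.
Hypothesis Sgt0 : forall i, 0 < S i i.
Hypothesis S1 : forall i, S i i <= 1.
Hypothesis sp : sparse s theta.
Hypothesis sF : s%:R <= frob S.

Let Y i := theta i + sigma * e i.
Let z i := e i / sig_i S i.
Let M := Num.max (Num.sqrt (sigmaS2 S Y)) (Num.sqrt (sigma_eta2 eta S Y)).
Let ta := tau eta S s.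
Let al := alpha_s_eta eta S s.

Definition loglevel : R := ln (1 + frob S ^+ 2 / s%:R ^+ 2).
Let L := loglevel.

Let sg2 : 0 < sigma ^+ 2. Proof. by rewrite exprn_gt0. Qed.
Let sR : 0 < @GRing.natmul R 1 s. Proof. by rewrite ltr0n. Qed.

(** The sum avoids the support while the centring runs over all coordinates; the excess has at most
    s terms. *)
Definition noise_part : R :=
  \sum_(i | theta i == 0) Y i ^+ 2 * (if M * sig_i S i * ta < `|Y i| then 1 else 0)
  - sigmaS2 S Y * al * \sum_i S i i.

(** Since s <= F, L is at least ln 2. Errors of order s are thereby absorbed into s L. *)
Lemma loglevel_ge : 2^-1 <= L.
Proof.
apply: (le_trans ln2_ge_half); rewrite ler_ln ?posrE//; last first.
  by rewrite ltr_wpDr// divr_ge0 ?sqr_ge0.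
have : s%:R ^+ 2 <= frob S ^+ 2 by rewrite lerXn2r ?nnegrE// (le_trans _ sF)// ltW.
rewrite -(ler_pM2r (_ : 0 < (s%:R ^+ 2)^-1)) ?invr_gt0 ?exprn_gt0//.
rewrite divff ?gt_eqF ?exprn_gt0//; lra.
Qed.

Lemma frob_gt0 : 0 < frob S.
Proof. exact: lt_le_trans sF. Qed.

Lemma expR_loglevel : expR (- L) <= (s%:R / frob S) ^+ 2.
Proof.
have F0 := frob_gt0.
have p0 : 0 < 1 + frob S ^+ 2 / s%:R ^+ 2 by rewrite ltr_wpDr// divr_ge0 ?sqr_ge0.
rewrite expRN lnK ?posrE// expr_div_n -[leRHS]invf_div lef_pV2 ?posrE//; last first.
  by rewrite divr_gt0 ?exprn_gt0.
by rewrite lerDr.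
Qed.

(** 9/8 is the squared factor 3 of [tau] over the 8 of the tail bounds. The linear bound serves
    means, the quadratic one variances; the former follows from the latter because s <= F. *)
Lemma expR_loglevel98 (x : R) : 9 / 8 * L <= x ->
  expR (- x) <= s%:R / frob S /\ expR (- x) <= (s%:R / frob S) ^+ 2.
Proof.
move=> Lx; have F0 := frob_gt0; have L0 := loglevel_ge.
have H : expR (- x) <= expR (- L) by rewrite ler_expR; lra.
have H2 := le_trans H expR_loglevel; split => //.
apply: (le_trans H2); rewrite expr2 ler_piMl//.
  by rewrite divr_ge0 ?ltW.
by rewrite ler_pdivrMr// mul1r.
Qed.

(** On the support a kept square is theta^2 + 2 sigma theta e + sigma^2 e^2, and a discarded one is
    at most the squared threshold, whence s ka. Cauchy-Schwarz on the cross term keeps the factor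
    ||theta||, as required to take square roots without loss. *)
Lemma signal_bound (G ka : R) :
  \sum_(i | theta i != 0) e i ^+ 2 <= G -> M ^+ 2 * ta ^+ 2 <= ka ->
  `|Qstar eta S s Y - l2norm theta ^+ 2| <=
    2 * l2norm theta * (sigma * Num.sqrt G) + sigma ^+ 2 * G + s%:R * ka + `|noise_part|.
Proof.
move=> GG kaM; rewrite /Qstar -/M -/ta -/al.
set b := l2norm theta.
have b0 : 0 <= b by exact: sqrtr_ge0.
have b2 : b ^+ 2 = \sum_(i | theta i != 0) theta i ^+ 2.
  rewrite sqr_sqrtr ?sumr_ge0//; last by move=> i _; exact: sqr_ge0.
  rewrite (bigID (fun i => theta i != 0))/= [X in _ + X]big1 ?addr0// => i /negbNE/eqP ->.
  by rewrite expr0n.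
have G0 : 0 <= G by apply: le_trans GG; rewrite sumr_ge0// => i _; exact: sqr_ge0.
have ka0 : 0 <= ka by apply: le_trans kaM; rewrite mulr_ge0 ?sqr_ge0.
have M0 : 0 <= M by rewrite le_max sqrtr_ge0.
have ta0 : 0 <= ta by rewrite mulr_ge0 ?sqrtr_ge0.
have -> : \sum_i Y i ^+ 2 * (if M * sig_i S i * ta < `|Y i| then 1 else 0) - sigmaS2 S Y * al * (\sum_i S i i) - b ^+ 2
  = 2 * sigma * (\sum_(i | theta i != 0) theta i * e i) + sigma ^+ 2 * (\sum_(i | theta i != 0) e i ^+ 2)
    - (\sum_(i | theta i != 0) Y i ^+ 2 * (if M * sig_i S i * ta < `|Y i| then 0 else 1)) + noise_part.
  rewrite /noise_part (bigID (fun i => theta i != 0))/= b2.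
  rewrite [X in _ + X - _ - _ = _](eq_bigl (fun i => theta i == 0)); last by move=> i; rewrite negbK.
  set A := \sum_(i | theta i == 0) _; set B := sigmaS2 _ _ * _ * _.
  suff -> : \sum_(i | theta i != 0) Y i ^+ 2 * (if M * sig_i S i * ta < `|Y i| then 1 else 0) =
     \sum_(i | theta i != 0) theta i ^+ 2 + 2 * sigma * (\sum_(i | theta i != 0) theta i * e i) + sigma ^+ 2 * (\sum_(i | theta i != 0) e i ^+ 2)
    - (\sum_(i | theta i != 0) Y i ^+ 2 * (if M * sig_i S i * ta < `|Y i| then 0 else 1)).
    by ring.
  rewrite !mulr_sumr -sumrN -!big_split/=; apply: eq_bigr => i _.
  by rewrite /Y; case: ifP => _; ring.
apply: (le_trans (ler_normD _ _)); rewrite lerD2r.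
apply: (le_trans (ler_normB _ _)); apply: lerD.
  apply: (le_trans (ler_normD _ _)); apply: lerD; last first.
    rewrite ger0_norm; first by rewrite ler_pM2l.
    by apply: mulr_ge0; [exact: ltW|apply: sumr_ge0 => i _; exact: sqr_ge0].
  have sg20 : 0 <= 2 * sigma by rewrite mulr_ge0// ltW.
  rewrite normrM [`|2 * sigma|]ger0_norm//.
  have CS := sum_cauchy_schwarz (fun i => theta i != 0) theta e.
  have H : `|\sum_(i | theta i != 0) theta i * e i| <= b * Num.sqrt G.
    rewrite -ler_sqr ?nnegrE ?mulr_ge0 ?sqrtr_ge0// real_normK ?num_real//.
    rewrite [leRHS]exprMn (sqr_sqrtr G0) b2.
    by apply: (le_trans CS); apply: ler_wpM2l => //; rewrite -b2 sqr_ge0.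
  have : 2 * sigma * `|\sum_(i | theta i != 0) theta i * e i| <= 2 * sigma * (b * Num.sqrt G).
    exact: ler_wpM2l.
  move/le_trans; apply; rewrite le_eqVlt; apply/orP; left; apply/eqP; ring.
rewrite ger0_norm; last by apply: sumr_ge0 => i _; rewrite mulr_ge0 ?sqr_ge0//; case: ifP.
apply: (sum_supp_le sp) => // i _.
case: ifPn => [_|]; first by rewrite mulr0.
rewrite -leNgt mulr1 => H; apply: le_trans kaM.
have sig1 : sig_i S i <= 1 by rewrite -[leRHS]sqrtr1 ler_sqrt.
have sigp := sig_i_gt0 Sgt0 i.
rewrite -[leLHS]real_normK ?num_real// -exprMn lerXn2r ?nnegrE ?mulr_ge0//.
apply: (le_trans H); rewrite mulrAC ler_piMr// mulr_ge0//.
Qed.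

(** The total error E dominates sigma^2 g s, so the cross term is at most 2 ||theta|| sqrt E, and
    passing to square roots costs the factor 9. The doubled constants come from 1 <= 2 L. *)
Lemma risk_bound (g ka cn : R) : 0 <= g -> 0 <= cn ->
  \sum_(i | theta i != 0) e i ^+ 2 <= g * s%:R ->
  M ^+ 2 * ta ^+ 2 <= ka * sigma ^+ 2 * L ->
  `|noise_part| <= cn * sigma ^+ 2 * s%:R ->
  (Nstar eta S s Y - l2norm theta) ^+ 2 <= 9 * (2 * g + ka + 2 * cn) * sigma ^+ 2 * psi_star s S.
Proof.
move=> g0 cn0 Gs kaM nb.
have L0 := loglevel_ge.
have ka0 : 0 <= ka * sigma ^+ 2 * L.
  by apply: le_trans kaM; rewrite mulr_ge0 ?sqr_ge0.
have b0 : 0 <= l2norm theta by exact: sqrtr_ge0.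
set E := sigma ^+ 2 * (g * s%:R) + s%:R * (ka * sigma ^+ 2 * L) + cn * sigma ^+ 2 * s%:R.
have t1 : 0 <= sigma ^+ 2 * (g * s%:R) by exact: mulr_ge0 (ltW sg2) (mulr_ge0 g0 (ltW sR)).
have t2 : 0 <= s%:R * (ka * sigma ^+ 2 * L) by exact: mulr_ge0 (ltW sR) ka0.
have t3 : 0 <= cn * sigma ^+ 2 * s%:R by exact: mulr_ge0 (mulr_ge0 cn0 (ltW sg2)) (ltW sR).
have E0 : 0 <= E by rewrite !addr_ge0.
apply: (@le_trans _ _ (9 * E)).
  apply: dist_sqrt_le => //.
  apply: (le_trans (signal_bound Gs kaM)).
  have : sigma * Num.sqrt (g * s%:R) <= Num.sqrt E.
    rewrite -[X in X * _]ger0_norm ?(ltW sg0)// -sqrtr_sqr -sqrtrM ?sqr_ge0// ler_sqrt//.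
    by rewrite /E -addrA lerDl addr_ge0.
  move=> /(ler_wpM2l b0); rewrite /E; lra.
rewrite /psi_star sF -/(loglevel) -/L.
have sL : s%:R <= 2 * (s%:R * L).
  have : s%:R * 2^-1 <= s%:R * L by rewrite ler_pM2l.
  lra.
have a1 : sigma ^+ 2 * (g * s%:R) <= sigma ^+ 2 * (g * (2 * (s%:R * L))).
  by apply: ler_wpM2l; [exact: ltW|exact: ler_wpM2l].
have a2 : cn * sigma ^+ 2 * s%:R <= cn * sigma ^+ 2 * (2 * (s%:R * L)).
  by apply: ler_wpM2l => //; rewrite mulr_ge0// ltW.
rewrite /E; move: a1 a2; move: (sigma ^+ 2) (s%:R : R) => v s'; lra.
Qed.

End risk.

(** * The coordinates off the support, for a fixed noise vector *)

Section noise.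
Context {R : realType} (d s : nat) (S : 'M[R]_d) (theta e : 'I_d -> R) (sigma eta : R).
Hypothesis d0 : (0 < d)%N.
Hypothesis s0 : (0 < s)%N.
Hypothesis sg0 : 0 < sigma.
Hypothesis Sgt0 : forall i, 0 < S i i.
Hypothesis S1 : forall i, S i i <= 1.
Hypothesis sp : sparse s theta.
Hypothesis sF : s%:R <= frob S.
Hypothesis sd : @GRing.natmul R 1 s <= d%:R / 4.

Let Y i := theta i + sigma * e i.
Let z i := e i / sig_i S i.
Let M := Num.max (Num.sqrt (sigmaS2 S Y)) (Num.sqrt (sigma_eta2 eta S Y)).
Let ta := tau eta S s.
Let al := alpha_s_eta eta S s.
Let L := loglevel s S.
Let qlo := qchi (eta / 20).
Let qhi := qchi (1 - eta / 20).
Let F := frob S.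

Hypothesis qlo0 : 0 < qlo.
Hypothesis qlohi : qlo <= qhi.
Hypothesis E1 : cnt z qlo < d%:R / 4.
Hypothesis E2 : 3 / 4 * d%:R <= cnt z qhi.

Let sg2 : 0 < sigma ^+ 2. Proof. by rewrite exprn_gt0. Qed.
Let sR : 0 < @GRing.natmul R 1 s. Proof. by rewrite ltr0n. Qed.
Let dR : 0 < @GRing.natmul R 1 d. Proof. by rewrite ltr0n. Qed.
Let qhi0 : 0 < qhi. Proof. exact: lt_le_trans qlohi. Qed.
Let F0 : 0 < F. Proof. exact: (frob_gt0 s0 sF). Qed.
Let L0 : 2^-1 <= L. Proof. exact: loglevel_ge. Qed.
Let Ls : 0 < L. Proof. by have := L0; lra. Qed.

Lemma tau_sqr : ta ^+ 2 = 9 * (qhi / qlo) * L.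
Proof.
rewrite /ta /tau exprMn sqr_sqrtr; first by rewrite -/(loglevel s S) -/L -/qhi -/qlo; ring.
by rewrite mulr_ge0// ?divr_ge0 ?ltW.
Qed.

Lemma tau_sqr_ge : 9 * L <= ta ^+ 2.
Proof.
rewrite tau_sqr ler_pM2r// ler_peMr//.
by rewrite ler_pdivlMr// mul1r.
Qed.

Lemma tau_ge0 : 0 <= ta.
Proof. by rewrite mulr_ge0 ?sqrtr_ge0. Qed.

Lemma tau_gt0 : 0 < ta.
Proof.
rewrite lt_def tau_ge0 andbT; apply/eqP => t0; have := tau_sqr_ge; rewrite t0 expr0n/=.
by have := L0; lra.
Qed.

Lemma alphaE : (al%:E = \int[normal_prob (0 : R) 1]_x (if ta <= `|x| then x ^+ 2 else 0)%:E)%E.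
Proof.
have H : (\int[normal_prob (0 : R) 1]_(x in [set x : R | (ta <= `|x|)%R]) (x ^+ 2)%:E =
  \int[normal_prob (0 : R) 1]_x (if ta <= `|x| then x ^+ 2 else 0)%:E)%E.
  rewrite integral_mkcond; apply: eq_integral => x _; rewrite patchE.
  case: ifPn => [/set_mem/= ->//|/negP H]; rewrite ifN//.
  by apply/negP => h; apply: H; exact/mem_set.
rewrite -H /al /alpha_s_eta fineK// H ge0_fin_numE; last first.
  by apply: integral_ge0 => x _; case: ifP; rewrite lee_fin ?sqr_ge0.
exact: le_lt_trans (expect_sqr_tail tau_ge0) (ltry _).
Qed.

Lemma alpha_bounds : 0 <= al <= 16 * expR (- (ta ^+ 2 / 8)).
Proof.
apply/andP; split; rewrite -lee_fin alphaE; last exact: expect_sqr_tail tau_ge0.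
by apply: integral_ge0 => x _; case: ifP; rewrite lee_fin ?sqr_ge0.
Qed.

Lemma expR_tau : expR (- (ta ^+ 2 / 8)) <= s%:R / F.
Proof.
by have [] := @expR_loglevel98 R d s S s0 sF (ta ^+ 2 / 8); first by have := tau_sqr_ge; rewrite -/L; lra.
Qed.

Lemma sigma_eta2_bounds : sigma ^+ 2 * (qlo / qhi) <= sigma_eta2 eta S Y <= sigma ^+ 2.
Proof.
have /andP[lo hi] := Mhat_bounds d0 sg0 sp sd E1 E2.
rewrite /sigma_eta2 -/qhi; apply/andP; split.
  by rewrite mulrA ler_pM2r// invr_gt0.
by rewrite ler_pdivrMr.
Qed.

Lemma Msqr : M ^+ 2 = Num.max (sigmaS2 S Y) (sigma_eta2 eta S Y).
Proof.
have /andP[a0 _] := sigmaS2_bounds d0 sg0 sp sd qlo0 E1 E2.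
have /andP[b0 _] := sigma_eta2_bounds.
have {}b0 : 0 <= sigma_eta2 eta S Y.
  by apply: le_trans b0; rewrite mulr_ge0 ?divr_ge0 ?ltW.
rewrite /M; have [ab|ba] := leP (sigmaS2 S Y) (sigma_eta2 eta S Y).
  by rewrite max_r ?ler_sqrt// sqr_sqrtr.
by rewrite max_l ?ler_sqrt ?(ltW ba)// sqr_sqrtr.
Qed.

(** The factor qhi/qlo in tau^2 exactly cancels the worst underestimation of sigma^2 by
    [sigma_eta2]; [sigmaS2] can only raise the threshold. *)
Lemma threshold_ge : 9 * L * sigma ^+ 2 <= M ^+ 2 * ta ^+ 2.
Proof.
have /andP[b0 _] := sigma_eta2_bounds.
have : sigma ^+ 2 * (qlo / qhi) <= M ^+ 2 by rewrite Msqr le_max b0 orbT.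
move=> /(ler_wpM2r (sqr_ge0 ta)); apply: le_trans.
rewrite tau_sqr le_eqVlt; apply/orP; left; apply/eqP; field.
by rewrite !gt_eqF.
Qed.

Lemma threshold_le : M ^+ 2 * ta ^+ 2 <= (1 + 32 * qhi) * (9 * (qhi / qlo)) * sigma ^+ 2 * L.
Proof.
have /andP[_ a1] := sigmaS2_bounds d0 sg0 sp sd qlo0 E1 E2.
have /andP[_ b1] := sigma_eta2_bounds.
have : M ^+ 2 <= (1 + 32 * qhi) * sigma ^+ 2.
  rewrite Msqr ge_max; apply/andP; split.
    by apply: (le_trans a1); rewrite ler_pM2r// lerDr.
  apply: (le_trans b1); rewrite ler_peMl ?(ltW sg2)// lerDl mulr_ge0// ltW//.
move=> /(ler_wpM2r (sqr_ge0 ta)) /le_trans; apply.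
by rewrite tau_sqr le_eqVlt; apply/orP; left; apply/eqP; ring.
Qed.

Let MtE i : theta i = 0 -> (M * sig_i S i * ta < `|Y i|) = (M * ta < sigma * `|z i|).
Proof.
move=> t0; have si := sig_i_gt0 Sgt0 i.
rewrite /Y t0 add0r /z normrM (gtr0_norm sg0) normrM normfV (gtr0_norm si).
by rewrite [M * _ * ta]mulrAC [sigma * (_ / _)]mulrA ltr_pdivlMr.
Qed.

Let Ysqr i : theta i = 0 -> Y i ^+ 2 = sigma ^+ 2 * (S i i * z i ^+ 2).
Proof.
move=> t0; have si := sig_i_gt0 Sgt0 i.
rewrite /Y t0 add0r exprMn /z expr_div_n -(sig_i_sqr Sgt0 i); congr (_ * _).
by field; rewrite gt_eqF.
Qed.

Let sumS : \sum_i S i i <= d%:R.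
Proof.
apply: (@le_trans _ _ (\sum_(i < d) 1)); first exact: ler_sum.
by rewrite sumr_const card_ord.
Qed.

Let sumS0 : 0 <= \sum_i S i i.
Proof. by apply: sumr_ge0 => i _; exact: ltW. Qed.

Let M0 : 0 <= M.
Proof. by rewrite le_max sqrtr_ge0. Qed.

(** No cancellation is used: d exp (- 9 L/8) <= d s/F <= s/c0 bounds the tail sum and the centring
    separately. The 512 is the 32 of the bound on [sigmaS2] times the 16 of the bound on alpha. *)
Lemma noise_dense (c0 B : R) : 0 < c0 -> c0 * d%:R <= F -> 0 <= B ->
  \sum_i (if 3 * Num.sqrt L <= `|z i| then z i ^+ 2 else 0) <= B * (d%:R * expR (- (9 / 8 * L))) ->
  `|noise_part s S theta e sigma eta| <= ((B + 512 * qhi) / c0) * sigma ^+ 2 * s%:R.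
Proof.
move=> c00 cd B0 HB.
have [a0 _] := @expR_loglevel98 R d s S s0 sF (9 / 8 * L) (lexx _).
have de : d%:R * expR (- (9 / 8 * L)) <= s%:R / c0.
  apply: (@le_trans _ _ (F / c0 * (s%:R / F))).
    apply: ler_pM => //; rewrite ?expR_ge0 ?ler0n//.
    by rewrite ler_pdivlMr// mulrC.
  by rewrite le_eqVlt; apply/orP; left; apply/eqP; field; rewrite !gt_eqF.
have /andP[sS0 sS1] := sigmaS2_bounds d0 sg0 sp sd qlo0 E1 E2.
have /andP[al0 al1] := alpha_bounds.
have et : expR (- (ta ^+ 2 / 8)) <= expR (- (9 / 8 * L)).
  by rewrite ler_expR; have := tau_sqr_ge; lra.
have n1 : \sum_(i | theta i == 0) Y i ^+ 2 * (if M * sig_i S i * ta < `|Y i| then 1 else 0) <= sigma ^+ 2 * (B * (s%:R / c0)).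
  apply: (@le_trans _ _ (sigma ^+ 2 * \sum_i (if 3 * Num.sqrt L <= `|z i| then z i ^+ 2 else 0))); last first.
    by rewrite ler_pM2l//; apply: (le_trans HB); exact: ler_wpM2l.
  rewrite mulr_sumr [leRHS](bigID (fun i => theta i == 0))/= ler_wpDr//.
    by apply: sumr_ge0 => i _; rewrite mulr_ge0 ?(ltW sg2)//; case: ifP; rewrite ?sqr_ge0.
  apply: ler_sum => i /eqP t0; rewrite MtE// Ysqr// -mulrA ler_pM2l//.
  case: ifPn => [lt|_]; last by rewrite mulr0; case: ifP; rewrite ?sqr_ge0.
  rewrite ifT; first by rewrite mulr1 ler_piMl ?sqr_ge0.
  have : 3 * Num.sqrt L * sigma <= M * ta.
    rewrite -ler_sqr ?nnegrE ?mulr_ge0 ?sqrtr_ge0 ?tau_ge0 ?(ltW sg0)//.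
    rewrite [leRHS]exprMn 2!exprMn sqr_sqrtr ?(ltW Ls)//.
    by rewrite (_ : 3 ^+ 2 = 9 :> R) ?threshold_ge//; ring.
  move=> /le_lt_trans/(_ lt); rewrite mulrC ltr_pM2l// => /ltW; exact.
have n1' : 0 <= \sum_(i | theta i == 0) Y i ^+ 2 * (if M * sig_i S i * ta < `|Y i| then 1 else 0).
  by apply: sumr_ge0 => i _; rewrite mulr_ge0 ?sqr_ge0//; case: ifP.
have n2 : sigmaS2 S Y * al * \sum_i S i i <= 512 * qhi * sigma ^+ 2 * (s%:R / c0).
  apply: (@le_trans _ _ (32 * qhi * sigma ^+ 2 * (16 * expR (- (9 / 8 * L))) * d%:R)).
    apply: ler_pM => //; first exact: mulr_ge0.
    by apply: ler_pM => //; apply: (le_trans al1); rewrite ler_pM2l.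
  have q0 : 0 <= 512 * qhi * sigma ^+ 2 by exact: mulr_ge0 (mulr_ge0 (ler0n _ 512) (ltW qhi0)) (ltW sg2).
  apply: le_trans (ler_wpM2l q0 de); rewrite le_eqVlt; apply/orP; left; apply/eqP; ring.
have n2' : 0 <= sigmaS2 S Y * al * \sum_i S i i by exact: mulr_ge0 (mulr_ge0 sS0 al0) sumS0.
rewrite /noise_part -/M -/ta -/al ler_norml; apply/andP; split.
  rewrite lerNl opprB lerBlDr; apply: (le_trans n2); rewrite ler_wpDr//.
  rewrite -subr_ge0; have -> : (B + 512 * qhi) / c0 * sigma ^+ 2 * s%:R - 512 * qhi * sigma ^+ 2 * (s%:R / c0) = B * sigma ^+ 2 * (s%:R / c0) by ring.
  exact: mulr_ge0 (mulr_ge0 B0 (ltW sg2)) (divr_ge0 (ltW sR) (ltW c00)).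
rewrite lerBlDr; apply: (le_trans n1); rewrite ler_wpDr//.
rewrite -subr_ge0; have -> : (B + 512 * qhi) / c0 * sigma ^+ 2 * s%:R - sigma ^+ 2 * (B * (s%:R / c0)) = 512 * qhi * sigma ^+ 2 * (s%:R / c0) by ring.
exact: mulr_ge0 (mulr_ge0 (mulr_ge0 (ler0n _ 512) (ltW qhi0)) (ltW sg2)) (divr_ge0 (ltW sR) (ltW c00)).
Qed.

(** The error has three sources: moving the threshold from its random to its ideal value, the
    fluctuation of the ideal tail sum, and the error in the centring. The first and third are linear
    in d r = rho0 F, which exp (- tau^2/8) <= s/F brings down to order s. *)
Lemma noise_sparse (r rho0 B5 B6 : R) : 0 <= rho0 -> r = rho0 * (F / d%:R) -> r <= 4^-1 ->
  `|sigmaS2 S Y - sigma ^+ 2| <= r * sigma ^+ 2 ->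
  sigma_eta2 eta S Y <= sigmaS2 S Y ->
  `|\sum_i (if theta i == 0 then S i i else 0) * ((if ta <= `|z i| then z i ^+ 2 else 0) - al)| <= B5 * s%:R ->
  0 <= B6 ->
  \sum_i (if ((1 - r) * ta <= `|z i| <= (1 + r) * ta)%R then z i ^+ 2 else 0) <= B6 * (d%:R * r * expR (- (ta ^+ 2 / 8))) ->
  `|noise_part s S theta e sigma eta| <= (B6 * rho0 + B5 + 16 * rho0 + 16) * sigma ^+ 2 * s%:R.
Proof.
move=> rho00 rE r4 Hs Hse H5 B60 H6.
have r0 : 0 <= r by rewrite rE mulr_ge0// divr_ge0 ?(ltW F0) ?(ltW dR).
have /andP[sS0 sS1] := sigmaS2_bounds d0 sg0 sp sd qlo0 E1 E2.
have /andP[al0 al1] := alpha_bounds.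
have drF : d%:R * r = rho0 * F by rewrite rE; field; rewrite gt_eqF.
have dre : d%:R * r * expR (- (ta ^+ 2 / 8)) <= rho0 * s%:R.
  rewrite drF -mulrA ler_wpM2l// -ler_pdivlMl// [F^-1 * _]mulrC; exact: expR_tau.
have e1 : expR (- (ta ^+ 2 / 8)) <= 1 by rewrite expR_le1 oppr_le0 divr_ge0 ?sqr_ge0.
(* [sigma_eta2] does not exceed [sigmaS2] here, so the maximum is the accurate estimate. *)
have ME : M = Num.sqrt (sigmaS2 S Y).
  by rewrite /M max_l// ler_sqrt.
have M2 : M ^+ 2 = sigmaS2 S Y by rewrite ME sqr_sqrtr.
(* (1 - r)^2 <= 1 - r and 1 + r <= (1 + r)^2, so a relative error r on the variance is also one on
   the scale. *)
have Mlo : (1 - r) * sigma <= M.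
  rewrite -ler_sqr ?nnegrE// ?mulr_ge0 ?(ltW sg0)//; last by lra.
  move: Hs; rewrite ler_norml -M2 exprMn => /andP[+ _]; nra.
have Mhi : M <= (1 + r) * sigma.
  rewrite -ler_sqr ?nnegrE// ?mulr_ge0 ?(ltW sg0)//; last by lra.
  move: Hs; rewrite ler_norml -M2 exprMn => /andP[_]; nra.
have ta0 := tau_ge0.
(* The two tests disagree only if |z_i| lies between the random and the ideal threshold, hence in
   the annulus of relative width r. *)
pose D i := z i ^+ 2 * (if M * ta < sigma * `|z i| then 1 else 0) - (if ta <= `|z i| then z i ^+ 2 else 0).
have nE : noise_part s S theta e sigma eta =
   sigma ^+ 2 * (\sum_(i | theta i == 0) S i i * D i)
   + sigma ^+ 2 * (\sum_i (if theta i == 0 then S i i else 0) * ((if ta <= `|z i| then z i ^+ 2 else 0) - al))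
   + al * ((sigma ^+ 2 - sigmaS2 S Y) * (\sum_i S i i) - sigma ^+ 2 * \sum_(i | theta i != 0) S i i).
  have -> : \sum_i (if theta i == 0 then S i i else 0) * ((if ta <= `|z i| then z i ^+ 2 else 0) - al) =
     \sum_(i | theta i == 0) S i i * ((if ta <= `|z i| then z i ^+ 2 else 0) - al).
    by rewrite [RHS]big_mkcond; apply: eq_bigr => i _; case: ifP => _ //; rewrite mul0r.
  rewrite /noise_part -/M -/ta -/al.
  have -> : \sum_(i | theta i == 0) Y i ^+ 2 * (if M * sig_i S i * ta < `|Y i| then 1 else 0) =
     sigma ^+ 2 * (\sum_(i | theta i == 0) S i i * D i) +
     sigma ^+ 2 * (\sum_(i | theta i == 0) S i i * ((if ta <= `|z i| then z i ^+ 2 else 0) - al)) +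
     sigma ^+ 2 * (\sum_(i | theta i == 0) S i i * al).
    rewrite !mulr_sumr -!big_split/=; apply: eq_bigr => i /eqP t0.
    rewrite MtE// Ysqr// /D; move: (if M * ta < _ then _ else _) (if ta <= _ then _ else _) => a b.
    by ring.
  rewrite -mulr_suml (bigID (fun i => theta i == 0) predT)/=; ring.
have b1 : `|\sum_(i | theta i == 0) S i i * D i| <= B6 * (rho0 * s%:R).
  apply: (@le_trans _ _ (\sum_i (if ((1 - r) * ta <= `|z i| <= (1 + r) * ta)%R then z i ^+ 2 else 0))); last first.
    by apply: (le_trans H6); exact: ler_wpM2l.
  apply: (le_trans (ler_norm_sum _ _ _)).
  rewrite [leRHS](bigID (fun i => theta i == 0))/= ler_wpDr//.
    by apply: sumr_ge0 => i _; case: ifP; rewrite ?sqr_ge0.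
  apply: ler_sum => i _; rewrite normrM ger0_norm ?(ltW (Sgt0 i))//.
  apply: (@le_trans _ _ `|D i|); first by rewrite ler_piMl.
  rewrite /D; have z2 := sqr_ge0 (z i).
  have Mlo' : (1 - r) * ta * sigma <= M * ta by nra.
  have Mhi' : M * ta <= (1 + r) * ta * sigma by nra.
  have r1 : (1 - r) * ta <= ta by nra.
  have r2 : ta <= (1 + r) * ta by nra.
  case: ifPn => [lt|]; case: ifPn => [le|].
  - by rewrite mulr1 subrr normr0; case: ifP.
  - rewrite -ltNge => lt2; rewrite mulr1 subr0 ger0_norm// ifT//.
    rewrite (le_trans (ltW lt2) r2) andbT.
    by have := le_lt_trans Mlo' lt; rewrite [sigma * _]mulrC ltr_pM2r// => /ltW.
  - rewrite -leNgt => le2; rewrite mulr0 sub0r normrN ger0_norm// ifT//.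
    rewrite (le_trans r1 le)/=.
    by have := le_trans le2 Mhi'; rewrite [sigma * _]mulrC ler_pM2r.
  - by rewrite mulr0 subrr normr0; case: ifP.
have b3 : `|al * ((sigma ^+ 2 - sigmaS2 S Y) * (\sum_i S i i) - sigma ^+ 2 * \sum_(i | theta i != 0) S i i)|
    <= 16 * sigma ^+ 2 * (rho0 * s%:R + s%:R).
  rewrite normrM ger0_norm//.
  have ss : \sum_(i | theta i != 0) S i i <= s%:R * 1 by apply: (sum_supp_le sp) => // i _.
  have ss0 : 0 <= \sum_(i | theta i != 0) S i i by apply: sumr_ge0 => i _; exact: ltW.
  have : `|(sigma ^+ 2 - sigmaS2 S Y) * (\sum_i S i i) - sigma ^+ 2 * \sum_(i | theta i != 0) S i i|
     <= sigma ^+ 2 * (d%:R * r + s%:R).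
    apply: (le_trans (ler_normB _ _)); rewrite mulrDr; apply: lerD.
      rewrite normrM [`|\sum_i S i i|]ger0_norm// distrC (mulrC d%:R) mulrA (mulrC _ r).
      by apply: ler_pM.
    rewrite ger0_norm; last exact: mulr_ge0 (ltW sg2) ss0.
    by rewrite (ler_pM2l sg2); move: ss; rewrite mulr1.
  move=> H; apply: (@le_trans _ _ (16 * expR (- (ta ^+ 2 / 8)) * (sigma ^+ 2 * (d%:R * r + s%:R)))).
    exact: ler_pM.
  have -> : 16 * expR (- (ta ^+ 2 / 8)) * (sigma ^+ 2 * (d%:R * r + s%:R)) =
     16 * sigma ^+ 2 * (d%:R * r * expR (- (ta ^+ 2 / 8)) + s%:R * expR (- (ta ^+ 2 / 8))) by ring.
  rewrite ler_pM2l ?mulr_gt0//; apply: lerD => //.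
  by rewrite ler_piMr// ltW.
rewrite nE; apply: (le_trans (ler_normD _ _)).
have n2 : `|sigma ^+ 2 * (\sum_(i | theta i == 0) S i i * D i)| <= sigma ^+ 2 * (B6 * (rho0 * s%:R)).
  by rewrite normrM ger0_norm ?(ltW sg2)// ler_pM2l.
have n3 := @ler_wpM2l _ _ (ltW sg2) _ _ H5.
rewrite -[X in X * `|_|]ger0_norm ?(ltW sg2)// -normrM in n3.
have n4 := ler_normD (sigma ^+ 2 * (\sum_(i | theta i == 0) S i i * D i)) (sigma ^+ 2 * (\sum_i (if theta i == 0 then S i i else 0) * ((if ta <= `|z i| then z i ^+ 2 else 0) - al))).
apply: (le_trans (lerD (le_trans n4 (lerD n2 n3)) b3)).
by rewrite le_eqVlt; apply/orP; left; apply/eqP; ring.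
Qed.

End noise.

(** * Accuracy of the dyadic scale estimate *)

Section scale_estimation.
Context {R : realType} (d s : nat) (S : 'M[R]_d) (theta e : 'I_d -> R) (sigma eta : R).
Hypothesis d0 : (0 < d)%N.
Hypothesis s0 : (0 < s)%N.
Hypothesis sg0 : 0 < sigma.
Hypothesis sp : sparse s theta.
Hypothesis sF : s%:R <= frob S.
Hypothesis sd : @GRing.natmul R 1 s <= d%:R / 4.

Let Y i := theta i + sigma * e i.
Let z i := e i / sig_i S i.
Let qlo := qchi (eta / 20).
Let qhi := qchi (1 - eta / 20).
Let q34 : R := qchi (3 / 4).
Let F := frob S.

Hypothesis qlo0 : 0 < qlo.
Hypothesis qlohi : qlo <= qhi.
Hypothesis E1 : cnt z qlo < d%:R / 4.
Hypothesis E2 : 3 / 4 * d%:R <= cnt z qhi.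

Let sg2 : 0 < sigma ^+ 2. Proof. by rewrite exprn_gt0. Qed.
Let sR : 0 < @GRing.natmul R 1 s. Proof. by rewrite ltr0n. Qed.
Let dR : 0 < @GRing.natmul R 1 d. Proof. by rewrite ltr0n. Qed.
Let qhi0 : 0 < qhi. Proof. exact: lt_le_trans qlohi. Qed.
Let F0 : 0 < F. Proof. exact: (frob_gt0 s0 sF). Qed.

(** Confines [that] to a deterministic grid whose size depends on eta alone, which keeps the later
    union bound free of d. Here 2^l0 is the power of 2 just above sigma^2 qlo. *)
Lemma that_grid (l0 : int) (N0 : nat) : 2 ^ l0 < 2 * (sigma ^+ 2 * qlo) ->
  2 * (qhi / qlo) <= 2 ^+ N0 -> sigma ^+ 2 * qlo <= 2 ^ l0 ->
  exists k : 'I_N0.+1, that S Y = 2 ^ (l0 + k%:Z).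
Proof.
move=> h1 h2 h3.
have [[l tl] _ lo hi] := that_bounds d0 sg0 sp sd qlo0 E1 E2; rewrite -/Y in tl lo hi.
have l0l : (l0 <= l)%R.
  rewrite -ltzD1 -(@ltr_eXz2l R 2) ?ltr1n// expfzDr// expr1z mulrC -tl.
  by apply: (lt_le_trans h1); rewrite ler_pM2l.
have lE : l = l0 + `|l - l0|%N%:Z by rewrite gez0_abs ?subr_ge0// subrKC.
have kN : (`|l - l0|%N < N0.+1)%N.
  move: (`|l - l0|%N) lE => n lE; rewrite ltnS -(@ler_eXn2l R 2) ?ltr1n//.
  apply: le_trans h2; move: hi; rewrite tl lE expfzDr// -exprnP => hi.
  have : sigma ^+ 2 * qlo * 2 ^+ n <= 2 * (sigma ^+ 2 * qhi).
    by apply: le_trans hi; rewrite ler_wpM2r// exprn_ge0.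
  move=> H; rewrite mulrA ler_pdivlMr// -(ler_pM2l sg2); move: H; move: (sigma ^+ 2) sg2 => v _.
  by rewrite [2 * (v * qhi)]mulrCA -[v * qlo * _]mulrA [qlo * _]mulrC.
by exists (Ordinal kN); rewrite tl /= -lE.
Qed.

(** The level is off by at most k = (A + 1) u: A from the fluctuation, 1 from the support, as s <=
    F. The quantile is then off by at most 2k/m = rho0 u qlo/2; as it is at least qlo/2, the
    relative error is at most rho0 u, whence the form of rho0. The last smallness condition keeps
    all arguments within the range of the slope bound. *)
Lemma sigmaS2_accuracy (A m : R) :
  let rho0 := 4 * (A + 1) / (m * qlo) in let u := F / d%:R in
  0 <= A -> 0 < m ->
  (forall t h, 0 <= t -> 0 <= h -> t + h <= 2 * qhi + 1 -> Fchi2 t + m * h <= Fchi2 (t + h)) ->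
  `|cnt z (that S Y / sigma ^+ 2) - d%:R * Fchi2 (that S Y / sigma ^+ 2)| <= A * F ->
  `|cnt z q34 - d%:R * (3 / 4)| <= A * F ->
  (A + 1) * u <= 4^-1 -> rho0 * u <= 4^-1 -> rho0 * u <= 1 - q34 / qhi -> rho0 * u * qlo <= 2 ->
  `|sigmaS2 S Y - sigma ^+ 2| <= rho0 * u * sigma ^+ 2 /\ sigma_eta2 eta S Y <= sigmaS2 S Y.
Proof.
move=> rho0 u A0 m0 lip E4 E4' c1 c2 c3 c4.
have [_ Fh lo hi] := that_bounds d0 sg0 sp sd qlo0 E1 E2; rewrite -/Y in Fh lo hi.
set x := that S Y / sigma ^+ 2 in E4 *.
have xlo : qlo <= x by rewrite /x ler_pdivlMr// mulrC.
have xhi : x <= 2 * qhi by rewrite /x ler_pdivrMr// -mulrA [qhi * _]mulrC.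
have tx : that S Y = x * sigma ^+ 2 by rewrite /x divfK// gt_eqF.
set p := Fhat S Y (that S Y) in Fh *.
pose k := (A + 1) * u.
have u0 : 0 < u by rewrite divr_gt0.
have k0 : 0 < k by rewrite mulr_gt0// ltr_wpDl.
have Fs : forall t c, `|cnt z (t / sigma ^+ 2) - d%:R * c| <= A * F -> `|Fhat S Y t - c| <= k.
  move=> t c H; rewrite /k /u mulrA ler_pdivlMr//.
  rewrite -[X in _ * X]ger0_norm ?(ltW dR)// -normrM mulrBl [_ * d%:R]mulrC [c * _]mulrC.
  have -> : d%:R * Fhat S Y t - d%:R * c = (d%:R * Fhat S Y t - cnt z (t / sigma ^+ 2)) + (cnt z (t / sigma ^+ 2) - d%:R * c) by ring.
  apply: (le_trans (ler_normD _ _)); rewrite mulrDl mul1r [leRHS]addrC; apply: lerD => //.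
  exact: le_trans (Fhat_cnt S e d0 sg0 sp t) sF.
have pF : `|p - Fchi2 x| <= k by apply: Fs.
have mq0 : 0 < m * qlo by rewrite mulr_gt0.
have kE : 2 * k / m = rho0 * u * qlo / 2.
  by rewrite /k /rho0; field; rewrite !gt_eqF.
have yx : `|Fchi2_inv p - x| <= rho0 * u * qlo / 2.
  rewrite -kE; apply: (Finv_close m0 lip) => //; first by lra.
  - by rewrite kE; nra.
  - by rewrite kE; lra.
set y := Fchi2_inv p in yx *.
have rho00 : 0 < rho0 by rewrite divr_gt0// mulr_gt0// ltr_wpDl.
have ylo : qlo / 2 <= y.
  by move: yx; rewrite ler_norml => /andP[+ _]; nra.
have y0 : 0 < y by apply: lt_le_trans ylo; rewrite divr_gt0.
have sE : sigmaS2 S Y = sigma ^+ 2 * (x / y).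
  by rewrite /sigmaS2 /sigmaS2_at -/p -/y tx; ring.
have acc : `|sigmaS2 S Y - sigma ^+ 2| <= rho0 * u * sigma ^+ 2.
  have -> : sigmaS2 S Y - sigma ^+ 2 = sigma ^+ 2 * ((x - y) / y) by rewrite sE; field; rewrite gt_eqF.
  rewrite normrM ger0_norm ?(ltW sg2)// mulrC ler_pM2r// normrM normfV (gtr0_norm y0) ler_pdivrMr//.
  rewrite distrC (le_trans yx)// -mulrA ler_pM2l// mulr_gt0//.
split => //.
(* The value sigma^2 q34/qhi separates the two estimates: at sigma^2 q34 the empirical level is at
   least 3/4 - 1/4 = 1/2, so [Mhat] is at most sigma^2 q34. *)
have r1 : sigma ^+ 2 * (q34 / qhi) <= sigmaS2 S Y.
  move: acc; rewrite ler_norml => /andP[+ _]; nra.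
apply: le_trans r1; rewrite /sigma_eta2 -/qhi mulrA ler_pM2r ?invr_gt0//.
apply: inf_lbound; first by exists 0; exact: Mhat_lbound.
have : `|Fhat S Y (sigma ^+ 2 * q34) - 3 / 4| <= k.
  by apply: Fs; rewrite [_ * q34]mulrC mulfK ?gt_eqF.
rewrite ler_norml => /andP[+ _] /=; rewrite -/k in c1; lra.
Qed.

End scale_estimation.

(** * Probability of the good events *)

Section failure_probability.
Context d (T : measurableType d) (R : realType) (P : probability T R).
Implicit Types (A B : T -> Prop) (p q : R).

(* [A] is not assumed measurable. *)
Definition fails_le p A :=
  exists B : set T, [/\ measurable B, (P B <= p%:E)%E & forall w, ~ B w -> A w].

Lemma fails_le_imp p A A' : fails_le p A -> (forall w, A w -> A' w) -> fails_le p A'.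
Proof. by move=> [B [mB pB AB]] AA'; exists B; split => // w /AB/AA'. Qed.

Lemma fails_le_mono p q A : p <= q -> fails_le p A -> fails_le q A.
Proof.
by move=> pq [B [mB pB AB]]; exists B; split => //; apply: (le_trans pB); rewrite lee_fin.
Qed.

Lemma fails_le_and p q A B :
  fails_le p A -> fails_le q B -> fails_le (p + q) (fun w => A w /\ B w).
Proof.
move=> [A' [mA pA A1]] [B' [mB pB B1]]; exists (A' `|` B'); split.
- exact: measurableU.
- by rewrite EFinD; apply: (le_trans (measureU2 _ mA mB)); exact: leeD.
- by move=> w nw; split; [apply: A1|apply: B1] => h; apply: nw; [left|right].
Qed.

Lemma fails_le_forall n p (A : 'I_n -> T -> Prop) :
  (forall k, fails_le p (A k)) -> fails_le (n%:R * p) (fun w => forall k, A k w).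
Proof.
elim: n A => [A _|n IH A H].
  exists set0; split => //; first by rewrite measure0 mul0r.
  by move=> w _ [].
have [B [mB pB BA]] := fails_le_and (H ord0) (IH _ (fun k => H (lift ord0 k))).
exists B; split => //; first by rewrite -natr1 mulrDl mul1r addrC.
move=> w /BA[h0 h1] k; case: (unliftP ord0 k) => [j ->|->] //.
Qed.

Lemma prob_ge_of_fails_le p (E : set T) : measurable E -> fails_le p E -> ((1 - p)%:E <= P E)%E.
Proof.
move=> mE [B [mB pB BE]].
have PC : (P (~` E) <= p%:E)%E.
  apply: le_trans pB; apply: le_measure; rewrite ?inE//; first exact: measurableC.
  by move=> w nE; apply: contrapT => /BE.
have := probability_setC P mE => PE; move: PC; rewrite PE.
have := fin_num_measure P _ mE; case: (P E) => [r| |] //= _.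
  by rewrite -EFinD !lee_fin; lra.
by rewrite leey.
Qed.

Lemma fails_le_markov (X : T -> R) (a p : R) : measurable_fun [set: T] X -> (forall w, 0 <= X w) ->
  0 < a -> (\int[P]_w (X w)%:E <= (a * p)%:E)%E -> fails_le p (fun w => X w < a).
Proof.
move=> mX X0 a0 H; exists [set w | a <= X w]; split.
- by rewrite -[X in measurable X]setTI; exact: measurable_fun_le.
- exact: markov_le.
- by move=> w /= /negP; rewrite -ltNge.
Qed.

End failure_probability.

Section chi2_indicator.
Context {R : realType}.
Notation N01 := (normal_prob (0 : R) 1).

Lemma measurable_ind_sqr (q a b : R) :
  measurable_fun [set: R] (fun x : R => if x ^+ 2 <= q then a else b).
Proof.
apply: measurable_fun_ifT => //.
by apply: measurable_fun_ler => //; exact: measurable_funX.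
Qed.

Lemma expect_ind_sqr (q : R) :
  (\int[N01]_x (if (x : R) ^+ 2 <= q then 1 : R else 0)%:E = (Fchi2 q)%:E)%E.
Proof.
rewrite Fchi2E -(setIT (mkset _)) -integral_indic//; last exact: measurable_sqr_le.
apply: eq_integral => x _; rewrite indicE/=.
by case: ifPn => [h|/negP h]; [rewrite mem_set|rewrite memNset].
Qed.

Lemma expect_ind_sqrC (q : R) :
  (\int[N01]_x (if (x : R) ^+ 2 <= q then 0 : R else 1)%:E = (1 - Fchi2 q)%:E)%E.
Proof.
have mq : measurable [set x : R | x ^+ 2 <= q] by exact: measurable_sqr_le.
rewrite EFinB Fchi2E -(@probability_setC _ _ _ N01 _ mq) -(setIT (~` _)).
rewrite -integral_indic//; last exact: measurableC.
apply: eq_integral => x _; rewrite indicE/= in_setC.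
by case: ifPn => [h|/negP h]; [rewrite mem_set|rewrite memNset].
Qed.

End chi2_indicator.

(** * Markov and Chebyshev bounds for sums over the noise coordinates *)

Section gaussian_sums.
Context (d : nat) (dT : measure_display) (T : measurableType dT) (R : realType)
  (P : probability T R) (eps : 'I_d -> T -> R) (S : 'M[R]_d).
Hypothesis geps : gaussian_vector P eps S.
Hypothesis covS : covariance_matrix S.
Hypothesis S0 : forall i, 0 < S i i.
Notation N01 := (normal_prob (0 : R) 1).
Let z w i := eps i w / sig_i S i.

(** Linearity of expectation and Markov's inequality; the correlations do not enter. *)
Lemma fails_le_sum (A : pred 'I_d) (f : R -> R) (V a p : R) :
  measurable_fun [set: R] f -> (forall x, 0 <= f x) ->
  (\int[N01]_x (f x)%:E <= V%:E)%E -> 0 < a -> \sum_(i | A i) V <= a * p ->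
  fails_le P p (fun w => \sum_(i | A i) f (z w i) < a).
Proof.
move=> mf f0 fV a0 H.
have mfz i : measurable_fun [set: T] (fun w => f (z w i)).
  by apply: (@measurableT_comp _ _ _ _ _ _ f _ (stdeps eps S i)) => //; exact: (measurable_stdeps geps i).
apply: fails_le_markov => //.
- under eq_fun do rewrite big_mkcond.
  by apply: measurable_sum => i; case: (A i).
- by move=> w; apply: sumr_ge0.
- apply: (@le_trans _ _ (\sum_(i | A i) V)%:E); last by rewrite lee_fin.
  under eq_integral do rewrite -sumEFin -big_filter.
  rewrite ge0_integral_sum//; last 2 first.
    by move=> i; exact/measurable_EFinP.
    by move=> i w _; rewrite lee_fin.
  rewrite -sumEFin -[leRHS]big_filter; apply: lee_sum => i _.
  by rewrite (ge0_integral_law (stdeps_law geps covS S0 i)).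
Qed.

(** Chebyshev's inequality with the correlation bound on the variance. *)
Lemma fails_le_centred_sum (w : 'I_d -> R) (f : R -> R) (W V a p : R) :
  (forall i, 0 <= w i) -> cosL2 f -> (\int[N01]_x (f x ^+ 2)%:E <= V%:E)%E ->
  \sum_i \sum_j w i * w j * corr S i j ^+ 2 <= W -> 0 <= V -> 0 < a ->
  4 * W * V <= a ^+ 2 * p ->
  fails_le P p (fun t => `|\sum_i w i * (f (z t i) - \int[N01]_x f x)| <= a).
Proof.
move=> w0 cf fV hW V0 a0 H.
have mf : measurable_fun [set: R] f by case: cf.
have mfz i : measurable_fun [set: T] (fun t => f (z t i)).
  by apply: (@measurableT_comp _ _ _ _ _ _ f _ (stdeps eps S i)) => //; exact: (measurable_stdeps geps i).
have := variance_cosL2 (stdeps_law geps covS S0) w0 (corr_le1 covS S0) (stdeps_pair geps covS S0) cf fV.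
move=> hv.
apply: (@fails_le_imp _ _ _ P p (fun t => (\sum_i w i * (f (z t i) - \int[N01]_x f x)) ^+ 2 < a ^+ 2)).
  apply: fails_le_markov => //.
  - apply: measurable_funX; apply: measurable_sum => i.
    by apply: measurable_funM => //; apply: measurable_funB.
  - by move=> t; exact: sqr_ge0.
  - by rewrite exprn_gt0.
  - apply: (le_trans hv); rewrite lee_fin; apply: le_trans H.
    by rewrite ler_wpM2r// ler_pM2l.
move=> t h; rewrite -(@ler_pXn2r _ 2)// ?nnegrE// ?(ltW a0)//.
by rewrite real_normK ?num_real// ltW.
Qed.

(** The expected count is d eta/20, and exceeding d/4 has probability at most eta/5: the quantile
    levels eta/20 and 1 - eta/20 are set for this Markov bound. *)
Lemma fails_le_cnt_lt (q eta : R) : (0 < d)%N -> 0 < eta < 1 -> Fchi2 q = eta / 20 ->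
  fails_le P (eta / 5) (fun w => cnt (z w) q < d%:R / 4).
Proof.
move=> d0 /andP[e0 e1] qE.
apply: (@fails_le_sum predT (fun x => if x ^+ 2 <= q then 1 else 0) (eta / 20)).
- exact: measurable_ind_sqr.
- by move=> x; case: ifP.
- by rewrite expect_ind_sqr qE.
- by rewrite divr_gt0// ltr0n.
- by rewrite sumr_const card_ord -[_ *+ d]mulr_natl; lra.
Qed.

Lemma fails_le_cnt_ge (q eta : R) : (0 < d)%N -> 0 < eta < 1 -> Fchi2 q = 1 - eta / 20 ->
  fails_le P (eta / 5) (fun w => 3 / 4 * d%:R <= cnt (z w) q).
Proof.
move=> d0 /andP[e0 e1] qE.
apply: (@fails_le_imp _ _ _ P _ (fun w => \sum_(i < d) (if z w i ^+ 2 <= q then 0 : R else 1) < d%:R / 4)); last first.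
  move=> w; rewrite (_ : \sum_(i < d) _ = d%:R - cnt (z w) q); last first.
    rewrite /cnt -[X in X%:R](card_ord d) -sumr_const -sumrB; apply: eq_bigr => i _.
    by case: ifP; rewrite ?subrr ?subr0.
  by move: (cnt _ _) => x; lra.
apply: (@fails_le_sum predT (fun x => if x ^+ 2 <= q then 0 else 1) (eta / 20)).
- exact: measurable_ind_sqr.
- by move=> x; case: ifP.
- by rewrite expect_ind_sqrC qE lee_fin; lra.
- by rewrite divr_gt0// ltr0n.
- by rewrite sumr_const card_ord -[_ *+ d]mulr_natl; lra.
Qed.

Lemma frob_sqr : frob S ^+ 2 = \sum_i \sum_j S i j ^+ 2.
Proof. by rewrite sqr_sqrtr// sumr_ge0// => i _; rewrite sumr_ge0// => j _; exact: sqr_ge0. Qed.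

Lemma corr_sqr i j : S i i * S j j * corr S i j ^+ 2 = S i j ^+ 2.
Proof.
rewrite /corr -!(sig_i_sqr S0).
by field; rewrite !gt_eqF// sig_i_gt0.
Qed.

Lemma fails_le_support (theta : 'I_d -> R) (s : nat) (eta : R) : (0 < s)%N -> 0 < eta ->
  (forall i, S i i <= 1) -> sparse s theta ->
  fails_le P (eta / 10) (fun w => \sum_(i | theta i != 0) eps i w ^+ 2 <= 160 / eta * s%:R).
Proof.
move=> s0 e0 S1 sp.
have sR : 0 < @GRing.natmul R 1 s by rewrite ltr0n.
apply: (@fails_le_imp _ _ _ P _ (fun w => \sum_(i | theta i != 0) z w i ^+ 2 < 160 / eta * s%:R)).
  apply: (@fails_le_sum _ (fun x => x ^+ 2) 16).
  - exact: measurable_funX.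
  - by move=> x; exact: sqr_ge0.
  - exact: expect_sqr_le.
  - by rewrite mulr_gt0// divr_gt0.
  - apply: (@le_trans _ _ (s%:R * 16)); first exact: (sum_supp_le sp).
    by have -> : 160 / eta * s%:R * (eta / 10) = s%:R * 16 by field; rewrite gt_eqF.
move=> w /ltW; apply: le_trans; apply: ler_sum => i _.
have -> : eps i w = sig_i S i * z w i by rewrite /z mulrC divfK// gt_eqF// sig_i_gt0.
by rewrite exprMn (sig_i_sqr S0) ler_piMl ?sqr_ge0.
Qed.

(** With unit weights, variances at least [cstar] give squared correlations at most
    [S i j ^+ 2 / cstar ^+ 2], which sum to F^2/cstar^2. So the count deviates by order F. *)
Lemma fails_le_cnt (cstar A p x : R) : 0 < cstar -> (forall i, cstar <= S i i) ->
  0 < frob S -> 0 < A -> 4 <= cstar ^+ 2 * A ^+ 2 * p -> 0 < x ->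
  fails_le P p (fun w => `|cnt (z w) x - d%:R * Fchi2 x| <= A * frob S).
Proof.
move=> c0 Sc F0 A0 H x0.
have F2 : 0 < frob S ^+ 2 by rewrite exprn_gt0.
apply: (@fails_le_imp _ _ _ P _ (fun w =>
    `|\sum_i 1 * ((if z w i ^+ 2 <= x then 1 else 0) - \int[N01]_y (if (y : R) ^+ 2 <= x then 1 else 0))| <= A * frob S)).
  apply: (@fails_le_centred_sum (fun=> 1) (fun y => if y ^+ 2 <= x then 1 else 0) (frob S ^+ 2 / cstar ^+ 2) 1).
  - by [].
  - exact: cosL2_indicator.
  - rewrite (eq_integral (fun y : measurableTypeR R => (if (y : R) ^+ 2 <= x then 1 : R else 0)%:E)).
      by rewrite expect_ind_sqr Fchi2E probability_le1//; exact: measurable_sqr_le.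
    by move=> y _; case: ifP; rewrite ?expr1n ?expr0n.
  - rewrite frob_sqr mulr_suml; apply: ler_sum => i _; rewrite mulr_suml; apply: ler_sum => j _.
    rewrite !mul1r -corr_sqr ler_pdivlMr ?exprn_gt0// mulrC ler_wpM2r ?sqr_ge0//.
    by rewrite expr2 ler_pM// ltW.
  - by [].
  - by rewrite mulr_gt0.
  - rewrite mulr1 exprMn mulrA ler_pdivrMr ?exprn_gt0//.
    have -> : A ^+ 2 * frob S ^+ 2 * p * cstar ^+ 2 = cstar ^+ 2 * A ^+ 2 * p * frob S ^+ 2 by ring.
    by rewrite ler_pM2r.
move=> w; congr (_ <= _); congr (`| _ |).
under eq_bigr do rewrite mul1r.
by rewrite sumrB sumr_const card_ord -[_ *+ d]mulr_natl /Rintegral expect_ind_sqr.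
Qed.

Section level.
Context (s : nat) (eta : R).
Hypothesis d0 : (0 < d)%N.
Hypothesis s0 : (0 < s)%N.
Hypothesis e0 : 0 < eta.
Hypothesis S1 : forall i, S i i <= 1.
Hypothesis sF : s%:R <= frob S.
Hypothesis qlo0 : 0 < qchi (eta / 20).
Hypothesis qlohi : qchi (eta / 20) <= qchi (1 - eta / 20).
Let ta := tau eta S s.

Let sR : 0 < @GRing.natmul R 1 s. Proof. by rewrite ltr0n. Qed.
Let dR : 0 < @GRing.natmul R 1 d. Proof. by rewrite ltr0n. Qed.
Let F0 : 0 < frob S. Proof. exact: (frob_gt0 s0 sF). Qed.

Lemma fails_le_tail :
  fails_le P (eta / 10) (fun w =>
    \sum_i (if 3 * Num.sqrt (loglevel s S) <= `|z w i| then z w i ^+ 2 else 0) <=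
      160 / eta * (d%:R * expR (- (9 / 8 * loglevel s S)))).
Proof.
have L0 : 0 <= loglevel s S by apply: le_trans (loglevel_ge s0 sF).
apply: (@fails_le_imp _ _ _ P); last by move=> w; exact: ltW.
apply: (@fails_le_sum predT (fun x => if 3 * Num.sqrt (loglevel s S) <= `|x| then x ^+ 2 else 0)
    (16 * expR (- (9 / 8 * loglevel s S)))).
- by apply: measurable_tail; exact: measurable_funX.
- by move=> x; case: ifP => //; rewrite sqr_ge0.
- have -> : 9 / 8 * loglevel s S = (3 * Num.sqrt (loglevel s S)) ^+ 2 / 8.
    by rewrite exprMn sqr_sqrtr//; ring.
  by apply: expect_sqr_tail; rewrite mulr_ge0 ?sqrtr_ge0.
- by rewrite mulr_gt0 ?(mulr_gt0 dR) ?expR_gt0// divr_gt0.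
- rewrite sumr_const card_ord -[_ *+ d]mulr_natl; move: (expR _) => x.
  by have -> : 160 / eta * (d%:R * x) * (eta / 10) = d%:R * (16 * x) by field; rewrite gt_eqF.
Qed.

Lemma fails_le_annulus (r : R) : 0 < r <= 4^-1 ->
  fails_le P (eta / 10) (fun w =>
    \sum_i (if (1 - r) * ta <= `|z w i| <= (1 + r) * ta then z w i ^+ 2 else 0) <=
      10 * 1000 / eta * (d%:R * r * expR (- (ta ^+ 2 / 8)))).
Proof.
move=> /andP[r0 r4].
have := @expect_annulus R ta r (tau_ge0 _ _ _).
rewrite r4 (ltW r0) => /(_ isT).
have : 0 < (1000 : R) by rewrite ltr0n.
move: (1000 : R) => k k0 H.
apply: (@fails_le_imp _ _ _ P); last by move=> w; exact: ltW.
apply: (@fails_le_sum predT (fun x => if (1 - r) * ta <= `|x| <= (1 + r) * ta then x ^+ 2 else 0)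
    (k * r * expR (- (ta ^+ 2 / 8)))) => //.
- exact: measurable_annulus.
- by move=> x; case: ifP => //; rewrite sqr_ge0.
- by rewrite mulr_gt0 ?(mulr_gt0 (mulr_gt0 dR r0)) ?expR_gt0// divr_gt0// mulr_gt0.
- rewrite sumr_const card_ord -[_ *+ d]mulr_natl; move: (expR _) => x.
  by have -> : 10 * k / eta * (d%:R * r * x) * (eta / 10) = d%:R * (k * r * x) by field; rewrite gt_eqF.
Qed.

(** Weights at most [S i i] turn the squared correlations into squared entries of [S], of sum F^2.
    The truncated fourth moment carries exp (- tau^2/8) <= (s/F)^2, which cancels F^2 and leaves a
    deviation of order s. *)
Lemma fails_le_noise (theta : 'I_d -> R) :
  fails_le P (eta / 10) (fun w =>
    `|\sum_i (if theta i == 0 then S i i else 0) *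
       ((if ta <= `|z w i| then z w i ^+ 2 else 0) - alpha_s_eta eta S s)| <=
      (1 + 40 * 256 / eta) * s%:R).
Proof.
have := @expect_pow4_tail R ta (tau_ge0 _ _ _).
have : 0 < (256 : R) by rewrite ltr0n.
move: (256 : R) => k K0 fV.
have B1 : 0 < 40 * k / eta by rewrite divr_gt0// mulr_gt0.
have -> : alpha_s_eta eta S s = \int[N01]_x (if ta <= `|x| then x ^+ 2 else 0).
  by rewrite /Rintegral -alphaE.
apply: (@fails_le_centred_sum _ (fun x => if ta <= `|x| then x ^+ 2 else 0) (frob S ^+ 2)
   (k * expR (- (ta ^+ 2 / 8)))).
- by move=> i; case: ifP => // _; exact: ltW.
- exact: (cosL2_tail (tau_gt0 s0 sF qlo0 qlohi)).
- exact: fV.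
- rewrite frob_sqr; apply: ler_sum => i _; apply: ler_sum => j _.
  rewrite -corr_sqr ler_wpM2r ?sqr_ge0//.
  by apply: ler_pM; do ?[case: ifP => // _; exact: ltW].
- by rewrite mulr_ge0 ?expR_ge0// ltW.
- by rewrite mulr_gt0// addr_gt0.
- have /(expR_loglevel98 s0 sF)[_ H] : 9 / 8 * loglevel s S <= ta ^+ 2 / 8.
    by have := tau_sqr_ge s0 sF qlo0 qlohi; rewrite -/ta; lra.
  apply: (@le_trans _ _ (4 * k * s%:R ^+ 2)).
    have -> : 4 * k * s%:R ^+ 2 = 4 * frob S ^+ 2 * (k * (s%:R / frob S) ^+ 2).
      by field; rewrite gt_eqF.
    apply: ler_wpM2l; first by rewrite mulr_ge0 ?sqr_ge0.
    by apply: ler_wpM2l => //; exact: ltW.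
  rewrite exprMn [leRHS]mulrAC ler_pM2r ?exprn_gt0//.
  have E : 40 * k / eta * (eta / 10) = 4 * k by field; rewrite gt_eqF.
  rewrite -E ler_pM2r ?divr_gt0//; move: (40 * k / eta) B1 => b b0; nra.
Qed.

Section noise_failure.
Context (theta : 'I_d -> R) (sigma : R).
Hypothesis sg0 : 0 < sigma.
Hypothesis sp : sparse s theta.
Hypothesis sd : @GRing.natmul R 1 s <= d%:R / 4.
Let qlo := qchi (eta / 20).
Let qhi := qchi (1 - eta / 20).
Let q34 : R := qchi (3 / 4).
Let noise w := noise_part s S theta (fun i => eps i w) sigma eta.
Let good w := cnt (z w) qlo < d%:R / 4 /\ 3 / 4 * d%:R <= cnt (z w) qhi.

Lemma fails_le_noise_dense (c0 : R) : 0 < c0 -> c0 * d%:R <= frob S ->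
  fails_le P (eta / 10) (fun w => good w ->
    `|noise w| <= (160 / eta + 512 * qhi) / c0 * sigma ^+ 2 * s%:R).
Proof.
move=> c00 cF; apply: (fails_le_imp fails_le_tail) => w H [E1 E2].
apply: noise_dense => //.
by rewrite divr_ge0// ltW.
Qed.

(** The counts at the N0 + 1 grid points and at the 3/4-quantile share a budget of eta/10; the
    centred tail sum and the annulus take eta/10 each. *)
Lemma fails_le_noise_sparse (cstar A m : R) (N0 : nat) :
  let rho0 := 4 * (A + 1) / (m * qlo) in let u := frob S / d%:R in
  0 < cstar -> (forall i, cstar <= S i i) -> 0 < A ->
  4 <= cstar ^+ 2 * A ^+ 2 * (eta / (10 * N0.+2%:R)) ->
  0 < m ->
  (forall t h, 0 <= t -> 0 <= h -> t + h <= 2 * qhi + 1 -> Fchi2 t + m * h <= Fchi2 (t + h)) ->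
  2 * (qhi / qlo) <= 2 ^+ N0 ->
  (A + 1) * u <= 4^-1 -> rho0 * u <= 4^-1 -> rho0 * u <= 1 - q34 / qhi -> rho0 * u * qlo <= 2 ->
  fails_le P (3 / 10 * eta) (fun w => good w ->
    `|noise w| <= (10 * 1000 / eta * rho0 + (1 + 40 * 256 / eta) + 16 * rho0 + 16)
                  * sigma ^+ 2 * s%:R).
Proof.
move=> rho0 u c0 Sc A0 HA m0 lip HN h1 h2 h3 h4.
have q340 : 0 < q34 by apply: qchi_gt0; lra.
have u0 : 0 < u by rewrite divr_gt0.
have rho00 : 0 < rho0 by rewrite divr_gt0 ?mulr_gt0// addr_gt0.
have sg2 : 0 < sigma ^+ 2 by rewrite exprn_gt0.
have [l0 /andP[l0a l0b]] := dyadic_between (mulr_gt0 sg2 qlo0).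
(* Chebyshev's inequality is applied at the deterministic grid points, one of which equals the
   random [that]. *)
have grid := @fails_le_forall _ _ _ P N0.+1 _ _ (fun k : 'I_N0.+1 =>
   @fails_le_cnt cstar A _ (2 ^ (l0 + k%:Z) / sigma ^+ 2) c0 Sc F0 A0 HA
     (divr_gt0 (exprz_gt0 _ (ltr0n R 2)) sg2)).
have f34 := fails_le_cnt c0 Sc F0 A0 HA q340.
have r4 : 0 < rho0 * u <= 4^-1 by rewrite h2 mulr_gt0.
have := fails_le_and (fails_le_and (fails_le_and grid f34) (fails_le_noise theta)) (fails_le_annulus r4).
move/fails_le_imp => H; apply: (@fails_le_mono _ _ _ _ (N0.+1%:R * (eta / (10 * N0.+2%:R)) + eta / (10 * N0.+2%:R) + eta / 10 + eta / 10)).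
  have : (0 : R) < N0.+2%:R by rewrite ltr0n.
  rewrite -[N0.+2%:R]natr1; move: (N0.+1%:R : R) => n n0.
  rewrite le_eqVlt; apply/orP; left; apply/eqP.
  by field; rewrite gt_eqF.
apply: H => w [[[Hgrid H34] Hn] Ha] [E1 E2].
have [k tk] := that_grid d0 sg0 sp sd qlo0 E1 E2 l0b HN l0a.
have Hx := Hgrid k; rewrite -tk in Hx.
rewrite /q34 (@Fchi2_qchi R (3 / 4)) in H34; last by lra.
have [acc le_eta] := sigmaS2_accuracy d0 s0 sg0 sp sF sd qlo0 qlohi E1 E2 (ltW A0) m0 lip Hx H34 h1 h2 h3 h4.
apply: (noise_sparse d0 s0 sg0 S0 S1 sp sF sd qlo0 qlohi E1 E2 (ltW rho00) erefl h2 acc le_eta Hn _ Ha).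
exact: divr_ge0 (mulr_ge0 (ler0n R 10) (ler0n R 1000)) (ltW e0).
Qed.

End noise_failure.
End level.
End gaussian_sums.

(** * Choice of the constants *)

Lemma qchi_lt (R : realType) (p q : R) : 0 < p < 1 -> 0 < q < 1 -> p < q -> qchi p < qchi q.
Proof.
move=> p01 q01 pq; rewrite ltNge; apply/negP => /Fchi2_mono.
by rewrite !Fchi2_qchi// leNgt pq.
Qed.

Theorem theorem8 (R : realType) (cstar : R) :
  0 < cstar ->
  exists alpha : R, 0 < alpha < 1 /\
  forall eta : R, 0 < eta < 1 ->
  exists c : R, 0 < c /\
  forall (d s : nat) (sigma : R) (S : 'M[R]_d) (theta : 'I_d -> R)
    (dT : measure_display) (T : measurableType dT) (P : probability T R)
    (eps : 'I_d -> T -> R),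
    (1 <= d)%N -> (1 <= s)%N -> 0 < sigma ->
    covariance_matrix S ->
    (forall i, S i i <= 1) ->
    (forall i, cstar <= S i i) ->
    s%:R <= alpha * d%:R -> s%:R <= frob S ->
    sparse s theta ->
    gaussian_vector P eps S ->
    ((1 - eta)%:E <=
      P [set w | ((Nstar eta S s (fun i => theta i + sigma * eps i w) - l2norm theta) ^+ 2
                 <= c * sigma ^+ 2 * psi_star s S)%R])%E.
Proof.
(* With alpha = 1/4 the at most s coordinates of the support and the fewer than d/4 small noise
   coordinates together stay below half of the sample. *)
move=> cs0; exists 4^-1; split; first by lra.
move=> eta /andP[e0 e1].
have le310 : eta / 10 <= 3 / 10 * eta by lra.
have tot : eta / 5 + eta / 5 + eta / 10 + 3 / 10 * eta <= eta by lra.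
have plo : 0 < eta / 20 < 1 by lra.
have phi : 0 < 1 - eta / 20 < 1 by lra.
have p34 : 0 < @GRing.inv R 4 * 3 < 1 by lra.
rewrite mulrC in p34.
set qlo := qchi (eta / 20); set qhi := qchi (1 - eta / 20); pose q34 : R := qchi (3 / 4).
have qlo0 : 0 < qlo by exact: qchi_gt0.
have q34hi : q34 < qhi by apply: qchi_lt => //; lra.
have qlohi : qlo <= qhi by apply: ltW; apply: qchi_lt => //; lra.
have qhi0 : 0 < qhi by exact: lt_le_trans qlohi.
have b0 : 0 < 2 * qhi + 1 by lra.
have [m m0 lip] := Fchi2_lower b0.
(* N0 doublings cover the range of [that], from sigma^2 qlo to 2 sigma^2 qhi. *)
pose N0 := Num.bound (2 * (qhi / qlo)).
have HN : 2 * (qhi / qlo) <= 2 ^+ N0 by apply: ltW; exact: upper_nthrootP.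
pose p0 := eta / (10 * N0.+2%:R).
have p00 : 0 < p0 by rewrite divr_gt0// mulr_gt0// ltr0n.
(* The summand 1 gives A <= A^2, so that A^2 exceeds 4/(cstar^2 p0), as Chebyshev's inequality
   requires at level p0. *)
pose A := 1 + 4 / (cstar ^+ 2 * p0).
have cp : 0 < cstar ^+ 2 * p0 by rewrite mulr_gt0// exprn_gt0.
have A1 : 1 <= A by rewrite lerDl divr_ge0// ltW.
have A0 : 0 < A by exact: lt_le_trans A1.
have HA : 4 <= cstar ^+ 2 * A ^+ 2 * p0.
  rewrite mulrAC -ler_pdivrMl// mulrC; apply: (@le_trans _ _ A).
    by rewrite /A mulrC lerDr.
  by rewrite expr2 ler_peMl// ltW.
pose rho0 := 4 * (A + 1) / (m * qlo).
have rho00 : 0 < rho0 by rewrite divr_gt0 ?mulr_gt0// addr_gt0.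
pose d1 := 1 - q34 / qhi.
have d10 : 0 < d1 by rewrite subr_gt0 ltr_pdivrMr// mul1r.
(* One constant for which K F <= d implies all smallness conditions on u = F/d; each summand handles
   one of them. *)
pose K := 4 * (A + 1) + rho0 * (4 + d1^-1 + qlo).
have K1 : 4 * (A + 1) <= K.
  by rewrite lerDl mulr_ge0// ?(ltW rho00)// !addr_ge0// ?invr_ge0 ltW.
have Kr x : x <= 4 + d1^-1 + qlo -> rho0 * x <= K.
  move=> xle; apply: (@le_trans _ _ (rho0 * (4 + d1^-1 + qlo))); first by rewrite ler_pM2l.
  by rewrite lerDr mulr_ge0// addr_ge0// ltW.
have d1V : 0 < d1^-1 by rewrite invr_gt0.
have K2 : 4 * rho0 <= K by rewrite mulrC; apply: Kr; rewrite -addrA lerDl addr_ge0// ltW.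
have K3 : d1^-1 * rho0 <= K by rewrite mulrC; apply: Kr; rewrite addrAC lerDr addr_ge0// ltW.
have K4 : rho0 * qlo <= K by apply: Kr; rewrite lerDr addr_ge0// ltW.
have K0 : 0 < K by apply: lt_le_trans K1; rewrite mulr_gt0// addr_gt0.
pose cA := (160 / eta + 512 * qhi) / K^-1.
pose cB := 10 * 1000 / eta * rho0 + (1 + 40 * 256 / eta) + 16 * rho0 + 16.
have cA0 : 0 <= cA.
  have k0 := ler0n R 512; rewrite /cA; move: (512 : R) k0 => k k0.
  apply: divr_ge0; last by rewrite invr_ge0 ltW.
  apply: addr_ge0; last exact: mulr_ge0 k0 (ltW qhi0).
  by rewrite divr_ge0// ltW.
have cB0 : 0 <= cB.
  have k0 := ler0n R 1000; have k0' := ler0n R 256; rewrite /cB.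
  move: (1000 : R) (256 : R) k0 k0' => k k' k0 k0'.
  have := divr_ge0 k0 (ltW e0); have := divr_ge0 k0' (ltW e0).
  rewrite -[10 * k / eta]mulrA -[40 * k' / eta]mulrA.
  move: (k / eta) (k' / eta) rho0 rho00 {K K1 Kr K2 K3 K4 K0 cA cA0 cB} => x y r /ltW r0 y0 x0.
  by rewrite !addr_ge0// !mulr_ge0.
pose g := 160 / eta.
have g0 : 0 < g by rewrite divr_gt0.
pose ka := (1 + 32 * qhi) * (9 * (qhi / qlo)).
have ka0 : 0 < ka.
  have h1 : 0 < 1 + 32 * qhi by rewrite addr_gt0// mulr_gt0.
  by apply: (mulr_gt0 h1); rewrite mulr_gt0// divr_gt0.
exists (9 * (2 * g + ka + 2 * (cA + cB))); split.
  by rewrite mulr_gt0// ltr_wpDr ?mulr_ge0 ?(addr_ge0 cA0)// addr_gt0// mulr_gt0.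
move=> d s sigma S theta dT T P eps d0 s0 sg0 covS S1 Sc sd sF sp geps.
have {}sd : @GRing.natmul R 1 s <= d%:R / 4 by rewrite mulrC.
have S0 i : 0 < S i i by exact: lt_le_trans (Sc i).
have F0 : 0 < frob S := frob_gt0 s0 sF.
have dR : 0 < @GRing.natmul R 1 d by rewrite ltr0n.
apply: prob_ge_of_fails_le.
  rewrite -[X in measurable X]setTI; apply: measurable_fun_le => //.
  apply: measurable_funX; apply: measurable_funB => //.
  apply: (@measurable_Nstar R d S dT T (fun i w => theta i + sigma * eps i w)) => // i.
  by apply: measurable_funD => //; apply: measurable_funM => //; case: geps.
have scale (k k' : R) : k <= k' -> k * sigma ^+ 2 * s%:R <= k' * sigma ^+ 2 * s%:R.
  by move=> kk'; rewrite ler_wpM2r// ler_wpM2r// sqr_ge0.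
have noiseP : fails_le P (3 / 10 * eta) (fun w =>
    cnt (fun i => eps i w / sig_i S i) qlo < d%:R / 4 /\
    3 / 4 * d%:R <= cnt (fun i => eps i w / sig_i S i) qhi ->
    `|noise_part s S theta (fun i => eps i w) sigma eta| <= (cA + cB) * sigma ^+ 2 * s%:R).
  (* The two regimes are separated at c0 = 1/K. Since [cA + cB] dominates both constants, the final
     bound does not depend on the regime. *)
  have [FK|FK] := leP (K^-1 * d%:R) (frob S).
    have K'0 : 0 < K^-1 by rewrite invr_gt0.
    have H := fails_le_noise_dense geps covS S0 d0 s0 e0 S1 sF qlo0 qlohi sg0 sp sd K'0 FK.
    apply: (@fails_le_mono _ _ _ _ (eta / 10)) => //.
    apply: (fails_le_imp H) => w Hw /Hw/le_trans; apply.
    by apply: scale; rewrite lerDl.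
  pose u := frob S / d%:R.
  have u0 : 0 < u by rewrite divr_gt0.
  have Ku : K * u <= 1.
    by rewrite /u mulrA ler_pdivrMr// mul1r -ler_pdivlMl// ltW.
  have small k x : 0 < k -> k * x <= K -> x * u <= k^-1.
    move=> k0 kx; rewrite -(ler_pM2l k0) mulfV ?gt_eqF// mulrA.
    by apply: le_trans Ku; rewrite ler_pM2r.
  have H1 : (A + 1) * u <= 4^-1 by apply: small.
  have H2 : rho0 * u <= 4^-1 by apply: small.
  have H3 : rho0 * u <= d1 by rewrite -[leRHS]invrK; apply: small.
  have H4 : rho0 * u * qlo <= 2.
    rewrite mulrAC; apply: (@le_trans _ _ 1); last by rewrite ler1n.
    by apply: le_trans Ku; rewrite ler_pM2r.
  have H := fails_le_noise_sparse geps covS S0 d0 s0 e0 S1 sF qlo0 qlohi sg0 sp sd cs0 Sc A0 HA m0 lip HN H1 H2 H3 H4.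
  apply: (fails_le_imp H) => w Hw /Hw/le_trans; apply.
  by apply: scale; rewrite lerDr.
have E1 := fails_le_cnt_lt geps covS S0 d0 (introT andP (conj e0 e1)) (Fchi2_qchi plo).
have E2 := fails_le_cnt_ge geps covS S0 d0 (introT andP (conj e0 e1)) (Fchi2_qchi phi).
have E3 := fails_le_support geps covS S0 s0 e0 S1 sp.
have := fails_le_and (fails_le_and (fails_le_and E1 E2) E3) noiseP.
move/fails_le_imp => H; apply: (fails_le_mono tot); apply: H.
move=> w [[[h1 h2] h3] /(_ (conj h1 h2)) h4].
apply: risk_bound => //; [exact: ltW|exact: addr_ge0|].
exact: threshold_le.
Qed.
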